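(* Assume that $X$ is of Pareto-type with index $\alpha\in(0,1)$ and that the counting process $\{N(t);\,t\geq 0\}$ $\mathcal{D}$-averages in time to the random variable $\Lambda$. Then $$\frac{\widehat{\mathrm{CoVar}(X)}}{\sqrt{N(t)}}\stackrel{\mathcal{D}}{\longrightarrow}\frac{\sqrt{U_\alpha}}{V_\alpha}\quad\text{as } t\rightarrow\infty,$$ where the joint distribution of the random vector $(U_\alpha,V_\alpha)^\prime$ is determined by $$\mathbb{E}\left\{e^{-rU_\alpha-sV_\alpha}\right\}=\mathbb{E}\left\{e^{-\delta_\alpha(r,s)\,\Lambda}\right\},\quad r>0,\ s\geq 0,$$ with $$\delta_\alpha(r,s):=2\,e^{\frac{s^2}{4r}}\int_0^\infty e^{-\left(u+\frac{s}{2\sqrt r}\right)^2}\left(u+\frac{s}{2\sqrt r}\right)\left(\frac{u}{\sqrt r}\right)^{-\alpha}du .$$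
   Context: $X$ is a positive random variable with distribution function $F$; $X_1,X_2,\ldots$ are i.i.d. copies of $X$; $\{N(t);\,t\geq 0\}$ is a counting process (nonnegative integer-valued, nondecreasing in $t$) independent of the $X_i$'s. The sample coefficient of variation based on $X_1,\ldots,X_{N(t)}$ is $\widehat{\mathrm{CoVar}(X)}:=S/\overline X$, where $\overline X:=\frac{1}{N(t)}\sum_{i=1}^{N(t)}X_i$ and $S\ge0$ with $S^2:=\frac{1}{N(t)}\sum_{i=1}^{N(t)}(X_i-\overline X)^2$; on $\{N(t)=0\}$ it, and its quotient by $\sqrt{N(t)}$, are set to $0$. $X$ (or $F$) is of Pareto-type with index $\alpha>0$ if $1-F(x)\sim x^{-\alpha}\ell(x)$ as $x\to\infty$ for a slowly varying function $\ell$. The counting process $\mathcal{D}$-averages in time to $\Lambda$ if $N(t)/t\stackrel{\mathcal{D}}{\longrightarrow}\Lambda$ (convergence in distribution) as $t\to\infty$, where $\mathbb{P}[\Lambda>0]=1$. *)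

(* Defs.v *)
From HB Require Import structures.
From mathcomp Require Import all_boot all_order all_algebra finmap.
From mathcomp Require Import all_classical all_reals all_analysis.

Set Implicit Arguments.
Unset Strict Implicit.
Unset Printing Implicit Defensive.
Import Order.TTheory GRing.Theory Num.Theory.
Import numFieldNormedType.Exports.

Local Open Scope classical_set_scope.
Local Open Scope ring_scope.

Section tails.
Context {R : realType}.

Definition slowly_varying (l : R -> R) :=
  (exists a : R, [/\ 0 < a, measurable_fun `[a, +oo[ l &
                     forall x, a <= x -> 0 < l x]) /\
  forall k : R, 0 < k -> l (k * x) / l x @[x --> +oo] --> (1 : R).

Definition pareto_type d (T : measurableType d) (P : probability T R)
    (X : {RV P >-> R}) (alpha : R) :=
  exists2 l : R -> R, slowly_varying l &
    (1 - fine (cdf X x)) / (x `^ (- alpha) * l x) @[x --> +oo] --> (1 : R).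

End tails.

Section processes.
Context {R : realType} {d} {T : measurableType d} (P : probability T R).

Definition mutually_independent (X : nat -> {RV P >-> R}) :=
  forall (J : {fset nat}) (B : nat -> set R), (forall i, measurable (B i)) ->
    P (\bigcap_(i in [set` J]) X i @^-1` B i) =
    (\prod_(i <- J) P (X i @^-1` B i))%E.

Definition iid_copies (X : {RV P >-> R}) (Xs : nat -> {RV P >-> R}) :=
  mutually_independent Xs /\
  forall i B, measurable B -> distribution P (Xs i) B = distribution P X B.

Definition generated_sigma I d' (T' : measurableType d') (D : set I)
    (Y : I -> T -> T') : set (set T) :=
  <<s \bigcup_(i in D) preimage_set_system setT (Y i) measurable >>.

(* Time runs over [0, +oo[; the values of N at negative times are irrelevant. *)
Definition counting_process (N : R -> {RV P >-> nat}) :=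
  forall s t w, 0 <= s -> s <= t -> (N s w <= N t w)%N.

Definition independent_of_sequence (N : R -> {RV P >-> nat})
    (X : nat -> {RV P >-> R}) :=
  forall A B,
    generated_sigma [set t : R | 0 <= t] (fun t => N t : T -> nat) A ->
    generated_sigma setT (fun i => X i : T -> R) B ->
    P (A `&` B) = (P A * P B)%E.

End processes.

(* Y t converges in distribution to Z as t --> +oo; the limit Z may live on
   another probability space. *)
Definition cvg_in_distribution {R : realType}
    {d} {T : measurableType d} (P : probability T R) (Y : R -> T -> R)
    {d'} {T' : measurableType d'} (P' : probability T' R) (Z : T' -> R) :=
  forall f : R -> R, continuous f -> (exists M : R, forall x, `|f x| <= M) ->
    ('E_P[f \o Y t] @[t --> +oo%R] --> 'E_P'[f \o Z])%E.

Definition averages_in_time {R : realType}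
    {d} {T : measurableType d} (P : probability T R) (N : R -> {RV P >-> nat})
    {d'} {T' : measurableType d'} (P' : probability T' R)
    (Lambda : {RV P' >-> R}) :=
  P' [set w | 0 < Lambda w] = 1%E /\
  cvg_in_distribution P (fun t w => (N t w)%:R / t) P' Lambda.

Section sample.
Context {R : realType}.

(* The sample x 0, ..., x n.-1. Division by 0 yields 0 here, so that for n = 0
   the three quantities below, and sample_CoVar n x / sqrt n, are equal to 0. *)
Definition sample_mean (n : nat) (x : nat -> R) : R :=
  n%:R^-1 * \sum_(i < n) x i.

Definition sample_sd (n : nat) (x : nat -> R) : R :=
  Num.sqrt (n%:R^-1 * \sum_(i < n) (x i - sample_mean n x) ^+ 2).

Definition sample_CoVar (n : nat) (x : nat -> R) : R :=
  sample_sd n x / sample_mean n x.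

Definition delta (alpha r s : R) : R :=
  2 * expR (s ^+ 2 / (4 * r)) *
  \int[lebesgue_measure]_(u in `]0, +oo[)
    (expR (- (u + s / (2 * Num.sqrt r)) ^+ 2) * (u + s / (2 * Num.sqrt r)) *
     (u / Num.sqrt r) `^ (- alpha)).

(* U and V are not required to be nonnegative: for Lambda > 0 a.s. the
   right-hand side is at most 1; letting r --> +oo with s = 0, resp. r --> 0 and
   then s --> +oo, this forces U >= 0, resp. V >= 0, almost surely. *)
Definition has_limit_transform (alpha : R)
    d' (T' : measurableType d') (P' : probability T' R) (Lambda : T' -> R)
    d (T : measurableType d) (P : probability T R) (U V : T -> R) :=
  forall r s : R, 0 < r -> 0 <= s ->
    ('E_P[fun w => expR (- r * U w - s * V w)] =
     'E_P'[fun w => expR (- delta alpha r s * Lambda w)])%E.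

End sample.

(* Main.v *)
Require Import Defs.
From HB Require Import structures.
From mathcomp Require Import all_boot all_order all_algebra finmap.
From mathcomp Require Import all_classical all_reals all_analysis.
From mathcomp Require Import measurable_realfun zify ring lra.

Set Implicit Arguments.
Unset Strict Implicit.
Unset Printing Implicit Defensive.
Import Order.TTheory GRing.Theory Num.Theory.
Import numFieldNormedType.Exports.

Local Open Scope classical_set_scope.
Local Open Scope ring_scope.

(** Divide the observations by a level [a_n] with [t_n P(X > a_n) --> 1], and let
    [U_n] and [V_n] be the sums of the squares and of the values of the first
    [N(t_n)] scaled observations. For a positive sample of size [N >= 1] the
    squared quotient of the coefficient of variation by [sqrt N] is
    [U_n / V_n ^ 2 - 1 / N], so that it differs from [sqrt U_n / V_n] by at most
    [N ^ (-1/2)] ([sample_ratio_close]); this is negligible, because [N / t_n]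
    has a positive limit ([cvg_mean_inv_count]). What remains is the joint limit
    of [(U_n, V_n)], and three arguments give it.

    - Transforms. By independence [E exp (- r U_n - s V_n) = E (rho_n ^ N)], where
      [rho_n] is the transform of one observation ([mean_random_product]).
      Integrating the tail of [X] against the derivative of
      [exp (- (r x^2 + s x))] ([gauss_layer_cake]), regular variation of the
      tail, with a Potter bound as a dominating function, gives
      [t_n (1 - rho_n) --> delta alpha r s] ([cvg_laplace_tail]), hence the limit
      [E exp (- delta alpha r s * Lambda)] ([cvg_process_transform]).

    - From transforms to laws. The pair [(exp (- U), exp (- V))] lives in the
      unit square, and the transform at integer points gives its moments
      [E (X ^ (a+1) Y ^ b)]. Bernstein polynomials turn convergence of these
      moments into convergence of [E (X g (X, Y))] for all continuous [g]
      ([cvg_weighted_mean]). The behaviour of [delta] near the origin and for large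
      [s] shows that the limit puts no mass where [U] is infinite or where [V] is
      [0] or infinite, so that test functions continuous only inside the square
      may be used ([cvg_mean_interior]). For a constant sequence this is
      uniqueness of the law ([limit_law_unique]); for [f (sqrt U / V)] it is the
      convergence of the ratio ([cvg_mean_ratio]).

    - Existence. The binary digits of [exp (- U_n)] and [exp (- V_n)],
      interleaved, form a random sequence of bits. Along an ultrafilter the
      probabilities of all finite words converge, and a tree of nested intervals
      realises the limiting probabilities on [0, 1[ with the uniform law
      ([bits_cluster]). Reading the bits back yields a pair with the required
      moments ([cluster_pair], [exists_limit_law]). *)

(** * Means of bounded functions *)

(** On a probability space these functions have means without any integrability
    condition, and they are stable under the algebraic operations. *)
Definition bounded_measurable {R : realType} d (T : measurableType d)
    (f : T -> R) :=
  measurable_fun setT f /\ exists M : R, forall x, `|f x| <= M.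

Section mean_of_bounded.
Context {R : realType} d (T : measurableType d) (P : probability T R).
Implicit Types f g : T -> R.
Local Notation bmeas := (@bounded_measurable R d T).
Local Notation E := (Rintegral P setT).

Lemma bmeas_integrable f : bmeas f -> P.-integrable setT (EFin \o f).
Proof.
move=> [mf [M fM]]; apply: measurable_bounded_integrable => //.
  by rewrite -ge0_fin_numE// fin_num_measure.
exists M; split; first exact: num_real.
by move=> x Mx y _ /=; rewrite (le_trans (fM y))// ltW.
Qed.

Lemma bmeas_cst (c : R) : bmeas (fun=> c).
Proof. by split; [exact: measurable_cst | exists `|c|]. Qed.

Lemma bmeasD f g : bmeas f -> bmeas g -> bmeas (fun x => f x + g x).
Proof.
move=> [mf [M fM]] [mg [N gN]]; split; first exact: measurable_funD.
by exists (M + N) => x; rewrite (le_trans (ler_normD _ _))// lerD.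
Qed.

Lemma bmeasM f g : bmeas f -> bmeas g -> bmeas (fun x => f x * g x).
Proof.
move=> [mf [M fM]] [mg [N gN]]; split; first exact: measurable_funM.
by exists (M * N) => x; rewrite normrM ler_pM.
Qed.

Lemma bmeasB f g : bmeas f -> bmeas g -> bmeas (fun x => f x - g x).
Proof.
move=> mf mg.
have := bmeasD mf (bmeasM (bmeas_cst (-1)) mg).
by congr bmeas; apply/funext => x; rewrite mulN1r.
Qed.

Lemma bmeasX f n : bmeas f -> bmeas (fun x => f x ^+ n).
Proof.
move=> bf; elim: n => [|n IH]; first exact: bmeas_cst.
rewrite (_ : (fun w => _) = fun w => f w * f w ^+ n); first exact: bmeasM.
by apply/funext => w; rewrite exprS.
Qed.

Lemma bmeas_norm f : bmeas f -> bmeas (fun x => `|f x|).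
Proof.
move=> [mf [M fM]]; split; first exact: measurableT_comp.
by exists M => x; rewrite normr_id.
Qed.

Lemma bmeas_le01 f : measurable_fun setT f -> (forall x, 0 <= f x <= 1) ->
  bmeas f.
Proof.
by move=> mf f01; split=> //; exists 1 => x; have /andP[? ?] := f01 x;
  rewrite ger0_norm.
Qed.

Lemma bmeas_exp_rate (c : R) f : 0 <= c -> measurable_fun setT f ->
  (forall x, 0 <= f x) -> bmeas (fun x => expR (- (c * f x))).
Proof.
move=> c0 mf f0; apply: bmeas_le01.
  apply: measurableT_comp => //; apply: measurableT_comp => //.
  by apply: measurable_funM => //; exact: measurable_cst.
by move=> x; rewrite expR_ge0 expR_le1 oppr_le0 mulr_ge0.
Qed.

Lemma bmeas_bool (b : T -> bool) : measurable_fun setT b ->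
  bmeas (fun x => (b x)%:R).
Proof.
move=> mb; apply: bmeas_le01; last by move=> x; case: (b x); rewrite ?lexx ?ler01.
rewrite (_ : (fun x => _) = fun x => if b x then 1 else 0).
  by apply: measurable_fun_ifT => //; exact: measurable_cst.
by apply/funext => x; case: (b x).
Qed.

Lemma bmeas_continuous (h : R -> R) f : continuous h ->
  (exists M : R, forall x, `|h x| <= M) -> measurable_fun setT f ->
  bmeas (fun x => h (f x)).
Proof.
move=> ch [M hM] mf; split; last by exists M => x.
exact: (measurableT_comp (continuous_measurable_fun ch) mf).
Qed.

Lemma expectation_bmeas f : bmeas f -> ('E_P[f] = (E f)%:E)%E.
Proof.
move=> mf; rewrite unlock /Rintegral fineK//.
exact: integrable_fin_num (bmeas_integrable mf).
Qed.

Lemma meanD f g : bmeas f -> bmeas g -> E (fun x => f x + g x) = E f + E g.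
Proof. by move=> mf mg; rewrite RintegralD//; exact: bmeas_integrable. Qed.

Lemma meanB f g : bmeas f -> bmeas g -> E (fun x => f x - g x) = E f - E g.
Proof. by move=> mf mg; rewrite RintegralB//; exact: bmeas_integrable. Qed.

Lemma meanZ c f : bmeas f -> E (fun x => c * f x) = c * E f.
Proof. by move=> mf; rewrite RintegralZl//; exact: bmeas_integrable. Qed.

Lemma mean_cst c : E (fun=> c) = c.
Proof.
have PT : fine (P setT) = 1 by rewrite (probability_setT P).
by rewrite Rintegral_cst// [X in _ * X]PT mulr1.
Qed.

Lemma le_mean f g : bmeas f -> bmeas g -> (forall x, f x <= g x) -> E f <= E g.
Proof.
by move=> mf mg fg; apply: le_Rintegral => //; exact: bmeas_integrable.
Qed.

Lemma eq_mean f g : f =1 g -> E f = E g.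
Proof. by move=> fg; congr Rintegral; apply/funext. Qed.

Lemma bmeas_sum (I : Type) (s : seq I) (h : I -> T -> R) :
  (forall i, bmeas (h i)) -> bmeas (fun x => \sum_(i <- s) h i x).
Proof.
move=> bh; elim: s => [|i s IH].
  by under eq_fun do rewrite big_nil; exact: bmeas_cst.
by under eq_fun do rewrite big_cons; exact: bmeasD.
Qed.

Lemma mean_sum (I : Type) (s : seq I) (h : I -> T -> R) :
  (forall i, bmeas (h i)) ->
  E (fun x => \sum_(i <- s) h i x) = \sum_(i <- s) E (h i).
Proof.
move=> bh; elim: s => [|i s IH].
  by under eq_fun do rewrite big_nil; rewrite mean_cst big_nil.
under eq_fun do rewrite big_cons; rewrite big_cons -IH meanD//.
exact: bmeas_sum.
Qed.

Lemma mean_ge0 f : (forall x, 0 <= f x) -> 0 <= E f.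
Proof. by move=> f0; apply: Rintegral_ge0 => x _. Qed.

Lemma mean_indic (A : set T) : measurable A -> E \1_A = fine (P A).
Proof. by move=> mA; rewrite /Rintegral integral_indic// setIT. Qed.

Lemma mean_le1 f : bmeas f -> (forall x, f x <= 1) -> E f <= 1.
Proof. by move=> mf f1; rewrite -(mean_cst 1); apply: le_mean => //; exact: bmeas_cst. Qed.

Lemma le_norm_mean f : bmeas f -> `|E f| <= E (fun x => `|f x|).
Proof. by move=> mf; apply: le_normr_Rintegral => //; exact: bmeas_integrable. Qed.

Lemma dist_mean f g h : bmeas f -> bmeas g -> bmeas h ->
  (forall x, `|f x - g x| <= h x) -> `|E f - E g| <= E h.
Proof.
move=> mf mg mh fgh; rewrite -meanB//.
apply: le_trans (le_norm_mean (bmeasB mf mg)) _.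
by apply: le_mean => //; exact/bmeas_norm/bmeasB.
Qed.

Lemma ae_of_prob1 (A : set T) : measurable A -> P A = 1%E ->
  {ae P, forall x, A x}.
Proof.
move=> mA PA; exists (~` A); split => //; first exact: measurableC.
by rewrite probability_setC// PA subee.
Qed.

Lemma ae_gt0 f : measurable_fun setT f -> P [set x | 0 < f x] = 1%E ->
  {ae P, forall x, 0 < f x}.
Proof.
move=> mf; apply: ae_of_prob1.
rewrite (_ : [set x | _] = f @^-1` `]0, +oo[%classic).
  by rewrite -[X in measurable X]setTI; apply: mf => //; exact: measurable_itv.
by apply/seteqP; split => x /=; rewrite in_itv/= andbT.
Qed.

Lemma ae_eq_mean f g : measurable_fun setT f -> measurable_fun setT g ->
  {ae P, forall x, f x = g x} -> E f = E g.
Proof.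
move=> mf mg fg; congr fine; apply: ae_eq_integral => //.
- exact/measurable_EFinP.
- exact/measurable_EFinP.
- by apply: filterS fg => x fgx _ /=; rewrite fgx.
Qed.

Lemma mean_eq0_ae f : bmeas f -> (forall x, 0 <= f x) -> E f = 0 ->
  {ae P, forall x, f x = 0}.
Proof.
move=> bf f0 Ef; have := expectation_bmeas bf; rewrite Ef unlock => intf.
have mf : measurable_fun setT (EFin \o f) by apply/measurable_EFinP; case: bf.
have [h _] := ae_eq_integral_abs P measurableT mf.
have /h hae : (\int[P]_x `|(EFin \o f) x| = 0)%E.
  by rewrite -[RHS]intf; apply: eq_integral => x _ /=; rewrite ger0_norm.
by apply: filterS hae => x /(_ Logic.I) /= [].
Qed.

Lemma eq_mean_on (A : set T) f g : measurable A -> P A = 1%E ->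
  measurable_fun setT f -> measurable_fun setT g ->
  (forall x, A x -> f x = g x) -> E f = E g.
Proof.
move=> mA PA mf mg fg; apply: ae_eq_mean => //.
by apply: filterS (ae_of_prob1 mA PA).
Qed.

(** The maximum of [f] and [g] equals [g] almost everywhere and dominates [f]
    everywhere. *)
Lemma ae_le_mean f g : bmeas f -> bmeas g ->
  {ae P, forall x, f x <= g x} -> E f <= E g.
Proof.
move=> mf mg fg.
have mM : bmeas (fun x => Num.max (f x) (g x)).
  case: mf mg => [mf [M fM]] [mg [N gN]]; split; first exact: measurable_maxr.
  exists (Num.max M N) => x; rewrite le_max.
  by case: (leP (f x) (g x)) => _; [rewrite gN orbT | rewrite fM].
rewrite (_ : E g = E (fun x => Num.max (f x) (g x))).
  by apply: le_mean => // x; rewrite le_max lexx.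
apply: ae_eq_mean; [by case: mg | by case: mM |].
by apply: filterS fg => x fgx; rewrite max_r.
Qed.

Lemma bounded_convergence (f_ : nat -> T -> R) f (M : R) :
  (forall n, measurable_fun setT (f_ n)) -> (forall n x, `|f_ n x| <= M) ->
  measurable_fun setT f ->
  {ae P, forall x, f_ n x @[n --> \oo] --> f x} ->
  E (f_ n) @[n --> \oo] --> E f.
Proof.
move=> mf_ fM mf fcvg.
have [|||||fint _ cvf] := @dominated_convergence _ _ _ P setT measurableT
  (fun n => EFin \o f_ n) (EFin \o f) (EFin \o (fun=> M)).
- by move=> n; exact/measurable_EFinP.
- exact/measurable_EFinP.
- apply: filterS fcvg => x fx _; apply/fine_cvgP; split; last exact: fx.
  by apply: nearW => n.
- by apply: bmeas_integrable; exact: bmeas_cst.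
- by apply: aeW => x n _ /=; rewrite lee_fin.
rewrite /Rintegral; apply: fine_cvg.
rewrite fineK//; exact: integrable_fin_num.
Qed.

End mean_of_bounded.

Section limits.
Context {R : realType}.

(** The three-epsilon argument: [v] and its limit may depend on the accuracy
    [e], as polynomial or truncated approximations of a mean do. *)
Lemma cvg_up_to (U : Type) (F : set_system U) {FF : Filter F} (u : U -> R) l :
  (forall e : R, 0 < e -> exists v l', [/\ v x @[x --> F] --> l',
     \forall x \near F, `|u x - v x| <= e & `|l - l'| <= e]) ->
  u x @[x --> F] --> l.
Proof.
move=> H; apply/cvgrPdist_le => e e0.
have e3 : 0 < e / 3 by rewrite divr_gt0.
have [v [l' [vl' uv ll']]] := H _ e3.
move/cvgrPdist_le : vl' => /(_ _ e3) vl'.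
near=> x.
have -> : l - u x = (l - l') + (l' - v x) + (v x - u x) by ring.
have -> : e = e / 3 + e / 3 + e / 3 by field.
rewrite (le_trans (ler_normD _ _))// lerD//; last first.
  by rewrite distrC; near: x.
by rewrite (le_trans (ler_normD _ _))// lerD//; near: x.
Unshelve. all: by end_near. Qed.

Lemma cvg_eq (U : Type) (F : set_system U) (u v : U -> R) (l l' : R) :
  u =1 v -> l = l' -> u x @[x --> F] --> l -> v x @[x --> F] --> l'.
Proof. by move=> /funext -> ->. Qed.

Lemma cvg_finite_sum (U I : Type) (F : set_system U) {FF : Filter F}
    (s : seq I) (u : I -> U -> R) (l : I -> R) :
  (forall i, u i x @[x --> F] --> l i) ->
  \sum_(i <- s) u i x @[x --> F] --> \sum_(i <- s) l i.
Proof.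
move=> ul; elim: s => [|i s IH].
  rewrite big_nil (_ : (fun x => _) = fun=> 0); first exact: cvg_cst.
  by apply/funext => x; rewrite big_nil.
rewrite big_cons (_ : (fun x => _) = fun x => u i x + \sum_(j <- s) u j x).
  by apply: cvgD.
by apply/funext => x; rewrite big_cons.
Qed.

End limits.

Section ramp.
Context {R : realType}.

Definition ramp (k c z : R) : R := Num.min (Num.max (k * (z - c)) 0) 1.

Lemma ramp01 k c z : 0 <= ramp k c z <= 1.
Proof. by rewrite /ramp le_min le_max lexx orbT ler01 ge_min lexx orbT. Qed.

Lemma ramp_le0 k c z : 0 <= k -> z <= c -> ramp k c z = 0.
Proof.
by move=> k0 zc; rewrite /ramp max_r ?min_l// mulr_ge0_le0// subr_le0.
Qed.

Lemma ramp_ge1 k c z : 1 <= k * (z - c) -> ramp k c z = 1.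
Proof. by move=> h; rewrite /ramp max_l ?min_r// (le_trans ler01). Qed.

Lemma continuous_ramp k c : continuous (ramp k c).
Proof.
move=> z; apply: (@continuous_min _ _ (fun z => Num.max (k * (z - c)) 0) (fun=> 1)).
  apply: (@continuous_max _ _ (fun z => k * (z - c)) (fun=> 0)); last exact: cvg_cst.
  by apply: cvgMl_tmp; apply: (@cvgB _ R^o); [exact: cvg_id | exact: cvg_cst].
exact: cvg_cst.
Qed.

End ramp.

(** * Bernstein approximation on the square *)

Section quadratic_modulus.
Context {R : realType}.

(** Uniform continuity on the unit square, with the modulus in a form that is
    linear in the squared distance: a mean of the right-hand side is a
    variance, which is all that the Bernstein operator and digit approximations
    need. *)
Definition quadratic_modulus (g : R -> R -> R) :=
  forall e : R, 0 < e -> exists2 C : R, 0 <= C &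
  forall x y x' y' : R, 0 <= x <= 1 -> 0 <= y <= 1 -> 0 <= x' <= 1 ->
    0 <= y' <= 1 ->
    `|g x y - g x' y'| <= e + C * ((x - x') ^+ 2 + (y - y') ^+ 2).

(** The sets where [|g z - g z'| < e + n |z - z'|^2] increase with [n] and
    cover the compact square of the unit square, since on the diagonal the
    left-hand side is [0]. *)
Lemma continuous_quadratic_modulus (g : R -> R -> R) :
  continuous (fun p : R * R => g p.1 p.2) -> quadratic_modulus g.
Proof.
move=> cg e e0.
pose K : set (R * R) := `[0, 1]%classic `*` `[0, 1]%classic.
have cK : compact (K `*` K).
  by apply: compact_setX; apply: compact_setX; exact: segment_compact.
pose G (z : (R * R) * (R * R)) := `|g z.1.1 z.1.2 - g z.2.1 z.2.2|.
pose D (z : (R * R) * (R * R)) :=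
  (z.1.1 - z.2.1) * (z.1.1 - z.2.1) + (z.1.2 - z.2.2) * (z.1.2 - z.2.2).
have cg1 : continuous (fun z : (R * R) * (R * R) => g z.1.1 z.1.2).
  move=> z; apply: (@continuous_comp _ _ _ fst (fun p : R * R => g p.1 p.2)).
    exact: cvg_fst.
  exact: cg.
have cg2 : continuous (fun z : (R * R) * (R * R) => g z.2.1 z.2.2).
  move=> z; apply: (@continuous_comp _ _ _ snd (fun p : R * R => g p.1 p.2)).
    exact: cvg_snd.
  exact: cg.
have cG : continuous G.
  move=> z; apply: (@continuous_comp _ _ _
    (fun z : (R * R) * (R * R) => g z.1.1 z.1.2 - g z.2.1 z.2.2) Num.norm).
    by apply: continuousB; [exact: cg1 | exact: cg2].
  exact: (@norm_continuous _ R^o).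
have cd1 : continuous (fun z : (R * R) * (R * R) => z.1.1 - z.2.1).
  by move=> z; apply: (@cvgB _ R^o); apply: continuous_comp;
    [exact: cvg_fst | exact: cvg_fst | exact: cvg_snd | exact: cvg_fst].
have cd2 : continuous (fun z : (R * R) * (R * R) => z.1.2 - z.2.2).
  by move=> z; apply: (@cvgB _ R^o); apply: continuous_comp;
    [exact: cvg_fst | exact: cvg_snd | exact: cvg_snd | exact: cvg_snd].
have cD : continuous D.
  by move=> z; apply: (@cvgD _ R^o); apply: cvgM; [exact: cd1 | exact: cd1 | exact: cd2 | exact: cd2].
have D0 z : 0 <= D z by rewrite addr_ge0// -expr2 sqr_ge0.
have H : \forall n \near \oo, K `*` K `<=` [set z | G z < e + n%:R * D z].
  apply: ((compact_near_coveringP _).1 cK nat _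
    (fun n z => G z < e + n%:R * D z) _) => z _.
  have [Gz|Gz] := ltP (G z) e.
    have : \forall z' \near z, G z' < e.
      exact: (cvgr_lt _ (cG z)).
    move=> Ge; near=> z' n => /=.
    rewrite (@lt_le_trans _ _ e)//; first by near: z'.
    by rewrite lerDl mulr_ge0.
  have Dz : 0 < D z.
    rewrite lt_neqAle D0 andbT eq_sym; apply/eqP => Dz.
    move: Gz; rewrite leNgt => /negP; apply.
    move: Dz; rewrite /D -!expr2 => /eqP; rewrite paddr_eq0 ?sqr_ge0//.
    by rewrite !sqrf_eq0 !subr_eq0 /G => /andP[/eqP -> /eqP ->]; rewrite subrr normr0.
  have nG : \forall z' \near z, G z' < G z + 1.
    by apply: (cvgr_lt _ (cG z)); rewrite ltrDl.
  have nD : \forall z' \near z, D z / 2 < D z'.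
    by apply: (cvgr_gt _ (cD z)); rewrite ltr_pdivrMr// ltr_pMr// ltr1n.
  near=> z' n => /=.
  rewrite (@lt_trans _ _ (G z + 1))//; first by near: z'.
  rewrite -[ltLHS]add0r ltr_leD//.
  rewrite (@le_trans _ _ (n%:R * (D z / 2)))//.
    by rewrite -ler_pdivrMr ?divr_gt0//; near: n; exact: nbhs_infty_ger.
  by rewrite ler_wpM2l// ltW//; near: z'.
have [n _ /(_ n (leqnn n)) Hn] := H.
exists n%:R => // x y x' y' x01 y01 x01' y01'.
have /= := Hn ((x, y), (x', y')); rewrite /G /D/= -!expr2 => h.
by apply/ltW/h; split; split => /=; rewrite in_itv/=.
Unshelve. all: by end_near. Qed.

End quadratic_modulus.

Section bernstein.
Context {R : realType}.
Implicit Types (x y : R) (f g : nat -> R).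

(** The mean of [f B] for [B] binomial with parameters [n] and [x], computed by
    conditioning on the first trial; all the identities below follow by
    induction without binomial coefficients. *)
Fixpoint bernstein n x f : R :=
  if n is n'.+1 then
    x * bernstein n' x (f \o succn) + (1 - x) * bernstein n' x f
  else f 0.

Lemma le_bernstein n x f g : 0 <= x <= 1 ->
  (forall j, (j <= n)%N -> f j <= g j) -> bernstein n x f <= bernstein n x g.
Proof.
move=> /andP[x0 x1]; elim: n f g => [|n IH] f g fg /=; first exact: fg.
apply: lerD; apply: ler_wpM2l => //; rewrite ?subr_ge0//; apply: IH => j jn.
  exact: fg.
by apply: fg; rewrite (leq_trans jn).
Qed.

Lemma bernsteinD n x f g :
  bernstein n x (fun j => f j + g j) = bernstein n x f + bernstein n x g.
Proof. by elim: n f g => [//|n IH] f g /=; rewrite /comp !IH; ring. Qed.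

Lemma bernsteinZ n x c f :
  bernstein n x (fun j => c * f j) = c * bernstein n x f.
Proof. by elim: n f => [//|n IH] f /=; rewrite /comp !IH; ring. Qed.

Lemma bernstein_cst n x c : bernstein n x (fun=> c) = c.
Proof. by elim: n => [//|n IH] /=; rewrite /comp !IH; ring. Qed.

Lemma bernstein_id n x : bernstein n x (fun j => j%:R) = n%:R * x.
Proof.
elim: n => [|n IH] /=; first by rewrite mul0r.
rewrite /comp (_ : (fun j => _) = (fun j => 1 + j%:R)); last first.
  by apply/funext => j; rewrite -natr1 addrC.
by rewrite bernsteinD bernstein_cst IH -natr1; ring.
Qed.

Lemma bernstein_sqr n x :
  bernstein n x (fun j => j%:R ^+ 2) = n%:R * (x * (1 - x)) + (n%:R * x) ^+ 2.
Proof.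
elim: n => [|n IH] /=; first by rewrite !mul0r expr0n/= addr0.
rewrite /comp (_ : (fun j => _) = (fun j => (1 + 2 * j%:R) + j%:R ^+ 2)); last first.
  by apply/funext => j; rewrite -natr1; ring.
rewrite bernsteinD bernsteinD bernstein_cst bernsteinZ bernstein_id IH -natr1.
by ring.
Qed.

Lemma bernstein_variance n x : (0 < n)%N ->
  bernstein n x (fun j => (x - j%:R / n%:R) ^+ 2) = x * (1 - x) / n%:R.
Proof.
move=> n0; have n0' : n%:R != 0 :> R by rewrite pnatr_eq0 -lt0n.
rewrite (_ : (fun j => _) =
    (fun j => x ^+ 2 + (- 2 * x / n%:R * j%:R + n%:R ^- 2 * j%:R ^+ 2))); last first.
  by apply/funext => j; field.
rewrite !bernsteinD !bernsteinZ bernstein_cst bernstein_id bernstein_sqr.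
by field.
Qed.

Lemma dist_bernstein n x f c : 0 <= x <= 1 ->
  `|bernstein n x f - c| <= bernstein n x (fun j => `|f j - c|).
Proof.
move=> x01; have -> : bernstein n x f - c = bernstein n x (fun j => f j - c).
  by rewrite bernsteinD bernstein_cst.
rewrite ler_norml; apply/andP; split.
  rewrite lerNl -mulN1r -bernsteinZ; apply: le_bernstein => // j _.
  by rewrite mulN1r -normrN ler_norm.
by apply: le_bernstein => // j _; rewrite ler_norm.
Qed.

Definition bernstein2 (n : nat) (g : R -> R -> R) x y : R :=
  bernstein n x (fun i => bernstein n y (fun j => g (i%:R / n%:R) (j%:R / n%:R))).

(** Weak law of large numbers: a binomial proportion has variance at most [1 /
    n], uniformly in the parameter, and [g] has a modulus linear in the squared
    distance. *)
Lemma bernstein2_approx (g : R -> R -> R) : quadratic_modulus g -> forall e : R, 0 < e ->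
  exists n, forall m, (n <= m)%N -> forall x y, 0 <= x <= 1 -> 0 <= y <= 1 ->
    `|bernstein2 m g x y - g x y| <= e.
Proof.
move=> gmod e e0; have e2 : 0 < e / 2 by rewrite divr_gt0.
have [C C0 gC] := gmod _ e2.
have [N _ HN] := @nbhs_infty_ger R (4 * C / e).
exists N.+1 => n Nn x y x01 y01.
have n0 : (0 < n)%N by rewrite (leq_trans _ Nn).
have n0' : 0 < n%:R :> R by rewrite ltr0n.
have ij01 i : (i <= n)%N -> 0 <= (i%:R / n%:R : R) <= 1.
  by move=> iN; rewrite divr_ge0//= ler_pdivrMr// mul1r ler_nat.
apply: (le_trans (dist_bernstein _ _ _ x01)).
apply: (@le_trans _ _ (bernstein n x (fun i => (e / 2 + C * (y * (1 - y) / n%:R)) + C * (x - i%:R / n%:R) ^+ 2))).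
  apply: le_bernstein => // i iN.
  apply: (le_trans (dist_bernstein _ _ _ y01)).
  rewrite -bernstein_variance// -bernsteinZ.
  rewrite -(bernstein_cst n y (e / 2)) -(bernstein_cst n y (C * (x - _) ^+ 2)).
  rewrite -!bernsteinD; apply: le_bernstein => // j jn.
  rewrite distrC; apply: le_trans (gC _ _ _ _ _ _ _ _) _ => //; try exact: ij01.
  by rewrite /=; lra.
rewrite bernsteinD bernsteinZ bernstein_cst bernstein_variance//.
have xx (z : R) : 0 <= z <= 1 -> z * (1 - z) / n%:R <= n%:R^-1.
  move=> /andP[z0 z1]; rewrite ler_pdivrMr// mulVf ?gt_eqF//.
  by rewrite mulr_ile1// ?subr_ge0// lerBlDr lerDl.
have Cn : C * n%:R^-1 <= e / 4.
  rewrite ler_pdivrMr//.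
  have : 4 * C / e <= n%:R by apply: HN; rewrite /= ltnW.
  by rewrite ler_pdivrMr// => ?; lra.
have := ler_wpM2l C0 (xx _ x01); have := ler_wpM2l C0 (xx _ y01).
by lra.
Qed.

End bernstein.

Section polynomial_functions.
Context {R : realType}.

(** Polynomial functions of two variables, presented so that a statement linear
    in the function reduces to monomials by induction. *)
Inductive polyfun2 : (R -> R -> R) -> Prop :=
| polyfun2_cst c : polyfun2 (fun _ _ => c)
| polyfun2D p q : polyfun2 p -> polyfun2 q ->
    polyfun2 (fun x y => p x y + q x y)
| polyfun2Z c p : polyfun2 p -> polyfun2 (fun x y => c * p x y)
| polyfun2X p : polyfun2 p -> polyfun2 (fun x y => x * p x y)
| polyfun2Y p : polyfun2 p -> polyfun2 (fun x y => y * p x y).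

Lemma polyfun2_bernstein2 n g : polyfun2 (bernstein2 n g).
Proof.
have polyy m (f : nat -> R) : polyfun2 (fun _ y => bernstein m y f).
  elim: m f => [|m IH] f /=; first exact: polyfun2_cst.
  rewrite (_ : (fun _ _ => _) = fun x y : R =>
    (y * bernstein m y (f \o succn) + (bernstein m y f + y * (-1 * bernstein m y f)))).
    by do !constructor; exact: IH.
  by apply/funext => x; apply/funext => y; ring.
have polyx m (h : nat -> R -> R) : (forall i, polyfun2 (fun _ y => h i y)) ->
    polyfun2 (fun x y => bernstein m x (h^~ y)).
  elim: m h => [|m IH] h ph /=; first exact: ph.
  rewrite (_ : (fun _ _ => _) = fun x y : R =>
      (x * bernstein m x ((h^~ y) \o succn) +
       (bernstein m x (h^~ y) + x * (-1 * bernstein m x (h^~ y))))).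
    do !constructor; [|exact: IH|exact: IH].
    by apply: (IH (h \o succn)) => i; exact: ph.
  by apply/funext => x; apply/funext => y; ring.
exact: (polyx n (fun i y => bernstein n y (fun j => g (i%:R / n%:R) (j%:R / n%:R)))).
Qed.

End polynomial_functions.

(** * Convergence of weighted moments *)

Section square_valued.
Context {R : realType} d (T : measurableType d).

Definition square_valued (X Y : T -> R) :=
  [/\ measurable_fun setT X, measurable_fun setT Y,
      forall w, 0 <= X w <= 1 & forall w, 0 <= Y w <= 1].

Variables X Y : T -> R.
Hypothesis XY : square_valued X Y.

Lemma bmeas_squareX : bounded_measurable X.
Proof. by case: XY => mX _ X01 _; exact: bmeas_le01. Qed.

Lemma bmeas_squareY : bounded_measurable Y.
Proof. by case: XY => _ mY _ Y01; exact: bmeas_le01. Qed.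

Lemma bmeas_polyfun2 p : polyfun2 p ->
  bounded_measurable (fun w => p (X w) (Y w)).
Proof.
elim=> [c|{}p q _ ? _ ?|c {}p _ ?|{}p _ ?|{}p _ ?].
- exact: bmeas_cst.
- exact: bmeasD.
- by apply: bmeasM => //; exact: bmeas_cst.
- by apply: bmeasM => //; exact: bmeas_squareX.
- by apply: bmeasM => //; exact: bmeas_squareY.
Qed.

(** The composite with [X] and [Y] is a limit of polynomials in [X] and [Y],
    hence measurable. *)
Lemma bmeas_quadratic_modulus g : quadratic_modulus g ->
  bounded_measurable (fun w => g (X w) (Y w)).
Proof.
move=> gm; case: (XY) => _ _ X01 Y01; split.
  apply: (@measurable_fun_cvg _ _ _ _ (fun n w => bernstein2 n g (X w) (Y w))).
    by move=> n; case: (bmeas_polyfun2 (polyfun2_bernstein2 n g)).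
  move=> w _; apply/cvgrPdist_le => e e0.
  have [N HN] := bernstein2_approx gm e0.
  near=> n; rewrite distrC HN//; near: n; exact: nbhs_infty_ge.
have [C C0 gC] := gm _ ltr01.
exists (`|g 0 0| + (1 + C * (1 + 1))) => w.
have -> : g (X w) (Y w) = g 0 0 + (g (X w) (Y w) - g 0 0) by ring.
rewrite (le_trans (ler_normD _ _))// lerD2l.
have z01 : 0 <= (0 : R) <= 1 by rewrite lexx ler01.
apply: le_trans (gC _ _ _ _ (X01 w) (Y01 w) z01 z01) _.
rewrite !subr0 lerD2l ler_wpM2l// lerD// expr_le1//.
- by case/andP: (X01 w).
- by case/andP: (X01 w).
- by case/andP: (Y01 w).
- by case/andP: (Y01 w).
Unshelve. all: by end_near. Qed.

End square_valued.

Section moment_convergence.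
Context {R : realType} d (T : measurableType d) (P : probability T R)
  d' (T' : measurableType d') (P' : probability T' R).
Variables (X_ Y_ : nat -> T -> R) (X Y : T' -> R).
Hypothesis XY_ : forall n, square_valued (X_ n) (Y_ n).
Hypothesis XY : square_valued X Y.
Hypothesis moments : forall a b : nat,
  \int[P]_w (X_ n w ^+ a.+1 * Y_ n w ^+ b) @[n --> \oo] -->
  \int[P']_w (X w ^+ a.+1 * Y w ^+ b).

Let bmom d1 (S : measurableType d1) (f g : S -> R) (a b : nat) :
  square_valued f g -> bounded_measurable (fun w => f w ^+ a * g w ^+ b).
Proof.
move=> fg; apply: bmeasM; apply: bmeasX.
  exact: bmeas_squareX fg.
exact: bmeas_squareY fg.
Qed.

(** Quantifying over all [a] and [b] absorbs the multiplications by the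
    variables into the exponents. *)
Lemma cvg_polynomial_moments p : polyfun2 p -> forall a b : nat,
  \int[P]_w (X_ n w ^+ a.+1 * Y_ n w ^+ b * p (X_ n w) (Y_ n w))
    @[n --> \oo] -->
  \int[P']_w (X w ^+ a.+1 * Y w ^+ b * p (X w) (Y w)).
Proof.
have bp d1 (S : measurableType d1) (f g : S -> R) (a b : nat) q :
    square_valued f g -> polyfun2 q ->
    bounded_measurable (fun w => f w ^+ a * g w ^+ b * q (f w) (g w)).
  by move=> fg pq; apply: bmeasM; [exact: bmom | exact: bmeas_polyfun2].
elim=> [c|{}p q pp IHp pq IHq|c {}p pp IHp|{}p pp IHp|{}p pp IHp] a b.
- apply: (cvg_eq _ _ (cvgMl_tmp (a := c) (@moments a b))) => [n|];
    by rewrite -meanZ; [apply: eq_mean => w; rewrite mulrC | exact: bmom].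
- apply: (cvg_eq _ _ (cvgD (IHp a b) (IHq a b))) => [n|];
    by rewrite -meanD; [apply: eq_mean => w; rewrite mulrDr | exact: bp | exact: bp].
- apply: (cvg_eq _ _ (cvgMl_tmp (a := c) (IHp a b))) => [n|];
    by rewrite -meanZ; [apply: eq_mean => w; ring | exact: bp].
- apply: (cvg_eq _ _ (IHp a.+1 b)) => [n|]; apply: eq_mean => w.
    by rewrite [X_ _ _ ^+ a.+2]exprSr; ring.
  by rewrite [X _ ^+ a.+2]exprSr; ring.
- apply: (cvg_eq _ _ (IHp a b.+1)) => [n|]; apply: eq_mean => w.
    by rewrite [Y_ _ _ ^+ _.+1]exprSr; ring.
  by rewrite [Y _ ^+ _.+1]exprSr; ring.
Qed.

(** The weight [X] is what the moments with exponent [a.+1] allow; since [0 <=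
    X <= 1], it does not spoil the uniform approximation of [g] by Bernstein
    polynomials. *)
Lemma cvg_weighted_mean g : quadratic_modulus g ->
  \int[P]_w (X_ n w * g (X_ n w) (Y_ n w)) @[n --> \oo] -->
  \int[P']_w (X w * g (X w) (Y w)).
Proof.
move=> gm; apply: cvg_up_to => e e0.
have [N HN] := bernstein2_approx gm e0.
have close d1 (S : measurableType d1) (Q : probability S R) (f h : S -> R) :
    square_valued f h ->
    `|\int[Q]_w (f w * g (f w) (h w)) -
      \int[Q]_w (f w * bernstein2 N g (f w) (h w))| <= e.
  move=> fh; case: (fh) => _ _ f01 h01; rewrite -[leRHS](mean_cst Q).
  have bf := bmeas_squareX fh.
  apply: dist_mean.
  - by apply: bmeasM => //; exact: bmeas_quadratic_modulus.
  - by apply: bmeasM => //; apply: bmeas_polyfun2 => //; exact: polyfun2_bernstein2.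
  - exact: bmeas_cst.
  move=> w; have /andP[f0 f1] := f01 w.
  rewrite -mulrBr normrM ger0_norm// -[leRHS]mul1r ler_pM// distrC.
  exact: HN.
exists (fun n => \int[P]_w (X_ n w * bernstein2 N g (X_ n w) (Y_ n w))).
exists (\int[P']_w (X w * bernstein2 N g (X w) (Y w))); split.
- apply: (cvg_eq _ _ (cvg_polynomial_moments (polyfun2_bernstein2 N g) (a := 0%N) (b := 0%N))) => [n|];
    by apply: eq_mean => w; rewrite expr1 expr0 mulr1.
- by near=> n; exact: close.
- exact: close.
Unshelve. all: by end_near. Qed.

End moment_convergence.

(** * Random words of bits and their limits *)

Section words.
Context d (S : measurableType d).

(** The first [k] bits, the latest one first, so that refining a word is a
    [cons]. *)
Fixpoint rword (b : nat -> S -> bool) (k : nat) (w : S) : seq bool :=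
  if k is k'.+1 then b k' w :: rword b k' w else [::].

Lemma size_rword b k w : size (rword b k w) = k.
Proof. by elim: k => //= k ->. Qed.

Lemma rev_rword b k w : rev (rword b k w) = mkseq (b^~ w) k.
Proof. by elim: k => [//|k IH]; rewrite /= rev_cons IH -mkseqS. Qed.

Lemma measurable_rword {R : realType} b k (F : seq bool -> R) :
  (forall i, measurable_fun setT (b i)) ->
  measurable_fun setT (fun w => F (rword b k w)).
Proof.
move=> mb; elim: k F => [|k IH] F /=; first exact: measurable_cst.
rewrite (_ : (fun w => _) = fun w =>
  if b k w then F (true :: rword b k w) else F (false :: rword b k w)).
  by apply: measurable_fun_ifT => //; [exact: (IH (F \o cons true)) |
                                       exact: (IH (F \o cons false))].
by apply/funext => w; case: (b k w).
Qed.

Lemma bmeas_rword {R : realType} b k (F : seq bool -> R) :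
  (forall i, measurable_fun setT (b i)) ->
  bounded_measurable (fun w => F (rword b k w)).
Proof.
move=> mb; split; first exact: measurable_rword.
exists (\sum_(r : k.-tuple bool) `|F r|) => w.
have sz : size (rword b k w) == k by rewrite size_rword.
rewrite (bigD1 (Tuple sz))//= lerDl.
by apply: sumr_ge0 => r _.
Qed.

(** A function of [k] bits takes finitely many values, so its mean is a finite
    combination of the probabilities of words. *)
Lemma mean_rword {R : realType} (Q : probability S R) b k (F : seq bool -> R) :
  (forall i, measurable_fun setT (b i)) ->
  \int[Q]_w F (rword b k w) =
  \sum_(r : k.-tuple bool) F r * \int[Q]_w (rword b k w == r)%:R.
Proof.
move=> mb.
have bm (G : seq bool -> R) := bmeas_rword k G mb.
have -> : \sum_(r : k.-tuple bool) F r * \int[Q]_w (rword b k w == r)%:R =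
    \sum_(r : k.-tuple bool) \int[Q]_w (F r * (rword b k w == r)%:R).
  by apply: eq_bigr => r _; rewrite meanZ//; exact: (bm (fun u => (u == r)%:R)).
rewrite -mean_sum; last by move=> r; exact: (bm (fun u => F r * (u == r)%:R)).
apply: eq_mean => w.
have sz : size (rword b k w) == k by rewrite size_rword.
rewrite (bigD1 (Tuple sz))//= eqxx mulr1 big1 ?addr0// => r rn.
case: eqP => [wr|]; last by rewrite mulr0.
by move/eqP: rn; case; apply/val_inj.
Qed.

End words.

Section nested_intervals.
Context {R : realType}.
Variable m : seq bool -> R.
Hypothesis m_ge0 : forall r, 0 <= m r.
Hypothesis m_nil : m [::] = 1.
Hypothesis m_split : forall r, m r = m (false :: r) + m (true :: r).

(** The word [r] is assigned the interval that starts at [left_end r] and has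
    length [m r]; each interval is cut into one for [false :: r], on the left,
    and one for [true :: r]. *)
Fixpoint left_end (r : seq bool) : R :=
  if r is b :: r' then left_end r' + (if b then m (false :: r') else 0) else 0.

(** The word of length [k] whose interval contains [x]. *)
Fixpoint node (k : nat) (x : R) : seq bool :=
  if k is k'.+1 then
    (left_end (node k' x) + m (false :: node k' x) <= x) :: node k' x
  else [::].

Definition node_bit (k : nat) (x : R) : bool :=
  left_end (node k x) + m (false :: node k x) <= x.

Lemma rword_node k x : rword node_bit k x = node k x.
Proof. by elim: k => //= k ->. Qed.

Lemma node_interval k r x : 0 <= x < 1 ->
  (node k x == r) = [&& size r == k, left_end r <= x & x < left_end r + m r].
Proof.
move=> /andP[x0 x1]; elim: k r => [|k IH] [|b r] //=.
- by rewrite m_nil add0r x0 x1.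
rewrite eqseq_cons eqSS; have := IH r.
have := m_split r; have := m_ge0 (false :: r); have := m_ge0 (true :: r).
have [-> |_] := eqVneq (node k x) r => m1 m0 ms.
  move=> /esym /and3P[/eqP -> lx xr]; rewrite eqxx andbT/=.
  case: b => /=.
    by rewrite -addrA -ms xr andbT; case: leP.
  by rewrite addr0 lx/=; case: leP.
move=> /esym h; rewrite andbF; apply/esym/negP => /and3P[sz].
move=> h1 h2; move: h; rewrite sz/= => /negP; apply.
case: b h1 h2 => /= h1 h2.
  by rewrite ms addrA h2 andbT (le_trans _ h1)// lerDl.
move: h1 h2; rewrite addr0 => -> h2.
by rewrite ms addrA (lt_le_trans h2)// lerDl.
Qed.

Lemma left_end_ge0 r : 0 <= left_end r.
Proof. by elim: r => [//|b r IH] /=; rewrite addr_ge0//; case: b. Qed.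

Lemma right_end_le1 r : left_end r + m r <= 1.
Proof.
elim: r => [|b r IH] /=; first by rewrite m_nil add0r.
have := m_split r; have := m_ge0 (false :: r); have := m_ge0 (true :: r).
by case: b; lra.
Qed.

Lemma measurable_node_bit k : measurable_fun setT (node_bit k).
Proof.
have H j (F : seq bool -> R) : measurable_fun setT (fun x => F (node j x)).
  elim: j F => [|j IH] F /=; first exact: measurable_cst.
  rewrite (_ : (fun w => _) = fun w =>
    if left_end (node j w) + m (false :: node j w) <= w
    then F (true :: node j w) else F (false :: node j w)).
    apply: measurable_fun_ifT.
    - apply: measurable_fun_ler => //.
      exact: (IH (fun r => left_end r + m (false :: r))).
    - exact: (IH (F \o cons true)).
    - exact: (IH (F \o cons false)).
  by apply/funext => w; case: ifP.
apply: measurable_fun_ler => //.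
exact: (H k (fun r => left_end r + m (false :: r))).
Qed.

Local Notation mu := (uniform_prob (@ltr01 R)).

Lemma uniform_prob_itvco (a b : R) : 0 <= a -> a <= b -> b <= 1 ->
  mu `[a, b[%classic = (b - a)%:E.
Proof.
move=> a0 ab b1; rewrite /uniform_prob.
rewrite (eq_integral (fun=> 1%E)).
  rewrite integral_cst//= mul1e lebesgue_measure_itv/= lte_fin.
  case: ltP => [//|ba]; have -> : a = b by apply/eqP; rewrite eq_le ab ba.
  by rewrite subrr.
move=> x; rewrite inE/= in_itv/= => /andP[ax xb].
rewrite /uniform_pdf subr0 invr1.
by rewrite (le_trans a0 ax) (le_trans (ltW xb) b1).
Qed.

(** Under the uniform law the words have the prescribed masses, because an
    interval has its length as probability. *)
Lemma prob_node r : \int[mu]_x (rword node_bit (size r) x == r)%:R = m r.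
Proof.
have co01 : mu `[0, 1[%classic = 1%E.
  by transitivity ((1 - 0)%:E : \bar R); [exact: uniform_prob_itvco | rewrite subr0].
rewrite (@eq_mean_on _ _ _ mu _ _ (\1_(`[left_end r, left_end r + m r[%classic)) _ co01)//.
- rewrite (@mean_indic _ _ _ mu)// [X in fine X]uniform_prob_itvco//=.
  + by rewrite addrC addKr.
  + exact: left_end_ge0.
  + by rewrite lerDl.
  + exact: right_end_le1.
- exact: (measurable_rword _ (fun u => (u == r)%:R) measurable_node_bit).
- move=> x; rewrite /= in_itv/= => x01.
  by rewrite rword_node node_interval// eqxx indicE mem_setE in_itv.
Qed.

End nested_intervals.

Section ultrafilter_limit.
Context {R : realType} d (T : measurableType d) (P : probability T R).
Local Notation mu := (uniform_prob (@ltr01 R)).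

(** Compactness of the unit interval. *)
Lemma ultra_cvg01 (U : set_system nat) (UU : UltraFilter U) (u : nat -> R) :
  (forall n, 0 <= u n <= 1) -> exists l : R, u n @[n --> U] --> l.
Proof.
move=> u01; have uU : UltraFilter (u @ U).
  split; first exact: fmap_proper_filter.
  move=> G GF sG; rewrite eqEsubset; split=> // A GA.
  have [//|UA] := in_ultra_setVsetC (u @^-1` A) UU.
  have : G (~` A) by apply: sG.
  by move=> /(filterI GA); rewrite setICr => /filter_not_empty.
have := @segment_compact R 0 1.
rewrite compact_ultra => /(_ (u @ U) uU)[].
  rewrite (_ : (u @ U) _ = U [set n | `[0, 1]%classic (u n)])//.
  by rewrite (_ : mkset _ = setT); [exact: filterT | apply/seteqP; split => // n _; rewrite /= in_itv/=].
by move=> l [_ ul]; exists l.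
Qed.

(** The limits of the probabilities of words are nonnegative and additive over
    the two refinements of a word, hence are the lengths of a family of nested
    intervals. This realisation on an interval takes the place of an extension
    theorem for measures on sequences. *)
Lemma bits_cluster (c : nat -> nat -> T -> bool) :
  (forall n k, measurable_fun setT (c n k)) ->
  exists (U : set_system nat) (b : nat -> R -> bool),
  [/\ UltraFilter U, \oo `<=` U, forall k, measurable_fun setT (b k) &
    forall k (F : seq bool -> R),
    \int[P]_w F (rword (c n) k w) @[n --> U] --> \int[mu]_x F (rword b k x)].
Proof.
move=> mc; have [U [UU sU]] := ultraFilterLemma eventually_filter.
pose p r n := \int[P]_w (rword (c n) (size r) w == r)%:R : R.
have bp r n : bounded_measurable (fun w => (rword (c n) (size r) w == r)%:R : R).
  exact: (bmeas_rword _ (fun u => (u == r)%:R) (mc n)).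
have p01 r n : 0 <= p r n <= 1.
  rewrite /p; apply/andP; split; first by apply: mean_ge0 => w; case: eqP.
  by apply: (mean_le1 P (bp r n)) => w; case: eqP; rewrite ?ler01.
have [m pm] := choice (fun r => ultra_cvg01 UU (p01 r)).
have m0 r : 0 <= m r.
  apply: (ler_cvg_to (cvg_cst _) (pm r)); apply: nearW => n.
  by case/andP: (p01 r n).
have m1 : m [::] = 1.
  have h : p [::] n @[n --> U] --> (1 : R).
    rewrite (_ : p [::] = fun=> 1); first exact: cvg_cst.
    by apply/funext => n; rewrite /p/= -[RHS](mean_cst P); exact: eq_mean.
  by apply: (cvg_unique _ (pm [::]) h); exact: Rhausdorff.
have ms r : m r = m (false :: r) + m (true :: r).
  have h : p r n @[n --> U] --> m (false :: r) + m (true :: r).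
    rewrite (_ : p r = fun n => p (false :: r) n + p (true :: r) n).
      by apply: cvgD; exact: pm.
    apply/funext => n; rewrite /p -meanD; [|exact: bp|exact: bp].
    apply: eq_mean => w /=; rewrite !eqseq_cons.
    by case: (c n _ w) => /=; rewrite ?add0r ?addr0.
  by apply: (cvg_unique _ (pm r) h); exact: Rhausdorff.
exists U, (node_bit m); split => //; first exact: measurable_node_bit.
move=> k F; rewrite mean_rword; last exact: measurable_node_bit.
rewrite (_ : (fun n => _) = fun n =>
   \sum_(r : k.-tuple bool) F r * p r n); last first.
  apply/funext => n; rewrite mean_rword//; apply: eq_bigr => r _.
  by rewrite /p size_tuple.
apply: cvg_finite_sum => r; apply: cvgMl_tmp.
rewrite (_ : Rintegral _ _ _ = m r); first exact: pm.
by rewrite -prob_node// size_tuple.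
Qed.

End ultrafilter_limit.

(** * Binary expansions and limits of pairs *)

Section binary_expansion.
Context {R : realType}.

Definition bin_partial (e : nat -> bool) (k : nat) : R :=
  \sum_(0 <= i < k) (2^-1) ^+ i.+1 * (e i)%:R.

Lemma bin_partial_nd e : nondecreasing_seq (bin_partial e).
Proof.
apply/nondecreasing_seqP => k; rewrite /bin_partial big_nat_recr//= lerDl.
by rewrite mulr_ge0// exprn_ge0// invr_ge0.
Qed.

Lemma bin_partial_ni e :
  nonincreasing_seq (fun k => bin_partial e k + (2^-1) ^+ k).
Proof.
apply/nonincreasing_seqP => k; rewrite /bin_partial big_nat_recr//= exprS.
have : 0 <= (2^-1 : R) ^+ k by rewrite exprn_ge0// invr_ge0.
by case: (e k) => /=; lra.
Qed.

Lemma cvg_half_expn : (2^-1 : R) ^+ k @[k --> \oo] --> (0 : R).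
Proof. by apply: cvg_expr; rewrite ger0_norm ?invr_ge0// invf_lt1// ltr1n. Qed.

(** The partial sums increase while the partial sums plus the largest possible
    remainder decrease. *)
Lemma bin_partial_bounds e : exists z : R,
  bin_partial e k @[k --> \oo] --> z /\
  forall k, bin_partial e k <= z <= bin_partial e k + (2^-1) ^+ k.
Proof.
have ub k : bin_partial e k <= 1.
  have b0 : bin_partial e 0 = 0 by rewrite /bin_partial big_geq.
  have /= := bin_partial_ni e (leq0n k); rewrite b0 expr0 add0r.
  by apply: le_trans; rewrite lerDl exprn_ge0// invr_ge0.
have cv : cvgn (bin_partial e).
  apply: nondecreasing_is_cvgn; first exact: bin_partial_nd.
  by exists 1 => _ [k _ <-].
exists (limn (bin_partial e)); split => // k; apply/andP; split.
  exact: nondecreasing_cvgn_le (@bin_partial_nd e) cv k.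
have cv2 : bin_partial e k + 2^-1 ^+ k @[k --> \oo] --> limn (bin_partial e).
  rewrite -[X in _ --> X]addr0; apply: cvgD => //; exact: cvg_half_expn.
rewrite -(cvg_lim _ cv2)//.
apply: (@nonincreasing_cvgn_ge _ (fun k => bin_partial e k + 2^-1 ^+ k)).
  exact: bin_partial_ni.
by apply/cvg_ex; exists (limn (bin_partial e)).
Qed.

(** What remains of [x], rescaled to the unit interval, after extraction of [k]
    binary digits. *)
Fixpoint bin_rest (k : nat) (x : R) : R :=
  if k is k'.+1 then
    2 * bin_rest k' x - ((2^-1 <= bin_rest k' x)%R)%:R
  else x.

Definition digit (k : nat) (x : R) : bool := 2^-1 <= bin_rest k x.

Lemma bin_rest01 k x : 0 <= x <= 1 -> 0 <= bin_rest k x <= 1.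
Proof.
move=> x01; elim: k => [//|k IH] /=.
by move: IH; case: (leP 2^-1 (bin_rest k x)) => /= h /andP[h0 h1];
  apply/andP; split; lra.
Qed.

Lemma bin_restE k x :
  x = bin_partial (digit^~ x) k + (2^-1) ^+ k * bin_rest k x.
Proof.
elim: k => [|k IH]; first by rewrite /bin_partial big_geq// add0r expr0 mul1r.
rewrite /bin_partial big_nat_recr//= -/(bin_partial _ k) {1}IH /digit exprS.
by field.
Qed.

Lemma digit_approx k x : 0 <= x <= 1 ->
  bin_partial (digit^~ x) k <= x <= bin_partial (digit^~ x) k + (2^-1) ^+ k.
Proof.
move=> /(bin_rest01 k)/andP[h0 h1].
have k0 : 0 <= (2^-1 : R) ^+ k by rewrite exprn_ge0// invr_ge0.
have r0 : 0 <= (2^-1) ^+ k * bin_rest k x by rewrite mulr_ge0.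
have r1 : (2^-1) ^+ k * bin_rest k x <= (2^-1) ^+ k.
  by rewrite -[leRHS]mulr1 ler_wpM2l.
have := bin_restE k x; set S := bin_partial _ k => xE.
by apply/andP; split; lra.
Qed.

Lemma measurable_digit d (T : measurableType d) (X : T -> R) k :
  measurable_fun setT X -> measurable_fun setT (fun w => digit k (X w)).
Proof.
move=> mX; have mr : measurable_fun setT (fun w => bin_rest k (X w)).
  elim: k => [//|k IH] /=; apply: measurable_funB.
    by apply: measurable_funM => //; exact: measurable_cst.
  have mb : measurable_fun setT (fun w => 2^-1 <= bin_rest k (X w)).
    by apply: measurable_fun_ler => //; exact: measurable_cst.
  by case: (bmeas_bool (R := R) mb).
by apply: measurable_fun_ler => //; exact: measurable_cst.
Qed.

End binary_expansion.

Section cluster_pair.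
Context {R : realType} d (T : measurableType d) (P : probability T R).
Local Notation mu := (uniform_prob (@ltr01 R)).
Variables X_ Y_ : nat -> T -> R.
Hypothesis XY_ : forall n, square_valued (X_ n) (Y_ n).

Let code (n k : nat) (w : T) : bool :=
  if odd k then digit k./2 (Y_ n w) else digit k./2 (X_ n w).

Let decode (j k : nat) (r : seq bool) : R :=
  bin_partial (fun i => nth false (rev r) (i.*2 + j)%N) k.

(** Digits of the first coordinate sit at even positions, those of the second
    at odd positions. *)
Lemma decode_rword d1 (S : measurableType d1) (b : nat -> S -> bool) j k w :
  (j <= 1)%N ->
  decode j k (rword b k.*2 w) = bin_partial (fun i => b (i.*2 + j)%N w) k.
Proof.
move=> j1; rewrite /decode rev_rword /bin_partial !big_mkord.
apply: eq_bigr => i _; rewrite nth_mkseq//.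
by have := ltn_ord i; rewrite -!muln2; lia.
Qed.

(** A function with a quadratic modulus is determined up to [e] by finitely
    many digits of both coordinates, and means of functions of finitely many
    bits pass to the limit along the ultrafilter. A mean that converges along
    the whole sequence therefore keeps its limit. *)
Lemma cluster_pair : exists Zx Zy : R -> R, square_valued Zx Zy /\
  forall (g : R -> R -> R) (l : R), quadratic_modulus g ->
    \int[P]_w g (X_ n w) (Y_ n w) @[n --> \oo] --> l ->
    \int[mu]_x g (Zx x) (Zy x) = l.
Proof.
have mcode n k : measurable_fun setT (code n k).
  case: (XY_ n) => mX mY _ _; rewrite /code.
  by case: (odd k); exact: measurable_digit.
have [U [b [UU sU mb bE]]] := bits_cluster P mcode.
have lim_of j := choice (fun x => bin_partial_bounds (R := R) (fun i => b (i.*2 + j)%N x)).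
have [Zx HZx] := lim_of 0%N; have [Zy HZy] := lim_of 1%N.
have bin01 (e : nat -> bool) (z : R) :
    (forall k, bin_partial e k <= z <= bin_partial e k + (2^-1) ^+ k) -> 0 <= z <= 1.
  by move=> /(_ 0%N); rewrite /bin_partial big_geq// expr0 add0r.
have mZ j (Z : R -> R) : (forall x,
    bin_partial (fun i => b (i.*2 + j)%N x) k @[k --> \oo] --> Z x) -> measurable_fun setT Z.
  move=> HZ; apply: (@measurable_fun_cvg _ _ _ _
    (fun k x => bin_partial (fun i => b (i.*2 + j)%N x) k)).
    move=> k; apply: measurable_sum => i; apply: measurable_funM.
      exact: measurable_cst.
    by case: (bmeas_bool (R := R) (mb (i.*2 + j)%N)).
  by move=> x _; exact: HZ.
have sqZ : square_valued Zx Zy.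
  split=> [||x|x]; [apply: (mZ 0%N) => x|apply: (mZ 1%N) => x| |].
  - by case: (HZx x).
  - by case: (HZy x).
  - by case: (HZx x) => _ /bin01.
  - by case: (HZy x) => _ /bin01.
exists Zx, Zy; split => // g l gm gl.
(* the convergent sequence has the same limit along the ultrafilter *)
have gU : \int[P]_w g (X_ n w) (Y_ n w) @[n --> U] --> l by move=> A /gl /sU.
apply: (cvg_unique _ _ gU); first exact: Rhausdorff.
apply: cvg_up_to => e e0.
have [C C0 gC] := gm _ (divr_gt0 e0 (ltr0n _ 2)).
have : C * (2 * 2^-1 ^+ k) @[k --> \oo] --> C * (2 * 0).
  by apply: cvgMl_tmp; apply: cvgMl_tmp; exact: cvg_half_expn.
rewrite !mulr0 => /cvgrPdist_le /(_ (e / 2)) /(_ (divr_gt0 e0 (ltr0n _ 2))).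
move=> [k _ /(_ k (leqnn k))]; rewrite /= sub0r normrN => Ck.
pose F r := g (decode 0 k r) (decode 1 k r).
have close z1 z2 z1' z2' : 0 <= z1 <= 1 -> 0 <= z2 <= 1 ->
    z1' <= z1 <= z1' + 2^-1 ^+ k -> z2' <= z2 <= z2' + 2^-1 ^+ k ->
    0 <= z1' -> 0 <= z2' -> `|g z1 z2 - g z1' z2'| <= e.
  move=> /andP[z10 z11] /andP[z20 z21] /andP[h1 h1'] /andP[h2 h2'] z1'0 z2'0.
  apply: (le_trans (gC _ _ _ _ _ _ _ _)); rewrite ?z10 ?z20 ?z1'0 ?z2'0//=.
  - exact: le_trans h1 z11.
  - exact: le_trans h2 z21.
  rewrite [leRHS](_ : e = e / 2 + e / 2); last by field.
  rewrite lerD2l (le_trans _ Ck)// (le_trans _ (ler_norm _))// ler_wpM2l//.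
  have k0 : 0 <= (2^-1 : R) ^+ k by rewrite exprn_ge0// invr_ge0.
  have k1 : (2^-1 : R) ^+ k <= 1.
    by rewrite exprn_ile1// ?invr_ge0// invf_le1// ler1n.
  by nra.
have b0 e1 : 0 <= bin_partial e1 k :> R.
  by rewrite /bin_partial; apply: sumr_ge0 => i _; rewrite mulr_ge0// exprn_ge0// invr_ge0.
exists (fun n => \int[P]_w F (rword (code n) k.*2 w)).
exists (\int[mu]_x F (rword b k.*2 x)); split; first exact: bE.
- apply: nearW => n; case: (XY_ n) => _ _ X01 Y01.
  rewrite -[leRHS](mean_cst P); apply: dist_mean.
  + exact: (bmeas_quadratic_modulus (XY_ n) gm).
  + exact: bmeas_rword.
  + exact: bmeas_cst.
  move=> w; rewrite /F !decode_rword//.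
  have -> : (fun i => code n (i.*2 + 0)%N w) = digit^~ (X_ n w).
    by apply/funext => i; rewrite /code addn0 odd_double doubleK.
  have -> : (fun i => code n (i.*2 + 1)%N w) = digit^~ (Y_ n w).
    by apply/funext => i; rewrite /code addn1/= odd_double/= uphalf_double.
  by apply: close => //; exact: digit_approx.
- rewrite -[leRHS](mean_cst mu); apply: dist_mean.
  + exact: (bmeas_quadratic_modulus sqZ gm).
  + exact: bmeas_rword.
  + exact: bmeas_cst.
  move=> x; rewrite /F !decode_rword//; case: sqZ => _ _ Zx01 Zy01.
  apply: close => //; first by case: (HZx x).
  by case: (HZy x).
Qed.

End cluster_pair.

(** * The function delta *)

Section kernel_integrals.
Context {R : realType}.
Local Notation mu := (@lebesgue_measure R).

(** The derivative of [gauss_prim b] below, that is of [- exp (- (u + b)^2) /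
    2]; with [b = s / (2 sqrt r)] it is the weight of the power function in
    [delta]. *)
Definition gauss_weight (b u : R) : R := expR (- (u + b) ^+ 2) * (u + b).

Lemma gauss_weight_ge0 b u : 0 <= b -> 0 <= u -> 0 <= gauss_weight b u.
Proof. by move=> b0 u0; rewrite mulr_ge0 ?expR_ge0// addr_ge0. Qed.

Definition gauss_prim (b u : R) : R := - (2^-1 * expR (- (u + b) ^+ 2)).

Lemma is_derive_gauss (b u : R) :
  is_derive u (1 : R) (gauss_prim b) (gauss_weight b u).
Proof.
have h : is_derive u (1 : R) (fun u : R => - (u + b) ^+ 2) (- (2 * (u + b))).
  by apply: is_derive_eq; rewrite /GRing.scale/=; ring.
have h2 : is_derive u (1 : R) (expR \o (fun u : R => - (u + b) ^+ 2))
    (expR (- (u + b) ^+ 2) * - (2 * (u + b))).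
  exact: is_derive1_comp.
apply: (is_derive_eq (is_deriveN (is_deriveZ 2^-1 h2))).
by rewrite /gauss_weight /GRing.scale/=; field.
Qed.

Lemma continuous_gauss_weight b : continuous (gauss_weight b).
Proof.
have c1 : continuous (fun u : R => u + b).
  by move=> u; apply: cvgD; [exact: cvg_id | exact: cvg_cst].
have c2 : continuous (fun u : R => - (u + b) ^+ 2).
  move=> u; apply: (@cvgN _ R^o).
  apply: (@continuous_comp _ _ _ (fun u => u + b) (fun y => y ^+ 2)); first exact: c1.
  exact: exprn_continuous.
move=> u; apply: cvgM; last exact: c1.
apply: (@continuous_comp _ _ _ (fun u : R => - (u + b) ^+ 2) (@expR R)).
  exact: c2.
exact: continuous_expR.
Qed.

Lemma measurable_gauss_weight b : measurable_fun setT (gauss_weight b).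
Proof. by apply: continuous_measurable_fun; exact: continuous_gauss_weight. Qed.

Lemma integral_gauss_weight b (z : R) : 0 <= z ->
  (\int[mu]_(u in `]0%R, z[) (gauss_weight b u)%:E)%E =
   (2^-1 * expR (- b ^+ 2) * (1 - expR (- (z ^+ 2 + 2 * b * z))))%:E :> \bar R.
Proof.
rewrite le_eqVlt => /predU1P[<-|z0].
  rewrite set_itv_ge -?leNgt ?bnd_simp// integral_set0.
  by rewrite expr0n/= mulr0 addr0 oppr0 expR0 subrr mulr0.
have mg (A : set R) : measurable_fun A (fun u => (gauss_weight b u)%:E).
  by apply/measurable_EFinP/measurable_funTS; exact: measurable_gauss_weight.
rewrite integral_itv_obnd_cbnd// integral_itv_bndo_bndc//.
have cF (u : R) : {for u, continuous (gauss_prim b)}.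
  apply: differentiable_continuous; apply/derivable1_diffP.
  by have [] := is_derive_gauss b u.
rewrite (@continuous_FTC2 _ _ (gauss_prim b))//.
- rewrite -EFinB /gauss_prim; congr EFin.
  have -> : - (z + b) ^+ 2 = - b ^+ 2 + - (z ^+ 2 + 2 * b * z) by ring.
  by rewrite expRD add0r; ring.
- by apply: continuous_subspaceT; exact: continuous_gauss_weight.
- split.
  + by move=> x _; have [] := is_derive_gauss b x.
  + by apply: cvg_at_right_filter; exact: cF.
  + by apply: cvg_at_left_filter; exact: cF.
- by move=> x _; rewrite derive1E; have [_ ->] := is_derive_gauss b x.
Qed.

Lemma cvg_gauss_infty : (- (2^-1 * expR (- u ^+ 2)) : R) @[u --> +oo] --> (0 : R).
Proof.
rewrite -oppr0; apply: cvgN; rewrite -(mulr0 2^-1); apply: cvgMl_tmp.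
have h : expR (- (u ^+ 2) : R) @[u --> +oo] --> (0 : R).
  apply: (@cvg_comp _ _ _ (fun u : R => u ^+ 2) (fun y => expR (- y))).
    exact: cvgr_expr2.
  exact: cvgr_expR.
exact: h.
Qed.

Lemma integral_gauss_weight0 :
  (\int[mu]_(u in `]0%R, +oo[) (gauss_weight 0 u)%:E)%E = (2^-1 : R)%:E.
Proof.
have mg (A : set R) : measurable_fun A (fun u => (gauss_weight 0 u)%:E).
  by apply/measurable_EFinP/measurable_funTS; exact: measurable_gauss_weight.
have cF (u : R) : {for u, continuous (gauss_prim 0)}.
  apply: differentiable_continuous; apply/derivable1_diffP.
  by have [] := is_derive_gauss 0 u.
rewrite integral_itv_obnd_cbnd//.
rewrite (@ge0_continuous_FTC2y _ _ (gauss_prim 0) _ 0)//.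
- rewrite -EFinB /gauss_prim; congr EFin.
  by rewrite addr0 expr0n/= oppr0 expR0 mulr1 opprK add0r.
- by move=> x x0; exact: gauss_weight_ge0.
- by apply: continuous_subspaceT; exact: continuous_gauss_weight.
- rewrite /gauss_prim; under eq_fun do rewrite addr0; exact: cvg_gauss_infty.
- by apply: cvg_at_right_filter; exact: cF.
- by move=> x _; rewrite derive1E; have [_ ->] := is_derive_gauss 0 x.
Qed.

(** The singularity of the power at [0] is approached from the intervals
    [[1/(n+1), 1]], where a primitive is available. *)
Lemma integral_powR_le (b : R) : 0 < b -> b < 1 ->
  (\int[mu]_(u in `]0%R, 1%R]) (u `^ (- b))%:E <= ((1 - b)^-1)%:E)%E.
Proof.
move=> b0 b1; have b1' : 0 < 1 - b by rewrite subr_gt0.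
have mp (A : set R) : measurable_fun A (fun u => (u `^ (- b))%:E).
  by apply/measurable_EFinP/measurable_funTS; exact: measurable_powR.
pose F n : set R := `[n.+1%:R^-1, 1]%classic.
have UF : \bigcup_n F n = `]0, 1]%classic.
  apply/seteqP; split => x /=.
    move=> [n _]; rewrite /F/= !in_itv/= => /andP[nx ->]; rewrite andbT.
    by rewrite (lt_le_trans _ nx)// invr_gt0.
  rewrite in_itv/= => /andP[x0 x1].
  have [n _ Hn] := @nbhs_infty_ger R x^-1.
  exists n => //; rewrite /F/= in_itv/= x1 andbT invf_ple ?posrE//.
  by rewrite (le_trans (Hn n (leqnn n)))// ler_nat.
rewrite -UF.
have cv : (\int[mu]_(x in F i) (x `^ (- b))%:E)%E @[i --> \oo] -->
    (\int[mu]_(x in \bigcup_i F i) (x `^ (- b))%:E)%E.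
  apply: ge0_nondecreasing_set_cvg_integral => //.
  - apply/nondecreasing_seqP => n; apply/subsetPset => x; rewrite /F/= !in_itv/=.
    move=> /andP[nx ->]; rewrite andbT (le_trans _ nx)//.
    by rewrite lef_pV2 ?posrE// ler_nat.
  - by move=> n; exact: measurable_itv.
  - by move=> n; exact: mp.
  - by move=> n x _; rewrite lee_fin powR_ge0.
rewrite -(cvg_lim _ cv)//; apply: lime_le; first by apply/cvg_ex; eexists; exact: cv.
apply: nearW => n.
  have [->|n0] := eqVneq n 0%N.
    rewrite /F invr1 set_itv1 integral_set1//.
    by rewrite lee_fin invr_ge0 ltW.
  have n1 : n.+1%:R^-1 < 1 :> R by rewrite invf_lt1// ltr1n ltnS lt0n.
  have nn0 : 0 < n.+1%:R^-1 :> R by rewrite invr_gt0.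
  have D (x : R) : 0 < x -> is_derive x (1 : R) (fun u => (1 - b)^-1 * u `^ (1 - b)) (x `^ (- b)).
    move=> x0; have h := is_deriveZ (1 - b)^-1 (is_derive1_powR (1 - b) x0).
    apply: (is_derive_eq h); rewrite /GRing.scale/= mulrA mulVf ?gt_eqF// mul1r.
    by congr (_ `^ _); ring.
  have cF (x : R) : 0 < x -> {for x, continuous (fun u => (1 - b)^-1 * u `^ (1 - b))}.
    move=> x0; apply: differentiable_continuous; apply/derivable1_diffP.
    by have [] := D _ x0.
  rewrite (@continuous_FTC2 _ _ (fun u => (1 - b)^-1 * u `^ (1 - b)))//.
  + rewrite -EFinB lee_fin powR1 mulr1 lerBlDr lerDl.
    by rewrite mulr_ge0// ?powR_ge0// invr_ge0 ltW.
  + apply: derivable_within_continuous => x; rewrite in_itv/= => /andP[nx _].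
    have x0 : 0 < x := lt_le_trans nn0 nx.
    by have [] := is_derive1_powR (- b) x0.
  + split.
    * move=> x; rewrite in_itv/= => /andP[nx _].
      by have [] := D _ (lt_trans nn0 nx).
    * by apply: cvg_at_right_filter; exact: cF.
    * by apply: cvg_at_left_filter; exact: cF.
  + move=> x; rewrite in_itv/= => /andP[nx _]; rewrite derive1E.
    by have [_ ->] := D _ (lt_trans nn0 nx).
Qed.
End kernel_integrals.

Section delta_properties.
Context {R : realType}.
Local Notation mu := (@lebesgue_measure R).
Local Notation pos := (`]0%R, +oo[%classic : set R).

(** One integrable function that dominates all the integrands below: Gaussian
    decay at infinity, a power singularity of order [b < 1] at [0]. *)
Definition dominator (b u : R) : R := expR (- u ^+ 2) * (u + 1) * (1 + u `^ (- b)).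

Lemma measurable_dominator b : measurable_fun setT (dominator b).
Proof.
have mid : measurable_fun setT (id : R -> R) by exact: measurable_id.
have mc (c : R) : measurable_fun setT (fun _ : R => c) by exact: measurable_cst.
apply: measurable_funM; last by apply: measurable_funD => //; exact: measurable_powR.
apply: measurable_funM; last exact: measurable_funD.
do 2 apply: measurableT_comp => //; exact: measurable_funX.
Qed.

Lemma dominator_ge0 b u : 0 < u -> 0 <= dominator b u.
Proof. by move=> u0; rewrite !mulr_ge0 ?expR_ge0 ?addr_ge0 ?powR_ge0// ltW. Qed.

Lemma powRN_ge1 (b u : R) : 0 <= b -> 0 < u -> u <= 1 -> 1 <= u `^ (- b).
Proof.
move=> b0 u0 u1; have u01 : 0 < u <= 1 by rewrite u0 u1.
by have := @ger_powR _ u u01 (- b) 0; rewrite powRr0; apply; rewrite oppr_le0.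
Qed.

Lemma dominator_le1 b u : 0 < b -> 0 < u -> u <= 1 -> dominator b u <= 4 * u `^ (- b).
Proof.
move=> b0 u0 u1; rewrite /dominator.
have p1 := powRN_ge1 (ltW b0) u0 u1.
have e1 : expR (- u ^+ 2) <= 1 by rewrite expR_le1 oppr_le0 sqr_ge0.
have h : expR (- u ^+ 2) * (u + 1) <= 2.
  rewrite -[leRHS]mul1r ler_pM ?expR_ge0//; lra.
apply: (@le_trans _ _ (2 * (u `^ (- b) + u `^ (- b)))); last by lra.
apply: ler_pM => //; first by rewrite mulr_ge0 ?expR_ge0// addr_ge0// ltW.
  by rewrite addr_ge0// powR_ge0.
by rewrite lerD2r.
Qed.

Lemma dominator_ge1 b u : 0 < b -> 1 <= u -> dominator b u <= 4 * gauss_weight 0 u.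
Proof.
move=> b0 u1; rewrite /dominator /gauss_weight !addr0.
have p1 : u `^ (- b) <= 1.
  have := @ler_powR _ u u1 (- b) 0; rewrite powRr0; apply.
  by rewrite oppr_le0 ltW.
have e0 := expR_ge0 (- u ^+ 2).
rewrite [leRHS](_ : _ = expR (- u ^+ 2) * (2 * u) * 2); last by ring.
rewrite ler_pM ?mulr_ge0 ?addr_ge0 ?powR_ge0//; [lra| |lra].
by rewrite ler_wpM2l//; lra.
Qed.

(** Comparison with [4 u^(-b)] on [[0, 1]] and with four times the Gaussian
    weight beyond [1]. *)
Lemma integrable_dominator b : 0 < b -> b < 1 ->
  mu.-integrable pos (EFin \o dominator b).
Proof.
move=> b0 b1; have md (A : set R) : measurable_fun A (EFin \o dominator b).
  by apply/measurable_EFinP/measurable_funTS; exact: measurable_dominator.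
have mp : measurable_fun setT (fun x : R => 4 * x `^ (- b)).
  by apply: measurable_funM; [exact: measurable_cst | exact: measurable_powR].
apply/integrableP; split; first exact: md.
have posE : pos = `]0, 1]%classic `|` `]1, +oo[%classic.
  apply/seteqP; split => x /=; rewrite !in_itv/= !andbT.
    by move=> x0; case: (leP x 1) => x1; [left; rewrite x0 | right].
  by move=> [/andP[]//|]; apply: lt_trans; exact: ltr01.
have -> : (\int[mu]_(x in pos) `|(EFin \o dominator b) x| =
    \int[mu]_(x in pos) (dominator b x)%:E)%E.
  apply: eq_integral => x /=.
  by rewrite inE/= in_itv/= andbT => x0; rewrite ger0_norm// dominator_ge0.
rewrite posE ge0_integral_setU//=; last 3 first.
- exact: md.
- move=> x xU; have : pos x by rewrite posE.
  rewrite /= in_itv/= andbT => x0.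
  by rewrite lee_fin dominator_ge0.
- apply/disj_set2P; apply/seteqP; split => // x [] /=; rewrite !in_itv/=.
  by move=> /andP[_ x1]; rewrite andbT ltNge x1.
apply: lte_add_pinfty.
  apply: (@le_lt_trans _ _ (4%:E * ((1 - b)^-1)%:E)%E); last exact: ltry.
  apply: le_trans (lee_wpmul2l _ (integral_powR_le b0 b1)); last by rewrite lee_fin.
  rewrite -ge0_integralZl//=; last 2 first.
  - by apply/measurable_EFinP/measurable_funTS; exact: measurable_powR.
  - by move=> x _; rewrite lee_fin powR_ge0.
  apply: ge0_le_integral => //=.
  - by move=> x /=; rewrite in_itv/= => /andP[x0 _]; rewrite lee_fin dominator_ge0.
  - exact: md.
  - exact/measurable_EFinP/measurable_funTS.
  - by move=> x /=; rewrite in_itv/= => /andP[x0 x1]; rewrite lee_fin dominator_le1.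
apply: (@le_lt_trans _ _ (4%:E * (2^-1 : R)%:E)%E); last exact: ltry.
rewrite -integral_gauss_weight0.
rewrite -ge0_integralZl//=; last 2 first.
- by apply/measurable_EFinP/measurable_funTS; exact: measurable_gauss_weight.
- by move=> x /=; rewrite in_itv/= andbT => x0; rewrite lee_fin gauss_weight_ge0// ltW.
have mg : measurable_fun setT (fun x : R => 4 * gauss_weight 0 x).
  by apply: measurable_funM; [exact: measurable_cst | exact: measurable_gauss_weight].
apply: (@le_trans _ _ (\int[mu]_(x in `]1%R, +oo[) (4 * gauss_weight 0 x)%:E)%E).
  apply: ge0_le_integral => //=.
  - move=> x /=; rewrite in_itv/= andbT => x1; rewrite lee_fin dominator_ge0//.
    exact: lt_trans x1.
  - exact: md.
  - exact/measurable_EFinP/measurable_funTS.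
  - by move=> x /=; rewrite in_itv/= andbT => x1; rewrite lee_fin dominator_ge1// ltW.
apply: ge0_subset_integral => //=.
- exact/measurable_EFinP/measurable_funTS.
- move=> x /=; rewrite in_itv/= andbT => x0; rewrite lee_fin mulr_ge0//.
  by rewrite gauss_weight_ge0// ltW.
- by move=> x /=; rewrite !in_itv/= !andbT; exact: lt_trans.
Qed.

Lemma dominated_pos (f : R -> R) (C b : R) : 0 < b -> b < 1 ->
  measurable_fun setT f -> (forall u, 0 < u -> `|f u| <= C * dominator b u) ->
  mu.-integrable pos (EFin \o f).
Proof.
move=> b0 b1 mf fC.
apply: (le_integrable _ _ _ (integrableZl _ C (integrable_dominator b0 b1))) => //.
- exact/measurable_EFinP/measurable_funTS.
- move=> u /=; rewrite in_itv/= andbT => u0; rewrite lee_fin.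
  by rewrite (le_trans (fC _ u0))// ler_norm.
Qed.

Lemma cvg_integral_pos (f_ : nat -> R -> R) (f : R -> R) (C b : R) :
  0 < b -> b < 1 -> (forall n, measurable_fun setT (f_ n)) ->
  measurable_fun setT f ->
  (forall u, 0 < u -> f_ n u @[n --> \oo] --> f u) ->
  (forall n u, 0 < u -> `|f_ n u| <= C * dominator b u) ->
  \int[mu]_(u in pos) f_ n u @[n --> \oo] --> \int[mu]_(u in pos) f u.
Proof.
move=> b0 b1 mf_ mf fcvg fC.
have [|||||fint _ cvf] := @dominated_convergence _ _ _ mu pos
  (measurable_itv _)
  (fun n => EFin \o f_ n) (EFin \o f) (EFin \o (fun u => C * dominator b u)).
- by move=> n; apply/measurable_EFinP/measurable_funTS; exact: mf_.
- by apply/measurable_EFinP/measurable_funTS; exact: mf.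
- apply: aeW => u /=; rewrite in_itv/= andbT => u0.
  by apply/fine_cvgP; split; [apply: nearW => n | exact: fcvg].
- exact: (integrableZl _ C (integrable_dominator b0 b1)).
- apply: aeW => u n /=; rewrite in_itv/= andbT => u0.
  by rewrite lee_fin; exact: fC.
rewrite /Rintegral; apply: fine_cvg.
by rewrite fineK//; exact: integrable_fin_num.
Qed.

Lemma gauss_weight_le (b u : R) : 0 <= b -> 0 < u ->
  gauss_weight b u <= (1 + b) * (expR (- u ^+ 2) * (u + 1)).
Proof.
move=> b0 u0; rewrite /gauss_weight.
rewrite [leRHS](_ : _ = expR (- u ^+ 2) * ((1 + b) * (u + 1))); last by ring.
apply: ler_pM; rewrite ?expR_ge0//.
- by rewrite addr_ge0// ltW.
- have u0' := ltW u0; rewrite ler_expR lerN2 ler_sqr ?nnegrE ?addr_ge0//.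
  by rewrite lerDl.
- by nra.
Qed.

End delta_properties.

Section delta_lemmas.
Context {R : realType}.
Local Notation mu := (@lebesgue_measure R).
Local Notation pos := (`]0%R, +oo[%classic : set R).

Lemma deltaE (alpha r s : R) : 0 < r ->
  delta alpha r s = 2 * expR ((s / (2 * Num.sqrt r)) ^+ 2) *
    \int[mu]_(u in pos)
      (gauss_weight (s / (2 * Num.sqrt r)) u * (u / Num.sqrt r) `^ (- alpha)).
Proof.
move=> r0; rewrite /delta /gauss_weight; congr (_ * _); congr (_ * expR _).
by rewrite expr_div_n exprMn sqr_sqrtr ?ltW//; congr (_ / _); ring.
Qed.

Lemma measurable_gauss_times (b : R) (g : R -> R) : measurable_fun setT g ->
  measurable_fun setT (fun u => gauss_weight b u * g u).
Proof. by move=> mg; apply: measurable_funM => //; exact: measurable_gauss_weight. Qed.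

Lemma gauss_times_dominated (b C beta u g : R) : 0 <= b -> 0 < u ->
  `|g| <= C * (1 + u `^ (- beta)) ->
  `|gauss_weight b u * g| <= (1 + b) * C * dominator beta u.
Proof.
move=> b0 u0 gC; rewrite normrM (ger0_norm (gauss_weight_ge0 b0 (ltW u0))).
rewrite /dominator [leRHS](_ : _ =
  ((1 + b) * (expR (- u ^+ 2) * (u + 1))) * (C * (1 + u `^ (- beta)))); last by ring.
rewrite ler_pM//; first exact: gauss_weight_ge0 b0 (ltW u0).
exact: gauss_weight_le.
Qed.

Lemma measurable_scaled_powR (c a : R) : measurable_fun setT (fun u : R => (u / c) `^ a).
Proof.
apply: (measurableT_comp (@measurable_powR _ a)).
apply: measurable_funM; first exact: measurable_id.
exact: measurable_cst.
Qed.

Lemma scaled_powRE (c a u : R) : 0 < c -> 0 < u ->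
  (u / c) `^ (- a) = c `^ a * u `^ (- a).
Proof.
move=> c0 u0; rewrite powRM ?invr_ge0 ?(ltW u0) ?(ltW c0)// mulrC; congr (_ * _).
by rewrite -(powR_inv1 (ltW c0)) -powRrM mulN1r opprK.
Qed.

Lemma scaled_powR_le (c a u : R) : 0 < c -> 0 < u ->
  `|(u / c) `^ (- a)| <= c `^ a * (1 + u `^ (- a)).
Proof.
move=> c0 u0; rewrite ger0_norm ?powR_ge0// scaled_powRE//.
by rewrite ler_wpM2l ?powR_ge0// lerDr.
Qed.

Lemma integrable_delta (alpha b c : R) : 0 < alpha -> alpha < 1 -> 0 <= b -> 0 < c ->
  mu.-integrable pos (EFin \o (fun u => gauss_weight b u * (u / c) `^ (- alpha))).
Proof.
move=> a0 a1 b0 c0; apply: (dominated_pos (C := (1 + b) * c `^ alpha) a0 a1).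
  by apply: measurable_gauss_times; exact: measurable_scaled_powR.
move=> u u0; apply: gauss_times_dominated => //.
exact: scaled_powR_le.
Qed.

(** Dominated convergence; the exponent [beta] of the bound may exceed [alpha],
    which leaves room for a Potter bound on [g_ n]. *)
Lemma cvg_delta_tail (alpha beta r s C : R) (g_ : nat -> R -> R) :
  0 < beta -> beta < 1 -> 0 < r -> 0 <= s ->
  (forall n, measurable_fun setT (g_ n)) ->
  (forall n u, 0 < u -> `|g_ n u| <= C * (1 + u `^ (- beta))) ->
  (forall u, 0 < u -> g_ n u @[n --> \oo] --> (u / Num.sqrt r) `^ (- alpha)) ->
  2 * expR ((s / (2 * Num.sqrt r)) ^+ 2) *
    (\int[mu]_(u in pos) (gauss_weight (s / (2 * Num.sqrt r)) u * g_ n u))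
   @[n --> \oo] --> delta alpha r s.
Proof.
move=> b0 b1 r0 s0 mg gC gcvg; rewrite deltaE//.
have bb : 0 <= s / (2 * Num.sqrt r) by rewrite divr_ge0// mulr_ge0// sqrtr_ge0.
apply: cvgMl_tmp; apply: (cvg_integral_pos (C := (1 + s / (2 * Num.sqrt r)) * C) b0 b1).
- by move=> n; exact: measurable_gauss_times.
- by apply: measurable_gauss_times; exact: measurable_scaled_powR.
- by move=> u u0; apply: cvgMl_tmp; exact: gcvg.
- by move=> n u u0; apply: gauss_times_dominated => //; exact: gC.
Qed.

(** Homogeneity: rescaling the observations by [c] changes [r] by [c^2] and [s]
    by [c], and leaves the shift [s / (2 sqrt r)] unchanged. *)
Lemma delta_scale (alpha r s c : R) : 0 < alpha -> alpha < 1 -> 0 < c -> 0 < r ->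
  0 <= s -> delta alpha (c ^+ 2 * r) (c * s) = c `^ alpha * delta alpha r s.
Proof.
move=> a0 a1 c0 r0 s0; rewrite !deltaE//; last by rewrite mulr_gt0// exprn_gt0.
have sr0 : 0 < Num.sqrt r by rewrite sqrtr_gt0.
have -> : Num.sqrt (c ^+ 2 * r) = c * Num.sqrt r.
  by rewrite sqrtrM ?sqr_ge0// sqrtr_sqr gtr0_norm.
have -> : c * s / (2 * (c * Num.sqrt r)) = s / (2 * Num.sqrt r).
  by field; rewrite !gt_eqF.
set b := s / (2 * Num.sqrt r).
have b0 : 0 <= b by rewrite divr_ge0// mulr_ge0// ltW.
rewrite mulrCA; congr (_ * _).
rewrite -RintegralZl//; last exact: integrable_delta.
apply: eq_Rintegral => u; rewrite inE/= in_itv/= andbT => u0.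
rewrite mulrCA; congr (_ * _).
have -> : u / (c * Num.sqrt r) = c^-1 * (u / Num.sqrt r) by field; rewrite !gt_eqF.
have us0 : 0 <= u / Num.sqrt r by rewrite divr_ge0// ltW.
rewrite (@powRM _ c^-1 (u / Num.sqrt r)) ?invr_ge0 ?(ltW c0)//.
by rewrite -(powR_inv1 (ltW c0)) -powRrM mulN1r opprK.
Qed.

(** On the interval from [v / 2] to [v] the integrand is at least its crudest
    lower bound; the factor [exp (s^2 / (4 r))] in front cancels the term [exp
    (- b^2)] of the Gaussian. *)
Lemma delta_lower (alpha r s v : R) : 0 < alpha -> alpha < 1 -> 0 < r ->
  0 <= s -> 0 < v ->
  v * (expR (- (v ^+ 2 + s / Num.sqrt r * v)) *
       (s / (2 * Num.sqrt r) + v / 2) * (v / Num.sqrt r) `^ (- alpha))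
  <= delta alpha r s.
Proof.
move=> a0 a1 r0 s0 v0; rewrite deltaE//.
have sr0 : 0 < Num.sqrt r by rewrite sqrtr_gt0.
have b0 : 0 <= s / (2 * Num.sqrt r) by rewrite divr_ge0// mulr_ge0// ltW.
have -> : s / Num.sqrt r = 2 * (s / (2 * Num.sqrt r)) by field; rewrite gt_eqF.
move: (s / (2 * Num.sqrt r)) b0 => b b0.
pose c := expR (- (v ^+ 2 + 2 * b * v)) * (b + v / 2) * (v / Num.sqrt r) `^ (- alpha).
rewrite -/c.
have c0 : 0 <= c.
  by rewrite !mulr_ge0 ?powR_ge0 ?expR_ge0// addr_ge0// divr_ge0// ltW.
have gw u : v / 2 < u < v ->
    expR (- b ^+ 2) * c <= gauss_weight b u * (u / Num.sqrt r) `^ (- alpha).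
  move=> /andP[vu uv]; have u0 : 0 < u by rewrite (lt_trans _ vu)// divr_gt0.
  rewrite /c /gauss_weight !mulrA -expRD.
  apply: ler_pM; rewrite ?powR_ge0//.
  - by rewrite mulr_ge0 ?expR_ge0// addr_ge0// divr_ge0// ltW.
  - apply: ler_pM; rewrite ?expR_ge0//.
    + by rewrite addr_ge0// divr_ge0// ltW.
    + rewrite ler_expR.
      have h1 : u ^+ 2 <= v ^+ 2 by rewrite ler_sqr ?nnegrE ?(ltW u0) ?(ltW v0)// ltW.
      have h2 : b * u <= b * v by rewrite ler_wpM2l// ltW.
      have -> : - (u + b) ^+ 2 = - u ^+ 2 - 2 * (b * u) - b ^+ 2 by ring.
      by lra.
    + lra.
  - rewrite !powRN lef_pV2 ?posrE ?powR_gt0 ?divr_gt0//.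
    rewrite ge0_ler_powR ?nnegrE ?divr_ge0 ?ltW//.
    by rewrite ltr_pM2r ?invr_gt0.
have I : v / 2 * (expR (- b ^+ 2) * c) <=
   \int[mu]_(u in pos) (gauss_weight b u * (u / Num.sqrt r) `^ (- alpha)).
  rewrite -lee_fin /Rintegral fineK; last first.
    by apply: integrable_fin_num => //; exact: integrable_delta.
  have mD (A : set R) : measurable_fun A
      (fun u => (gauss_weight b u * (u / Num.sqrt r) `^ (- alpha))%:E).
    apply/measurable_EFinP/measurable_funTS.
    by apply: measurable_gauss_times; exact: measurable_scaled_powR.
  apply: (@le_trans _ _ (\int[mu]_(u in `](v / 2)%R, v[)
      (gauss_weight b u * (u / Num.sqrt r) `^ (- alpha))%:E)%E).
    apply: (@le_trans _ _ (\int[mu]_(u in `](v / 2)%R, v[) (expR (- b ^+ 2) * c)%:E)%E).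
      rewrite integral_cst//= lebesgue_measure_itv/= lte_fin.
      rewrite ltr_pdivrMr// ltr_pMr// ltr1n -EFinB -EFinM lee_fin.
      by rewrite le_eqVlt; apply/orP; left; apply/eqP; field.
    apply: ge0_le_integral => //=.
    - by move=> u _; rewrite lee_fin mulr_ge0// expR_ge0.
    - exact: mD.
  apply: ge0_subset_integral => //=.
  - exact: mD.
  - move=> u /=; rewrite in_itv/= andbT => u0; rewrite lee_fin.
    by rewrite mulr_ge0 ?powR_ge0// gauss_weight_ge0// ltW.
  - move=> u /=; rewrite !in_itv/= andbT => /andP[vu _].
    by rewrite (lt_trans _ vu)// divr_gt0.
rewrite (_ : v * c = 2 * expR (b ^+ 2) * (v / 2 * (expR (- b ^+ 2) * c))).
  by rewrite ler_wpM2l// mulr_ge0// expR_ge0.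
rewrite expRN; field.
by rewrite gt_eqF// expR_gt0.
Qed.

Lemma delta_gt0 (alpha r s : R) : 0 < alpha -> alpha < 1 -> 0 < r -> 0 <= s ->
  0 < delta alpha r s.
Proof.
move=> a0 a1 r0 s0; apply: lt_le_trans (delta_lower a0 a1 r0 s0 ltr01).
rewrite mul1r !mulr_gt0 ?expR_gt0 ?powR_gt0 ?divr_gt0 ?sqrtr_gt0//.
by rewrite ltr_wpDl// ?divr_ge0// ?mulr_ge0 ?sqrtr_ge0.
Qed.

(** The lower bound [delta_lower] at [v = sqrt r / s]: it shows that [delta
    alpha r s] grows at least like [s^alpha]. *)
Lemma delta_lower_large (alpha r s : R) : 0 < alpha -> alpha < 1 -> 0 < r ->
  1 <= s -> expR (- (r + 1)) / 2 * s `^ alpha <= delta alpha r s.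
Proof.
move=> a0 a1 r0 s1; have s0 : 0 < s by rewrite (lt_le_trans _ s1).
have sr0 : 0 < Num.sqrt r by rewrite sqrtr_gt0.
have v0 : 0 < Num.sqrt r / s by rewrite divr_gt0.
apply: le_trans (delta_lower a0 a1 r0 (ltW s0) v0).
have -> : s / Num.sqrt r * (Num.sqrt r / s) = 1 by field; rewrite !gt_eqF.
have -> : (Num.sqrt r / s / Num.sqrt r) `^ (- alpha) = s `^ alpha.
  have -> : Num.sqrt r / s / Num.sqrt r = s^-1 by field; rewrite !gt_eqF.
  by rewrite -(powR_inv1 (ltW s0)) -powRrM mulN1r opprK.
rewrite [leRHS](_ : _ = expR (- ((Num.sqrt r / s) ^+ 2 + 1)) *
    (1 / 2 + (Num.sqrt r / s) ^+ 2 / 2) * s `^ alpha); last first.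
  by field; rewrite !gt_eqF.
rewrite ler_wpM2r ?powR_ge0//.
rewrite ler_pM ?expR_ge0//.
- rewrite ler_expR lerN2 lerD2r expr_div_n sqr_sqrtr ?(ltW r0)//.
  by rewrite ler_pdivrMr ?exprn_gt0// ler_peMr ?(ltW r0)// exprn_ege1.
- by rewrite mul1r lerDl divr_ge0// sqr_ge0.
Qed.

End delta_lemmas.

(** * Regularly varying tails *)

Section survival.
Context {R : realType} d (T : measurableType d) (P : probability T R).

Definition survival (Z : T -> R) (x : R) : R := fine (P [set w | x < Z w]).

Variable Z : T -> R.
Hypothesis mZ : measurable_fun setT Z.

Let mgt x : measurable [set w | x < Z w].
Proof.
rewrite (_ : [set _ | _] = Z @^-1` `]x, +oo[%classic).
  by rewrite -[X in measurable X]setTI; apply: mZ => //; exact: measurable_itv.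
by apply/seteqP; split => w /=; rewrite in_itv/= andbT.
Qed.

Let indic_gt x w : \1_[set w | x < Z w] w = ((x < Z w)%R)%:R :> R.
Proof.
rewrite indicE; have -> // : (w \in [set w | x < Z w]) = (x < Z w).
by apply/idP/idP; rewrite inE.
Qed.

Lemma survival_ge0 x : 0 <= survival Z x.
Proof. by rewrite /survival fine_ge0. Qed.

Lemma survival_le1 x : survival Z x <= 1.
Proof.
by rewrite /survival -lee_fin fineK ?fin_num_measure//; exact: probability_le1.
Qed.

Lemma survival_ni x y : x <= y -> survival Z y <= survival Z x.
Proof.
move=> xy; rewrite /survival fine_le ?fin_num_measure//.
by rewrite le_measure ?inE// => w /=; exact: le_lt_trans.
Qed.

Lemma measurable_survival : measurable_fun setT (survival Z).
Proof. by apply: nonincreasing_measurable => // x y; exact: survival_ni. Qed.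

Lemma mean_gt (x : R) : \int[P]_w ((x < Z w)%R)%:R = survival Z x.
Proof.
rewrite /survival -mean_indic//; by apply: eq_mean => w; rewrite indic_gt.
Qed.

(** The function [1 - exp (- (z^2 + 2 b z))] is the integral from [0] to [z] of
    its derivative [2 exp (b^2) gauss_weight b]; Tonelli exchanges this
    integral with the mean. *)
Lemma gauss_layer_cake (b : R) : 0 <= b -> (forall w, 0 <= Z w) ->
  1 - \int[P]_w expR (- (Z w ^+ 2 + 2 * b * Z w)) =
  2 * expR (b ^+ 2) *
  \int[lebesgue_measure]_(u in `]0, +oo[) (gauss_weight b u * survival Z u).
Proof.
move=> b0 Z0.
pose k (u : R) := if 0 < u then gauss_weight b u else 0.
have k0 u : 0 <= k u.
  by rewrite /k; case: ifPn => // u0; rewrite gauss_weight_ge0// ltW.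
have mk : measurable_fun setT k.
  apply: measurable_fun_ifT; last exact: measurable_cst.
    by apply: measurable_fun_ltr => //; exact: measurable_cst.
  exact: measurable_gauss_weight.
pose f (p : T * R) : \bar R := (k p.2 * (if p.2 < Z p.1 then 1 else 0))%:E.
have mf : measurable_fun setT f.
  apply/measurable_EFinP; apply: measurable_funM.
    exact: (measurableT_comp mk (@measurable_snd _ _ _ _)).
  apply: measurable_fun_ifT; [|exact: measurable_cst|exact: measurable_cst].
  apply: measurable_fun_ltr; first exact: measurable_snd.
  exact: (measurableT_comp mZ (@measurable_fst _ _ _ _)).
have f0 p : (0 <= f p)%E by rewrite lee_fin mulr_ge0//; case: ifP.
have := fubini_tonelli (m1 := P) (m2 := @lebesgue_measure R) f mf f0.
pose c := 2^-1 * expR (- b ^+ 2).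
pose E w := expR (- (Z w ^+ 2 + 2 * b * Z w)).
have mE : bounded_measurable E.
  apply: bmeas_le01.
    apply: measurableT_comp => //; apply: measurableT_comp => //.
    apply: measurable_funD; first exact: measurable_funX.
    by apply: measurable_funM => //; exact: measurable_cst.
  move=> w; rewrite expR_ge0 expR_le1 oppr_le0 addr_ge0 ?sqr_ge0//.
  by rewrite !mulr_ge0.
have -> : (\int[P]_w \int[lebesgue_measure]_u f (w, u))%E =
    (c * (1 - \int[P]_w E w))%:E.
  transitivity (\int[P]_w (c * (1 - E w))%:E)%E.
    apply: eq_integral => w _; rewrite -integral_gauss_weight// [RHS]integral_mkcond.
    apply: eq_integral => u _; rewrite /f /k patchE /=.
    case: ifPn => [u0|u0]; case: ifPn => [uZ|uZ]; rewrite ?mulr1 ?mulr0 ?mul0r.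
    - by rewrite ifT// inE/= in_itv/= u0 uZ.
    - by rewrite ifF//; apply/negP; rewrite inE/= in_itv/= => /andP[_]; exact/negP.
    - by rewrite ifF//; apply/negP; rewrite inE/= in_itv/= (negbTE u0).
    - by rewrite ifF//; apply/negP; rewrite inE/= in_itv/= (negbTE u0).
  have bE : bounded_measurable (fun w => 1 - E w).
    by apply: bmeasB => //; exact: bmeas_cst.
  have := expectation_bmeas P (bmeasM (bmeas_cst T c) bE).
  rewrite unlock => ->; congr EFin.
  rewrite meanZ// meanB//; last exact: bmeas_cst.
  by rewrite mean_cst.
have -> : (\int[lebesgue_measure]_u \int[P]_w f (w, u))%E =
    (\int[lebesgue_measure]_(u in `]0%R, +oo[) (gauss_weight b u * survival Z u)%:E)%E.
  rewrite [RHS]integral_mkcond; apply: eq_integral => u _; rewrite patchE /=.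
  have bi : bounded_measurable (fun w => ((u < Z w)%R)%:R : R).
    by apply: bmeas_bool; apply: measurable_fun_ltr => //; exact: measurable_cst.
  transitivity ((k u * survival Z u)%:E).
    rewrite -mean_gt -meanZ//.
    have := expectation_bmeas P (bmeasM (bmeas_cst T (k u)) bi).
    rewrite unlock => <-; apply: eq_integral => w _.
    by rewrite /f/=; case: (u < Z w).
  rewrite /k; case: ifPn => u0; first by rewrite ifT// inE/= in_itv/= u0.
  by rewrite mul0r ifF//; apply/negP; rewrite inE/= in_itv/= (negbTE u0).
move=> h; rewrite /Rintegral -h/=.
rewrite /c mulrA (_ : 2 * _ * _ = 1) ?mul1r//.
by rewrite expRN; field; rewrite gt_eqF// expR_gt0.
Qed.

End survival.

Section regular_variation.
Context {R : realType} (G : R -> R) (alpha : R).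
Hypothesis G_le1 : forall x, G x <= 1.
Hypothesis G_ni : forall x y, x <= y -> G y <= G x.
Hypothesis alpha0 : 0 < alpha.
Hypothesis G_pos : forall x, 0 < G x.
Hypothesis G_rv : forall k : R, 0 < k -> G (k * x) / G x @[x --> +oo] --> k `^ (- alpha).

Let G_ge0 x : 0 <= G x. Proof. exact: ltW. Qed.

(** Eventually halving the argument multiplies [G] by less than [2^beta].
    Iterating gives the power [y^(-beta)] as long as the argument stays above
    [x0]. Once [a / 2 < x0], the bound [G <= 1] is enough, because then [G a >=
    G (2 x0) > 0]. *)
Lemma potter_bound (beta : R) : alpha < beta -> exists C x0 : R,
  [/\ 0 < x0, 0 <= C & forall a y : R, x0 <= a -> 0 < y ->
    G (a * y) <= C * (1 + y `^ (- beta)) * G a].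
Proof.
move=> ab.
have half : (2^-1 : R) `^ (- alpha) < 2 `^ beta.
  rewrite -powR_inv1// -powRrM mulN1r opprK /powR.
  by rewrite pnatr_eq0/= ltr_expR ltr_pM2r// ln_gt0// ltr1n.
have h2 : 0 < (2^-1 : R) by rewrite invr_gt0.
have [x1 [_ Hx1]] := cvgr_lt _ (G_rv h2) _ half.
pose x0 := Num.max 1 (x1 + 1).
have x0_gt0 : 0 < x0 by rewrite lt_max ltr01.
have Hhalf a : x0 <= a -> G (a / 2) <= 2 `^ beta * G a.
  move=> xa; rewrite -ler_pdivrMr// mulrC ltW// mulrC.
  rewrite [a / 2]mulrC; apply: Hx1.
  by rewrite (lt_le_trans _ xa)// lt_max ltrDl ltr01 orbT.
have two_beta : 1 <= 2 `^ beta.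
  have := @ler_powR R 2 (ler1n _ 2) 0 beta; rewrite powRr0; apply.
  by rewrite ltW// (lt_trans alpha0).
pose C := Num.max (2 `^ beta) (G (2 * x0))^-1.
have C0 : 0 < C by rewrite lt_max powR_gt0.
have pw (y : R) : 0 < y -> y <= 1 -> 1 <= y `^ (- beta).
  by apply: powRN_ge1; rewrite ltW// (lt_trans alpha0).
(* each step trades a halving of a for a doubling of y *)
have key k : forall a y : R, x0 <= a -> 2^-1 ^+ k <= y -> y <= 1 ->
    G (a * y) <= C * y `^ (- beta) * G a.
  elim: k => [|k IH] a y xa ky y1.
    have -> : y = 1 by apply/eqP; rewrite eq_le y1 -(expr0 2^-1).
    by rewrite mulr1 powR1 mulr1 ler_peMl// le_max two_beta.
  have y0 : 0 < y by rewrite (lt_le_trans _ ky)// exprn_gt0// invr_gt0.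
  have [y2|y2] := leP y 2^-1; last first.
    apply: (@le_trans _ _ (G (a / 2))).
      by apply: G_ni; rewrite ler_wpM2l// ltW// (lt_le_trans _ xa).
    rewrite (le_trans (Hhalf _ xa))// ler_wpM2r//.
    rewrite -[leLHS]mulr1 ler_pM ?powR_ge0//; first by rewrite le_max lexx.
    exact: pw.
  have [xa2|xa2] := leP x0 (a / 2).
    have -> : a * y = a / 2 * (2 * y) by field.
    have h1 : 2^-1 ^+ k <= 2 * y.
      by rewrite -ler_pdivrMl// -exprS.
    have h3 : 2 * y <= 1 by rewrite -ler_pdivlMl// mulr1.
    apply: (le_trans (IH _ _ xa2 h1 h3)).
    rewrite powRM ?(ltW y0)//.
    have -> : C * y `^ (- beta) * G a = C * (2 `^ (- beta) * y `^ (- beta)) * (2 `^ beta * G a).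
      rewrite [X in _ = _ * (X * _) * _]powRN; field.
      by rewrite gt_eqF// powR_gt0.
    apply: ler_wpM2l; last exact: Hhalf.
    by rewrite !mulr_ge0 ?powR_ge0 ?(ltW C0).
  apply: (le_trans (G_le1 _)).
  have Ga : G (2 * x0) <= G a.
    by apply: G_ni; rewrite mulrC -ler_pdivrMr// ltW.
  apply: (@le_trans _ _ (C * G a)).
    apply: (@le_trans _ _ ((G (2 * x0))^-1 * G a)).
      by rewrite mulrC ler_pdivlMr// mul1r.
    by rewrite ler_wpM2r// le_max lexx orbT.
  by rewrite ler_wpM2r// ler_peMr ?(ltW C0)// pw.
exists C, x0; split => //; first exact: ltW.
move=> a y xa y0.
have C1 : 1 <= C by rewrite le_max two_beta.
have [y1|y1] := leP y 1; last first.
  apply: (@le_trans _ _ (G a)).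
    by apply: G_ni; rewrite ler_peMr ?ltW// (lt_le_trans _ xa).
  by rewrite ler_peMl// mulr_ege1// lerDl powR_ge0.
have [k _ Hk] : \forall k \near \oo, (2^-1 : R) ^+ k < y.
  by apply: (cvgr_lt _ (cvg_expr _)) => //; rewrite ger0_norm ?invr_ge0// invf_lt1// ltr1n.
apply: (le_trans (key k _ _ xa (ltW (Hk k (leqnn k))) y1)).
by rewrite ler_wpM2r// ler_wpM2l ?(ltW C0)// lerDr.
Qed.

Hypothesis G_0 : G x @[x --> +oo] --> 0.

(** A nearly minimal point of the set where [t n * G <= 1]: there [G] is at
    most [1 / t n], while at a slightly smaller point it exceeds [1 / t n].
    Regular variation makes the two values of [G] comparable, even where [G]
    jumps. *)
Lemma quantile_sequence (t : nat -> R) : t n @[n --> \oo] --> +oo ->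
  exists a : nat -> R, [/\ forall n, 0 < a n, a n @[n --> \oo] --> +oo &
    t n * G (a n) @[n --> \oo] --> (1 : R)].
Proof.
move=> tn.
have tgt A : \forall n \near \oo, A < t n by move: A; apply/cvgryPgt.
have qex n : exists a : R, 0 < a /\ (1 < t n * G 1 ->
    t n * G a <= 1 /\ 1 < t n * G (a / (1 + n.+1%:R^-1))).
  have [tG|_] := ltP 1 (t n * G 1); last by exists 1.
  have t0 : 0 < t n by rewrite -(pmulr_lgt0 _ (G_pos 1)) (lt_trans _ tG).
  pose S := [set x | t n * G x <= 1].
  have lS : lbound S 1.
    move=> x Sx; rewrite leNgt; apply/negP => x1.
    have h : t n * G 1 <= t n * G x by rewrite ler_wpM2l ?(ltW t0)// G_ni// ltW.
    by have := lt_le_trans tG (le_trans h Sx); rewrite ltxx.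
  have S0 : S !=set0.
    have [x1 [_ Hx]] : \forall x \near +oo, G x < (t n)^-1.
      by apply: (cvgr_lt _ G_0); rewrite invr_gt0.
    exists (x1 + 1); rewrite /S/= mulrC -ler_pdivlMr// mul1r ltW// Hx//.
    by rewrite ltrDl.
  have hS : has_inf S by split => //; exists 1.
  have q1 : 1 < 1 + n.+1%:R^-1 :> R by rewrite ltrDl invr_gt0.
  have i1 : 1 <= inf S by exact: lb_le_inf.
  have i0 : 0 < inf S by rewrite (lt_le_trans _ i1).
  (* inf S / n.+1 makes x / (1 + n.+1^-1) fall below inf S *)
  have [x Sx xi] := @inf_adherent _ S (inf S / n.+1%:R) (divr_gt0 i0 (ltr0Sn _ _)) hS.
  have x1 : 1 <= x by exact: lS.
  exists x; split; first by rewrite (lt_le_trans _ x1).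
  move=> _; split => //; rewrite ltNge; apply/negP => Sq.
  have := @ge_inf _ S (ex_intro _ 1 lS) _ Sq.
  rewrite ler_pdivlMr ?(lt_trans _ q1)// leNgt => /negP; apply.
  by rewrite mulrDr mulr1.
have [a Ha] := choice qex.
exists a; have a0 n : 0 < a n by case: (Ha n).
have tG1 : \forall n \near \oo, 1 < t n * G 1.
  near=> n; rewrite -ltr_pdivrMr// div1r; near: n.
  exact: tgt.
have ay : a n @[n --> \oo] --> +oo.
  apply/cvgryPge => K.
  have tK : \forall n \near \oo, (G K)^-1 < t n by exact: tgt.
  near=> n; rewrite leNgt; apply/negP => aK.
  have [|tGa _] := (Ha n).2; first by near: n.
  have tK' : (G K)^-1 < t n by near: n.
  have t0 : 0 < t n by rewrite (lt_trans _ tK')// invr_gt0.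
  have : t n * G K <= 1.
    by apply: le_trans tGa; rewrite ler_wpM2l ?(ltW t0)// G_ni// ltW.
  rewrite leNgt -ltr_pdivrMr// div1r => /negP; exact.
split => //; apply/cvgrPdist_le => e e0.
(* k = m `^ alpha^-1 makes the limit of G (k * a n) / G (a n) equal to m^-1 *)
pose m : R := Num.max 2^-1 (1 - e / 2).
have m0 : 0 < m by rewrite lt_max invr_gt0 ltr0n.
have m1 : m < 1 by rewrite gt_max invf_lt1// ltr1n/= ltrBlDr ltrDl divr_gt0.
pose k := m `^ alpha^-1.
have k0 : 0 < k by rewrite powR_gt0.
have ka : k `^ alpha = m by rewrite /k -powRrM mulVf ?gt_eqF// powRr1// ltW.
have k1 : k < 1.
  rewrite ltNge; apply/negP => k1; have := @ler_powR _ k k1 0 alpha (ltW alpha0).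
  by rewrite powRr0 ka leNgt m1.
have kGa : G (k * a n) / G (a n) @[n --> \oo] --> k `^ (- alpha).
  exact: (cvg_comp _ _ ay (G_rv k0)).
have Gka : G (a n) / G (k * a n) @[n --> \oo] --> m.
  rewrite -ka -[k `^ alpha]invrK -powRN.
  rewrite (_ : (fun n => _) = fun n => (G (k * a n) / G (a n))^-1).
    by apply: cvgV => //; rewrite gt_eqF// powR_gt0.
  by apply/funext => n; rewrite invf_div.
have me : 1 - e < m by rewrite lt_max; apply/orP; right; rewrite ltrD2l ltrN2 ltr_pdivrMr// ltr_pMr// ltr1n.
near=> n.
have [|tGa tGq] := (Ha n).2; first by near: n.
rewrite ger0_norm ?subr_ge0// lerBlDr -lerBlDl.
have t0 : 0 < t n.
  rewrite -(pmulr_lgt0 _ (G_pos (a n / (1 + n.+1%:R^-1)))).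
  by rewrite (lt_trans _ tGq).
have q0 : 0 < 1 + n.+1%:R^-1 :> R by rewrite ltr_wpDr.
have Gk : 1 <= t n * G (k * a n).
  apply: (le_trans (ltW tGq)); rewrite ler_wpM2l ?(ltW t0)// G_ni//.
  rewrite ler_pdivlMr// mulrAC ler_piMl ?(ltW (a0 n))//.
  rewrite mulrDr mulr1 -lerBrDl -ler_pdivlMl// invf_ple ?posrE//.
    rewrite (@le_trans _ _ n%:R)//; last by rewrite ler_nat.
    by near: n; exact: nbhs_infty_ger.
  by rewrite mulr_gt0// ?invr_gt0// subr_gt0.
have h : 1 - e < G (a n) / G (k * a n) by near: n; exact: (cvgr_gt _ Gka).
apply: (le_trans (ltW h)).
rewrite ler_pdivrMr// mulrAC -[leLHS]mul1r mulrC [leRHS]mulrC ler_wpM2l// ltW//.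
Unshelve. all: by end_near. Qed.

End regular_variation.

(** * The transform of one scaled observation *)

Section pareto_tail.
Context {R : realType} d (T : measurableType d) (P : probability T R).
Variables (X : {RV P >-> R}) (alpha : R).
Hypothesis alpha0 : 0 < alpha.
Hypothesis alpha1 : alpha < 1.
Hypothesis pX : pareto_type X alpha.
Local Notation G := (survival P X).

Lemma survivalE x : 1 - fine (cdf X x) = G x.
Proof.
have h : ccdf X x = P [set w | x < X w].
  rewrite /ccdf /distribution /pushforward; congr (P _).
  by apply/seteqP; split => w /=; rewrite in_itv/= andbT.
rewrite /survival -h ccdf_1_cdf fineB// fin_num_measure//.
Qed.

Let mX : measurable_fun setT X. Proof. exact: measurable_funP. Qed.

Lemma cvg_survival_y : G x @[x --> +oo] --> 0.
Proof.
have h := fine_cvg (cvg_ccdfy0 X).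
rewrite (_ : G = fine \o ccdf X); first exact: h.
apply/funext => x; rewrite -survivalE/= ccdf_1_cdf fineB// fin_num_measure//.
Qed.

(** The slowly varying factor cancels in the quotient at [k x] and [x]. The
    tail is eventually positive, hence positive everywhere, being
    nonincreasing. *)
Lemma pareto_regular : (forall x, 0 < G x) /\
  forall k : R, 0 < k -> G (k * x) / G x @[x --> +oo] --> k `^ (- alpha).
Proof.
have [l [[a [a0 _ lpos]] lsv]] := pX.
under eq_fun do rewrite survivalE.
move=> GA.
have gpos : \forall x \near +oo, 0 < G x / (x `^ (- alpha) * l x).
  exact: (cvgr_gt _ GA).
have lx : \forall x \near +oo, 0 < x /\ 0 < l x.
  near=> x; split; first by near: x; apply: nbhs_pinfty_gt; exact: num_real.
  by apply: lpos; near: x; apply: nbhs_pinfty_ge; exact: num_real.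
have Gn : \forall x \near +oo, 0 < G x.
  near=> x; rewrite lt_neqAle survival_ge0 andbT eq_sym; apply/eqP => Gx.
  have : 0 < G x / (x `^ (- alpha) * l x) by near: x.
  by rewrite Gx mul0r ltxx.
split.
  move=> x; have [M [_ HM]] := Gn.
  apply: (@lt_le_trans _ _ (G (Num.max x (M + 1)))).
    by apply: HM; rewrite lt_max ltrDl ltr01 orbT.
  by apply: survival_ni => //; rewrite le_max lexx.
move=> k k0.
have kx : k * x @[x --> +oo] --> +oo.
  apply/cvgryPge => A; near=> x; rewrite -ler_pdivrMl//; near: x.
pose A x := G x / (x `^ (- alpha) * l x).
have lim : A (k * x) / A x * k `^ (- alpha) * (l (k * x) / l x) @[x --> +oo]
    --> 1 / 1 * k `^ (- alpha) * 1.
  apply: cvgM; last exact: lsv.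
  apply: cvgMr_tmp; apply: cvgM; first exact: (cvg_comp _ _ kx GA).
  apply: cvgV; [exact: oner_neq0 | exact: GA].
rewrite divr1 mul1r mulr1 in lim.
apply: cvg_trans lim; apply: near_eq_cvg; near=> x.
have [x0 lx0] : 0 < x /\ 0 < l x by near: x.
have [kx0 lkx0] : 0 < k * x /\ 0 < l (k * x) by near: x; exact: (kx _ lx).
have Gx : 0 < G x by near: x.
rewrite /A powRM ?(ltW k0) ?(ltW x0)//.
have xa : 0 < x `^ (- alpha) by rewrite powR_gt0.
have ka : 0 < k `^ (- alpha) by rewrite powR_gt0.
field; rewrite ?(gt_eqF lx0) ?(gt_eqF lkx0) ?(gt_eqF Gx) ?(gt_eqF xa) ?(gt_eqF ka)//.
Unshelve. all: by end_near. Qed.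

(** The positive part makes the sums below nonnegative everywhere; for an
    almost surely positive [X] it changes nothing. *)
Definition scaled_pos (a : R) (w : T) : R := Num.max (X w) 0 / a.

Lemma scaled_pos_ge0 a w : 0 < a -> 0 <= scaled_pos a w.
Proof. by move=> a0; rewrite divr_ge0 ?le_max ?lexx ?orbT// ltW. Qed.

Lemma measurable_scaled_pos a : measurable_fun setT (scaled_pos a).
Proof.
apply: measurable_funM; last exact: measurable_cst.
by apply: measurable_maxr => //; exact: measurable_cst.
Qed.

(** By [gauss_layer_cake] applied to [sqrt r] times the scaled observation, the
    left-hand side is, up to a constant factor, the integral of [gauss_weight]
    against [G (a_n u / sqrt r) / G (a_n)], which tends to [(u / sqrt
    r)^(-alpha)] and is dominated through the Potter bound. *)
Lemma cvg_laplace_tail (r s : R) (a : nat -> R) : 0 < r -> 0 <= s ->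
  (forall n, 0 < a n) -> a n @[n --> \oo] --> +oo ->
  (1 - \int[P]_w expR (- (r * scaled_pos (a n) w ^+ 2 + s * scaled_pos (a n) w)))
    / G (a n) @[n --> \oo] --> delta alpha r s.
Proof.
move=> r0 s0 apos ay.
have [Gpos Grv] := pareto_regular.
have [Gge0 Gle1] : (forall x, 0 <= G x) /\ (forall x, G x <= 1).
  by split=> x; [exact: survival_ge0 | exact: survival_le1].
have Gni x y : x <= y -> G y <= G x by exact: survival_ni.
have q0 : 0 < Num.sqrt r by rewrite sqrtr_gt0.
set q := Num.sqrt r in q0 *.
(* any exponent strictly between alpha and 1 *)
pose beta := (1 + alpha) / 2.
have ab : alpha < beta by rewrite /beta; move: alpha1; lra.
have b1 : beta < 1 by rewrite /beta; move: alpha1; lra.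
have b0 : 0 < beta by rewrite (lt_trans alpha0).
have [C [x0 [x00 C0 HC]]] := potter_bound Gle1 Gni alpha0 Gpos Grv ab.
(* the Potter bound requires arguments beyond x0; a' n = a n for large n *)
pose a' n := Num.max (a n) x0.
pose g n (u : R) := G (a' n * (u / q)) / G (a' n).
have bb : 0 <= s / (2 * q) by rewrite divr_ge0// mulr_ge0// ltW.
have mG c : measurable_fun setT (fun u : R => G (c * (u / q))).
  apply: (measurableT_comp (measurable_survival P mX)).
  apply: measurable_funM; first exact: measurable_cst.
  by apply: measurable_funM; [exact: measurable_id | exact: measurable_cst].
have ayP K : \forall n \near \oo, K <= a n by move: K; apply/cvgryPge.
have a'y : a' n @[n --> \oo] --> +oo.
  apply/cvgryPge => K; near=> n; rewrite le_max; apply/orP; left; near: n.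
  exact: ayP.
have lim : 2 * expR ((s / (2 * Num.sqrt r)) ^+ 2) *
    (\int[lebesgue_measure]_(u in `]0%R, +oo[)
      (gauss_weight (s / (2 * Num.sqrt r)) u * g n u))
   @[n --> \oo] --> delta alpha r s.
  apply: (@cvg_delta_tail R alpha beta r s (C * (1 + q `^ beta))) => //.
  - by move=> n; apply: measurable_funM => //; exact: measurable_cst.
  - move=> n u u0; rewrite /g ger0_norm ?divr_ge0//.
    rewrite ler_pdivrMr//; apply: le_trans (HC _ _ _ (divr_gt0 u0 q0)) _.
      by rewrite le_max lexx orbT.
    rewrite ler_wpM2r// -mulrA ler_wpM2l// scaled_powRE//.
    have qb := powR_ge0 q beta; have ub := powR_ge0 u (- beta).
    have -> : (1 + q `^ beta) * (1 + u `^ (- beta)) =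
      1 + q `^ beta * u `^ (- beta) + (q `^ beta + u `^ (- beta)) by ring.
    by rewrite lerDl addr_ge0.
  - move=> u u0; rewrite /g.
    have uq : 0 < u / q by rewrite divr_gt0.
    rewrite (_ : (fun n => _) = fun n => G (u / q * a' n) / G (a' n)); last first.
      by apply/funext => n; rewrite [a' n * _]mulrC.
    exact: (cvg_comp _ _ a'y (Grv _ uq)).
apply: cvg_trans lim; apply: near_eq_cvg; near=> n.
have aE : a' n = a n.
  by rewrite /a' max_l//; near: n; exact: ayP.
pose Z w := q * scaled_pos (a n) w.
have mZ : measurable_fun setT Z.
  by apply: measurable_funM; [exact: measurable_cst | exact: measurable_scaled_pos].
have Z0 w : 0 <= Z w by rewrite mulr_ge0 ?(ltW q0)// scaled_pos_ge0.
have := gauss_layer_cake P mZ bb Z0.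
rewrite (_ : Rintegral P _ _ = \int[P]_w expR
   (- (r * scaled_pos (a n) w ^+ 2 + s * scaled_pos (a n) w))); last first.
  apply: eq_mean => w; rewrite /Z; move: (scaled_pos (a n) w) => y.
  have -> : (q * y) ^+ 2 = r * y ^+ 2 by rewrite exprMn sqr_sqrtr// ltW.
  by have -> : 2 * (s / (2 * q)) * (q * y) = s * y by field; rewrite gt_eqF.
move=> ->; rewrite -[RHS]mulrA; congr (_ * _).
rewrite [RHS]mulrC -RintegralZl//; last first.
  apply: (dominated_pos (C := (1 + s / (2 * q)) * 1) b0 b1).
    by apply: measurable_gauss_times; exact: measurable_survival.
  move=> u u0; apply: gauss_times_dominated => //.
  rewrite mul1r ger0_norm ?survival_ge0// (le_trans (survival_le1 P mZ _))//.
  by rewrite lerDl powR_ge0.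
apply: eq_Rintegral => u; rewrite inE/= in_itv/= andbT => u0.
rewrite [RHS]mulrCA; congr (_ * _); rewrite /g aE [RHS]mulrC; congr (_ * _).
rewrite /survival; congr (fine (P _)); apply/funext => w /=; apply/propext.
have an0 := apos n.
have e : (u < Z w) = (a n * (u / q) < X w).
  have -> : Z w = q * Num.max (X w) 0 / a n by rewrite /Z /scaled_pos mulrA.
  have -> : a n * (u / q) = u * a n / q by rewrite mulrA [a n * u]mulrC.
  rewrite ltr_pdivlMr// ltr_pdivrMr// [X w * q]mulrC maxr_pMr ?(ltW q0)// lt_max mulr0.
  by rewrite [_ < 0]ltNge (ltW (mulr_gt0 u0 an0)) orbF.
by rewrite e.
Unshelve. all: by end_near. Qed.

End pareto_tail.

(** * Sums of a random number of observations *)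

Section indexed_by_nat.
Context {R : realType} d (T : measurableType d).

(** A countable union over the values of [N]. *)
Lemma measurable_nat_index (N : T -> nat) (F : nat -> T -> R) :
  measurable_fun setT N -> (forall n, measurable_fun setT (F n)) ->
  measurable_fun setT (fun w => F (N w) w).
Proof.
move=> mN mF _ B mB; rewrite setTI.
rewrite (_ : _ @^-1` B = \bigcup_n (N @^-1` [set n] `&` F n @^-1` B)).
  apply: bigcup_measurable => n _; apply: measurableI.
    by rewrite -[X in measurable X]setTI; exact: mN.
  by rewrite -[X in measurable X]setTI; exact: mF.
apply/seteqP; split => w /=; first by move=> FB; exists (N w).
by move=> [n _ [/= <-]].
Qed.

Lemma measurable_nat_eq (N : T -> nat) n : measurable_fun setT N ->
  bounded_measurable (fun w => (N w == n)%:R : R).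
Proof.
move=> mN; apply: bmeas_le01.
  apply: (measurable_nat_index (F := fun k _ => (k == n)%:R) mN) => k.
  exact: measurable_cst.
by move=> w; case: (N w == n); rewrite ?lexx ?ler01.
Qed.

End indexed_by_nat.

Section functional_determined_by_events.
Context {R : realType} d (T : measurableType d) (P : probability T R).
Variables (W : T -> R) (Y X : T -> R) (c : R).
Hypothesis bW : bounded_measurable W.
Hypothesis mY : measurable_fun setT Y.
Hypothesis mX : measurable_fun setT X.
Hypothesis events : forall B : set R, measurable B ->
  \int[P]_w (W w * \1_B (Y w)) = c * \int[P]_w \1_B (X w).

(** An identity linear in [g] that holds for indicators extends to all [g] with
    values in the unit interval: the binary digits of [g] are indicators of
    events, and [g] is the sum of the corresponding series. *)
Lemma mean_of_events (g : R -> R) : measurable_fun setT g ->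
  (forall x, 0 <= g x <= 1) ->
  \int[P]_w (W w * g (Y w)) = c * \int[P]_w g (X w).
Proof.
move=> mg g01.
pose D i : set R := [set x | digit i (g x)].
have mD i : measurable (D i).
  have h := measurable_digit i mg; rewrite -[D i]setTI.
  exact: (h measurableT [set true]).
pose gk k x : R := bin_partial (fun i => digit i (g x)) k.
have gkE k x : gk k x = \sum_(0 <= i < k) (2^-1) ^+ i.+1 * \1_(D i) x.
  rewrite /gk /bin_partial; apply: eq_bigr => i _; congr (_ * _).
  rewrite indicE; congr (_%:R); have -> // : (x \in D i) = digit i (g x).
  by apply/idP/idP; rewrite inE.
have bI i (Z : T -> R) : measurable_fun setT Z ->
    bounded_measurable (fun w => \1_(D i) (Z w) : R).
  move=> mZ; apply: bmeas_le01.
    exact: (measurableT_comp (measurable_indic (mD i)) mZ).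
  by move=> w; rewrite indicE; case: (_ \in _); rewrite ?lexx ?ler01.
have bt i (Z : T -> R) : measurable_fun setT Z ->
    bounded_measurable (fun w => (2^-1) ^+ i.+1 * \1_(D i) (Z w) : R).
  by move=> mZ; apply: bmeasM; [exact: bmeas_cst | exact: bI].
have bgk k (Z : T -> R) : measurable_fun setT Z ->
    bounded_measurable (fun w => gk k (Z w)).
  by move=> mZ; under eq_fun do rewrite gkE; apply: bmeas_sum => i; exact: bt.
have step k : \int[P]_w (W w * gk k (Y w)) = c * \int[P]_w gk k (X w).
  under eq_fun do rewrite gkE mulr_sumr.
  under [X in _ = c * Rintegral _ _ X]eq_fun do rewrite gkE.
  rewrite !mean_sum; [|by move=> i; exact: bt|by move=> i; apply: bmeasM => //; exact: bt].
  rewrite mulr_sumr; apply: eq_bigr => i _; rewrite meanZ; last exact: bI.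
  rewrite mulrCA -events// -meanZ; last by apply: bmeasM => //; exact: bI.
  by apply: eq_mean => w; rewrite mulrCA.
have gk01 k x : 0 <= gk k x <= 1.
  have /andP[h _] := digit_approx k (g01 x); have /andP[_ g1] := g01 x.
  by rewrite (le_trans h g1) andbT; apply: sumr_ge0 => i _;
    rewrite mulr_ge0// exprn_ge0// invr_ge0.
have gkcvg x : gk k x @[k --> \oo] --> g x.
  apply: (@squeeze_cvgr _ _ _ _ (fun k => g x - (2^-1) ^+ k) (fun=> g x)).
  - apply: nearW => k; have /andP[h1 h2] := digit_approx k (g01 x).
    by rewrite h1 andbT lerBlDr.
  - rewrite -[X in _ --> X]subr0; apply: cvgB; [exact: cvg_cst|exact: cvg_half_expn].
  - exact: cvg_cst.
have [M WM] := bW.2.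
have mgZ (Z : T -> R) : measurable_fun setT Z -> measurable_fun setT (fun w => g (Z w)).
  by move=> mZ; exact: measurableT_comp mg mZ.
have c1 : \int[P]_w (W w * gk k (Y w)) @[k --> \oo] --> \int[P]_w (W w * g (Y w)).
  apply: (bounded_convergence (M := M)).
  - by move=> k; case: (bmeasM bW (bgk k _ mY)).
  - move=> k w; rewrite normrM -[leRHS]mulr1 ler_pM//.
    by have /andP[h0 h1] := gk01 k (Y w); rewrite ger0_norm.
  - by apply: measurable_funM; [case: bW | exact: mgZ].
  - by apply: aeW => w; apply: cvgMl_tmp; exact: gkcvg.
have c2 : \int[P]_w gk k (X w) @[k --> \oo] --> \int[P]_w g (X w).
  apply: (bounded_convergence (M := 1)).
  - by move=> k; case: (bgk k _ mX).
  - by move=> k w; have /andP[h0 h1] := gk01 k (X w); rewrite ger0_norm.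
  - exact: mgZ.
  - by apply: aeW => w; exact: gkcvg.
have c3 : \int[P]_w (W w * gk k (Y w)) @[k --> \oo] --> c * \int[P]_w g (X w).
  by rewrite (eq_cvg _ _ step); apply: cvgMl_tmp.
by apply: (cvg_unique _ c1 c3); exact: Rhausdorff.
Qed.

End functional_determined_by_events.

Section random_index_product.
Context {R : realType} d (T : measurableType d) (P : probability T R).
Variables (N : T -> nat) (Xs : nat -> T -> R) (X : T -> R).
Hypothesis mN : measurable_fun setT N.
Hypothesis mXs : forall i, measurable_fun setT (Xs i).
Hypothesis mX : measurable_fun setT X.
Hypothesis indep : forall n (B : nat -> set R), (forall i, measurable (B i)) ->
  \int[P]_w ((N w == n)%:R * \prod_(i < n) \1_(B i) (Xs i w)) =
  \int[P]_w (N w == n)%:R * \prod_(i < n) \int[P]_w \1_(B i) (X w).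

Lemma bmeas_prod (I : Type) (s : seq I) (Q : pred I) (h : I -> T -> R) :
  (forall i, bounded_measurable (h i)) ->
  bounded_measurable (fun w => \prod_(i <- s | Q i) h i w).
Proof.
move=> bh; elim: s => [|i s IH].
  rewrite (_ : (fun w => _) = fun=> 1); first exact: bmeas_cst.
  by apply/funext => w; rewrite big_nil.
rewrite (_ : (fun w => _) = fun w => (if Q i then h i w else 1) *
    \prod_(j <- s | Q j) h j w).
  apply: bmeasM => //; case: (Q i) => //; exact: bmeas_cst.
by apply/funext => w; rewrite big_cons; case: ifP; rewrite ?mul1r.
Qed.

(** The indicators are replaced by the functions [h i] one index at a time,
    each time by [mean_of_events] with all the other factors gathered in the
    weight. *)
Lemma independent_product n (h : nat -> R -> R) :
  (forall i, measurable_fun setT (h i)) -> (forall i x, 0 <= h i x <= 1) ->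
  \int[P]_w ((N w == n)%:R * \prod_(i < n) h i (Xs i w)) =
  \int[P]_w (N w == n)%:R * \prod_(i < n) \int[P]_w h i (X w).
Proof.
suff H k : (k <= n)%N -> forall h : nat -> R -> R,
    (forall i, measurable_fun setT (h i)) -> (forall i x, 0 <= h i x <= 1) ->
    (forall i, (k <= i)%N -> exists2 B, measurable B & h i = \1_B) ->
    \int[P]_w ((N w == n)%:R * \prod_(i < n) h i (Xs i w)) =
    \int[P]_w (N w == n)%:R * \prod_(i < n) \int[P]_w h i (X w).
  move=> mh h01.
  pose h' i := if (i < n)%N then h i else \1_setT.
  have hE (i : 'I_n) : h i = h' i by rewrite /h' ltn_ord.
  transitivity (\int[P]_w ((N w == n)%:R * \prod_(i < n) h' i (Xs i w))).
    by apply: eq_mean => w; congr (_ * _); apply: eq_bigr => i _; rewrite hE.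
  rewrite (H n)//.
  - by congr (_ * _); apply: eq_bigr => i _; rewrite hE.
  - by move=> i; rewrite /h'; case: ifP => // _; exact: measurable_indic.
  - move=> i x; rewrite /h'; case: ifP => // _.
    by rewrite indicE in_setT lexx ler01.
  - by move=> i ni; rewrite /h' ltnNge ni/=; exists setT.
elim: k => [|k IH] kn {}h mh h01 hB.
  (* at k = 0 all the functions are indicators *)
  have [B HB] := choice (fun i => (let: ex_intro2 B mB hE := hB i (leq0n i) in
    ex_intro (fun B => measurable B /\ h i = \1_B) B (conj mB hE))).
  transitivity (\int[P]_w ((N w == n)%:R * \prod_(i < n) \1_(B i) (Xs i w))).
    by apply: eq_mean => w; congr (_ * _); apply: eq_bigr => i _; rewrite (HB i).2.
  rewrite indep; last by move=> i; case: (HB i).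
  by congr (_ * _); apply: eq_bigr => i _; rewrite (HB i).2.
pose ok : 'I_n := Ordinal kn.
have bh i (Z : T -> R) : measurable_fun setT Z -> bounded_measurable (fun w => h i (Z w)).
  by move=> mZ; apply: bmeas_le01 => //; exact: measurableT_comp (mh i) mZ.
pose W w := (N w == n)%:R * \prod_(i < n | i != ok) h i (Xs i w).
pose c := \int[P]_w (N w == n)%:R * \prod_(i < n | i != ok) \int[P]_w h i (X w).
have bW : bounded_measurable W.
  apply: bmeasM; first exact: measurable_nat_eq.
  by apply: (bmeas_prod _ _ (h := fun (i : 'I_n) w => h i (Xs i w))) => i; exact: bh.
have ev (B : set R) : measurable B ->
    \int[P]_w (W w * \1_B (Xs k w)) = c * \int[P]_w \1_B (X w).
  move=> mB; pose h' i := if i == k then \1_B else h i.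
  have h'ne (i : 'I_n) : i != ok -> h' i = h i by rewrite /h' -val_eqE/= => /negbTE ->.
  have h'k : h' k = \1_B by rewrite /h' eqxx.
  have mI : measurable_fun setT (\1_B : R -> R) by exact: measurable_indic.
  have := IH (ltnW kn) h'.
  have -> : \int[P]_w ((N w == n)%:R * \prod_(i < n) h' i (Xs i w)) =
      \int[P]_w (W w * \1_B (Xs k w)).
    apply: eq_mean => w; rewrite /W (bigD1 ok)//= h'k.
    rewrite [X in _ * (_ * X)](_ : _ = \prod_(i < n | i != ok) h i (Xs i w)); first by ring.
    by apply: eq_bigr => i ik; rewrite h'ne.
  have -> : \int[P]_w (N w == n)%:R * \prod_(i < n) \int[P]_w h' i (X w) =
      c * \int[P]_w \1_B (X w).
    rewrite /c (bigD1 ok)//= h'k.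
    rewrite [X in _ * (_ * X)](_ : _ = \prod_(i < n | i != ok) \int[P]_w h i (X w)); first by ring.
    by apply: eq_bigr => i ik; rewrite h'ne.
  apply.
  - by move=> i; rewrite /h'; case: ifP.
  - move=> i x; rewrite /h'; case: ifP => // _.
    by rewrite indicE; case: (_ \in _); rewrite ?lexx ?ler01.
  - move=> i ki; rewrite /h'; case: ifPn => [_|ik]; first by exists B.
    by apply: hB; rewrite ltn_neqAle eq_sym ik.
have := mean_of_events bW (mXs k) mX ev (mh k) (h01 k).
rewrite /c /W => E.
rewrite [in RHS](bigD1 ok)//= mulrA [in RHS]mulrAC -E.
by apply: eq_mean => w; rewrite (bigD1 ok)//=; ring.
Qed.

(** Conditioning on the value of [N]: the series over these values converges to
    the mean by bounded convergence. *)
Lemma mean_random_product (g : R -> R) : measurable_fun setT g ->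
  (forall x, 0 <= g x <= 1) ->
  \int[P]_w (\prod_(i < N w) g (Xs i w)) =
  \int[P]_w ((\int[P]_v g (X v)) ^+ N w).
Proof.
move=> mg g01; set rho := \int[P]_v g (X v).
have bgX : bounded_measurable (fun w => g (X w)).
  by apply: bmeas_le01 => //; exact: measurableT_comp mg mX.
have rho01 : 0 <= rho <= 1.
  apply/andP; split; first by apply: mean_ge0 => w; case/andP: (g01 (X w)).
  by apply: (mean_le1 P bgX) => w; case/andP: (g01 (X w)).
have bprod n : bounded_measurable (fun w => \prod_(i < n) g (Xs i w)).
  apply: bmeas_prod => i; apply: bmeas_le01 => //; exact: measurableT_comp mg (mXs i).
have beq n := measurable_nat_eq (R := R) n mN.
have eqn n : \int[P]_w ((N w == n)%:R * \prod_(i < n) g (Xs i w)) =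
    \int[P]_w ((N w == n)%:R * rho ^+ n).
  rewrite (independent_product n (h := fun=> g))//.
  rewrite prodr_const card_ord mulrC -meanZ//.
  by apply: eq_mean => w; rewrite mulrC.
have trunc (F : nat -> T -> R) : (forall n, bounded_measurable (F n)) ->
    (forall n w, 0 <= F n w <= 1) ->
    \sum_(0 <= n < m) \int[P]_w ((N w == n)%:R * F n w) @[m --> \oo] -->
    \int[P]_w F (N w) w.
  move=> bF F01.
  have b1 n : bounded_measurable (fun w => (N w == n)%:R * F n w) by exact: bmeasM.
  under eq_fun do rewrite -mean_sum//.
  have SE m w : \sum_(0 <= n < m) (N w == n)%:R * F n w = (N w < m)%:R * F (N w) w.
    elim: m => [|m IH]; first by rewrite big_geq// mul0r.
    rewrite big_nat_recr//= IH ltnS; case: ltngtP => [h|h|->].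
    - by rewrite mul0r addr0.
    - by rewrite !mul0r addr0.
    - by rewrite mul0r add0r.
  apply: (bounded_convergence (M := 1)).
  - by move=> m; case: (bmeas_sum (index_iota 0 m) b1).
  - move=> m w; rewrite SE normrM -[leRHS]mulr1; have /andP[h0 h1] := F01 (N w) w.
    by rewrite ler_pM// ?(ger0_norm h0)//; case: ltnP; rewrite ?normr1 ?normr0.
  - by apply: measurable_nat_index => // n; case: (bF n).
  - apply: aeW => w; apply: cvg_near_cst; near=> m.
    rewrite SE (_ : (N w < m)%N) ?mul1r//; near: m; exact: nbhs_infty_gt.
have g01' n w : 0 <= \prod_(i < n) g (Xs i w) <= 1.
  apply/andP; split; first by apply: prodr_ge0 => i _; case/andP: (g01 (Xs i w)).
  by apply: prodr_ile1 => i _.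
have c1 := trunc (fun n w => \prod_(i < n) g (Xs i w)) bprod g01'.
have r01 n (w : T) : 0 <= rho ^+ n <= 1.
  by case/andP: rho01 => h0 h1; rewrite exprn_ge0// exprn_ile1.
have c2 := trunc (fun n _ => rho ^+ n) (fun n => bmeas_cst T _) r01.
rewrite (_ : (fun m => _) = fun m =>
   \sum_(0 <= n < m) \int[P]_w ((N w == n)%:R * rho ^+ n)) in c1; last first.
  by apply/funext => m; apply: eq_bigr => n _; exact: eqn.
by apply: (cvg_unique _ c1 c2); exact: Rhausdorff.
Unshelve. all: by end_near. Qed.

End random_index_product.

Section exponential_bounds.
Context {R : realType}.

(** The function [c |-> exp (- c x)] is Lipschitz on the half-line beyond [m],
    with a constant independent of [x], since [c x exp (- c x) <= 1]. *)
Lemma dist_expR_le (m c c' x : R) : 0 < m -> m <= c -> m <= c' -> 0 <= x ->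
  `|expR (- (c * x)) - expR (- (c' * x))| <= `|c - c'| / m.
Proof.
move=> m0; wlog cc : c c' / c <= c' => [H mc mc' x0|mc _ x0].
  have [cc|/ltW cc] := leP c c'; first exact: H.
  by rewrite distrC [X in _ <= X / m]distrC; apply: H.
have c0 : 0 < c by rewrite (lt_le_trans m0).
have h1 : c * x * expR (- (c * x)) <= 1.
  rewrite expRN ler_pdivrMr ?expR_gt0// mul1r.
  by apply: le_trans (expR_ge1Dx _); rewrite lerDr.
have h2 : 1 - (c' - c) * x <= expR (- ((c' - c) * x)) by exact: expR_ge1Dx.
have e0 := expR_ge0 (- (c * x)).
have E : expR (- (c' * x)) = expR (- (c * x)) * expR (- ((c' - c) * x)).
  by rewrite -expRD; congr expR; ring.
have ee : expR (- (c' * x)) <= expR (- (c * x)).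
  by rewrite ler_expR lerN2 ler_wpM2r.
rewrite ger0_norm ?subr_ge0// distrC (ger0_norm (_ : 0 <= c' - c)) ?subr_ge0//.
rewrite ler_pdivlMr// E.
apply: (@le_trans _ _ (expR (- (c * x)) * ((c' - c) * x) * c)).
  rewrite ler_pM ?(ltW m0)//.
    by rewrite -E subr_ge0.
  rewrite -[X in X - _]mulr1 -mulrBr ler_wpM2l//; lra.
rewrite [leLHS](_ : _ = (c' - c) * (c * x * expR (- (c * x)))); last by ring.
by rewrite -[leRHS]mulr1 ler_wpM2l// subr_ge0.
Qed.

(** Squeeze [- ln (1 - theta)] between [theta] and [theta / (1 - theta)]. *)
Lemma cvg_exp_rate (theta t : nat -> R) (l : R) :
  (forall n, 0 <= theta n < 1) -> (forall n, 0 < t n) ->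
  t n @[n --> \oo] --> +oo -> t n * theta n @[n --> \oo] --> l ->
  - t n * ln (1 - theta n) @[n --> \oo] --> l.
Proof.
move=> th01 t0 ty tl.
have ti : (t n)^-1 @[n --> \oo] --> (0 : R).
  have tp : \forall n \near \oo, 0 < t n by apply: nearW.
  exact: ((gtr0_cvgV0 tp).2 ty).
have th0 : theta n @[n --> \oo] --> (0 : R).
  rewrite (_ : theta = fun n => (t n)^-1 * (t n * theta n)); last first.
    by apply/funext => n; rewrite mulKf// gt_eqF.
  by rewrite -(mul0r l); apply: cvgM.
have up : t n * theta n / (1 - theta n) @[n --> \oo] --> l.
  rewrite [X in _ --> X](_ : l = l / (1 - 0)); last by rewrite subr0 divr1.
  apply: cvgM => //; apply: cvgV; first by rewrite subr0 oner_neq0.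
  by apply: cvgB => //; exact: cvg_cst.
apply: (squeeze_cvgr _ tl up); apply: nearW => n.
have /andP[h0 h1] := th01 n; have d0 : 0 < 1 - theta n by rewrite subr_gt0.
rewrite mulNr -mulrN; apply/andP; split.
  rewrite ler_wpM2l ?(ltW (t0 n))// lerNr.
  by apply: le_ln1Dx; rewrite ltrN2.
rewrite -mulrA ler_wpM2l ?(ltW (t0 n))//.
rewrite -lnV ?posrE//.
have E : (1 - theta n)^-1 = 1 + theta n / (1 - theta n) by field; rewrite gt_eqF.
rewrite [X in ln X]E.
by apply: le_ln1Dx; rewrite (@lt_le_trans _ _ 0)// ?ltrN10// divr_ge0// ltW.
Qed.

End exponential_bounds.

Section random_rate.
Context {R : realType} d (T : measurableType d) (P : probability T R)
  d' (T' : measurableType d') (P' : probability T' R).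
Variables (S_ : nat -> T -> R) (L : T' -> R).
Hypothesis mS : forall n, measurable_fun setT (S_ n).
Hypothesis S0 : forall n w, 0 <= S_ n w.
Hypothesis SL : forall f : R -> R, continuous f ->
  (exists M : R, forall x, `|f x| <= M) ->
  \int[P]_w f (S_ n w) @[n --> \oo] --> \int[P']_w f (L w).

(** For a fixed rate this is convergence in distribution, tested on a bounded
    continuous function that agrees with the exponential on the half-line;
    [dist_expR_le] allows the rate to vary. *)
Lemma cvg_mean_exp_rate (c : nat -> R) (l : R) : 0 < l ->
  c n @[n --> \oo] --> l ->
  \int[P]_w expR (- (c n * S_ n w)) @[n --> \oo] -->
  \int[P']_w expR (- (l * Num.max (L w) 0)).
Proof.
move=> l0 cl.
have base : \int[P]_w expR (- (l * S_ n w)) @[n --> \oo] -->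
    \int[P']_w expR (- (l * Num.max (L w) 0)).
  pose f (x : R) := expR (- (l * Num.max x 0)).
  have cf : continuous f.
    have cm : continuous (fun x : R => - (l * Num.max x 0)).
      move=> x; apply: (@cvgN _ R^o); apply: cvgMl_tmp.
      apply: (@continuous_max _ _ id (fun=> 0)); first exact: cvg_id.
      exact: cvg_cst.
    move=> x; apply: (@continuous_comp _ _ _ (fun x : R => - (l * Num.max x 0)) (@expR R)).
      exact: cm.
    exact: continuous_expR.
  have bf : exists M : R, forall x, `|f x| <= M.
    exists 1 => x; rewrite ger0_norm ?expR_ge0// expR_le1 oppr_le0 mulr_ge0 ?(ltW l0)//.
    by rewrite le_max lexx orbT.
  apply: (cvg_eq _ _ (SL cf bf)) => // n.
  by apply: eq_mean => w; rewrite /f max_l.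
apply: cvg_up_to => e e0.
exists (fun n => \int[P]_w expR (- (l * S_ n w))).
exists (\int[P']_w expR (- (l * Num.max (L w) 0))); split => //; last first.
  by rewrite subrr normr0 ltW.
have l2 : 0 < l / 2 by rewrite divr_gt0.
have e2 : 0 < e * (l / 2) by rewrite mulr_gt0.
have lc : l / 2 < l by rewrite ltr_pdivrMr// ltr_pMr// ltr1n.
near=> n.
have cn : l / 2 < c n by near: n; exact: (cvgr_gt _ cl).
have dn : `|c n - l| <= e * (l / 2).
  by rewrite distrC; near: n; move/cvgrPdist_le : cl; apply.
rewrite -[leRHS](mean_cst P); apply: dist_mean.
- by apply: bmeas_exp_rate => //; rewrite (le_trans (ltW l2))// ltW.
- by apply: bmeas_exp_rate => //; exact: ltW.
- exact: bmeas_cst.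
move=> w; apply: le_trans (dist_expR_le l2 (ltW cn) (ltW lc) (S0 n w)) _.
by rewrite ler_pdivrMr.
Unshelve. all: by end_near. Qed.

End random_rate.

Section process_transform.
Context {R : realType} d (T : measurableType d) (P : probability T R).
Variables (X : {RV P >-> R}) (Xs : nat -> {RV P >-> R}) (alpha : R).
Context d' (T' : measurableType d') (P' : probability T' R).
Variables (N_ : nat -> T -> nat) (t : nat -> R) (L : T' -> R).
Hypothesis alpha0 : 0 < alpha.
Hypothesis alpha1 : alpha < 1.
Hypothesis pX : pareto_type X alpha.
Hypothesis mN : forall n, measurable_fun setT (N_ n).
Hypothesis t0 : forall n, 0 < t n.
Hypothesis ty : t n @[n --> \oo] --> +oo.
Hypothesis indep : forall m n (B : nat -> set R), (forall i, measurable (B i)) ->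
  \int[P]_w ((N_ m w == n)%:R * \prod_(i < n) \1_(B i) (Xs i w)) =
  \int[P]_w (N_ m w == n)%:R * \prod_(i < n) \int[P]_w \1_(B i) (X w).
Hypothesis NL : forall f : R -> R, continuous f ->
  (exists M : R, forall x, `|f x| <= M) ->
  \int[P]_w f ((N_ n w)%:R / t n) @[n --> \oo] --> \int[P']_w f (L w).

Definition scaled_sum (p : nat) (a : R) (N : T -> nat) (w : T) : R :=
  \sum_(i < N w) (scaled_pos (Xs i) a w) ^+ p.

(** The mean over [N] of [rho_n ^ N] is [E exp (- c_n (N / t_n))] with [c_n = -
    t_n ln rho_n], and [c_n] has the limit [delta alpha r s]. *)
Lemma cvg_process_transform : exists a : nat -> R, (forall n, 0 < a n) /\
  forall r s : R, 0 < r -> 0 <= s ->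
  \int[P]_w expR (- (r * scaled_sum 2 (a n) (N_ n) w + s * scaled_sum 1 (a n) (N_ n) w))
    @[n --> \oo] --> \int[P']_w expR (- (delta alpha r s * Num.max (L w) 0)).
Proof.
have mX : measurable_fun setT X by exact: measurable_funP.
have [Gpos Grv] := pareto_regular pX.
have Gge0 x : 0 <= survival P X x by exact: survival_ge0.
have Gni x y : x <= y -> survival P X y <= survival P X x by exact: survival_ni.
have [a [a0 ay tG]] := quantile_sequence Gni alpha0 Gpos Grv (cvg_survival_y X) ty.
exists a; split => // r s r0 s0.
pose g n (x : R) := expR (- (r * (Num.max x 0 / a n) ^+ 2 + s * (Num.max x 0 / a n))).
have pos x n : 0 <= Num.max x 0 / a n.
  by rewrite divr_ge0 ?(ltW (a0 n))// le_max lexx orbT.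
have g01 n x : 0 <= g n x <= 1.
  rewrite expR_ge0 expR_le1 oppr_le0 addr_ge0// mulr_ge0 ?(ltW r0)//.
  exact: sqr_ge0.
have mg n : measurable_fun setT (g n).
  have mid : measurable_fun setT (id : R -> R) by exact: measurable_id.
  have mc (c : R) : measurable_fun setT (fun _ : R => c) by exact: measurable_cst.
  have mm : measurable_fun setT (fun x : R => Num.max x 0 / a n).
    by apply: measurable_funM => //; exact: measurable_maxr.
  apply: measurableT_comp => //; apply: measurableT_comp => //.
  by apply: measurable_funD; apply: measurable_funM => //; exact: measurable_funX.
pose rho n := \int[P]_w g n (X w).
have bg n : bounded_measurable (fun w => g n (X w)).
  by apply: bmeas_le01 => //; exact: measurableT_comp (mg n) mX.
(* the mean of a positive function is positive *)
have rho0 n : 0 < rho n.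
  rewrite lt_neqAle eq_sym; apply/andP; split; last first.
    by apply: mean_ge0 => w; case/andP: (g01 n (X w)).
  apply/eqP => rh.
  have gpos w : 0 < g n (X w) by exact: expR_gt0.
  have := mean_eq0_ae (bg n) (fun w => ltW (gpos w)) rh.
  move=> [A [mA PA gA]].
  have PT : P setT = 0%E.
    apply/eqP; rewrite eq_le measure_ge0 andbT -PA le_measure ?inE//.
    by move=> w _; apply: gA => /= gw; have := gpos w; rewrite gw ltxx.
  by have := probability_setT P; rewrite PT => /esym/eqP; rewrite eqe oner_eq0.
have rho1 n : rho n <= 1.
  by apply: (mean_le1 P (bg n)) => w; case/andP: (g01 n (X w)).
have thl : t n * (1 - rho n) @[n --> \oo] --> delta alpha r s.
  have h := cvg_laplace_tail alpha0 alpha1 pX r0 s0 a0 ay.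
  rewrite (_ : (fun n => _) = fun n => t n * survival P X (a n) *
     ((1 - rho n) / survival P X (a n))).
    by rewrite -[X in _ --> X]mul1r; apply: cvgM.
  by apply/funext => n; field; rewrite gt_eqF.
have cl := cvg_exp_rate (theta := fun n => 1 - rho n) _ t0 ty thl.
have cn : - t n * ln (rho n) @[n --> \oo] --> delta alpha r s.
  apply: (cvg_eq _ _ (cl _)) => // n; first by congr (_ * ln _); ring.
   rewrite subr_ge0 rho1/= ltrBlDr ltrDl; exact: rho0.
have S0 n w : 0 <= (N_ n w)%:R / t n by rewrite divr_ge0// ltW.
have mS n : measurable_fun setT (fun w => (N_ n w)%:R / t n).
  apply: (measurable_nat_index (F := fun k _ => k%:R / t n) (mN n)) => k.
  exact: measurable_cst.
apply: (cvg_eq _ _ (cvg_mean_exp_rate mS S0 NL (delta_gt0 alpha0 alpha1 r0 s0) cn)) => // n.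
transitivity (\int[P]_w (rho n ^+ N_ n w)).
  apply: eq_mean => w; rewrite -[in RHS](lnK (rho0 n)) -expRM_natl; congr expR.
  by field; rewrite gt_eqF.
have mXs i : measurable_fun setT (Xs i) by exact: measurable_funP.
rewrite -(mean_random_product (mN n) mXs mX (indep n) (mg n) (g01 n)).
apply: eq_mean => w; rewrite -expR_sum; congr expR.
rewrite /scaled_sum !mulr_sumr -big_split/= -sumrN; apply: eq_bigr => i _.
by rewrite expr1.
Qed.

End process_transform.

(** * The mixed transform *)

Section power_modulus.
Context {R : realType}.

Lemma quadratic_modulus_limit (g : R -> R -> R) :
  (forall e : R, 0 < e -> exists2 h, quadratic_modulus h &
    forall x y, 0 <= x <= 1 -> 0 <= y <= 1 -> `|g x y - h x y| <= e) ->
  quadratic_modulus g.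
Proof.
move=> H e e0; have e3 : 0 < e / 3 by rewrite divr_gt0.
have [h hm gh] := H _ e3; have [C C0 hC] := hm _ e3.
exists C => // x y x' y' x0 y0 x0' y0'.
have -> : g x y - g x' y' = (g x y - h x y) + (h x y - h x' y') - (g x' y' - h x' y').
  by ring.
have h1 := gh _ _ x0 y0; have h2 := gh _ _ x0' y0'.
have h3 := hC _ _ _ _ x0 y0 x0' y0'.
apply: (le_trans (ler_normB _ _)).
apply: (le_trans (lerD (ler_normD _ _) (lexx _))).
by move: (`|_|) (`|_|) (`|_|) h1 h2 h3 => a b c; lra.
Qed.

Lemma continuous_powR_max (c r : R) : 0 < c ->
  continuous (fun x : R => Num.max x c `^ r).
Proof.
move=> c0 x.
have m0 : 0 < Num.max x c by rewrite lt_max c0 orbT.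
have cm : {for x, continuous (fun x : R => Num.max x c)}.
  by apply: (@continuous_max _ _ id (fun=> c)); [exact: cvg_id | exact: cvg_cst].
apply: (@continuous_comp _ _ _ (fun x : R => Num.max x c) (fun z => z `^ r)) => //.
apply: differentiable_continuous; apply/derivable1_diffP.
by have [] := is_derive1_powR r m0.
Qed.

(** Powers with exponents in the unit interval have unbounded derivatives at
    [0]; the bases are bounded away from [0] at the cost of a uniformly small
    error. *)
Lemma quadratic_modulus_powR (r s : R) : 0 < r -> 0 <= s ->
  quadratic_modulus (fun x y => x `^ r * y `^ s).
Proof.
move=> r0 s0; apply: quadratic_modulus_limit => e e0.
have e2 : 0 < e / 2 by rewrite divr_gt0.
have powc (p : R) : 0 < p -> \forall c \near 0^'+, c `^ p <= e / 2.
  move=> p0; have := @powR_cvg0 R p p0.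
  move=> /cvgrPdist_le /(_ _ e2); apply: filterS => c.
  by rewrite sub0r normrN ger0_norm ?powR_ge0.
have dist (p c x : R) : 0 < p -> 0 < c -> c `^ p <= e / 2 -> 0 <= x ->
    `|x `^ p - Num.max x c `^ p| <= e / 2.
  move=> p0 c0 cp x0; case: (leP c x) => [_|/ltW xc]; first by rewrite subrr normr0 ltW.
  have xp : x `^ p <= c `^ p by rewrite ge0_ler_powR// ?nnegrE ?(ltW p0)// ltW.
  rewrite distrC ger0_norm ?subr_ge0//.
  by have := powR_ge0 x p; lra.
have [c [c0 c1 cr cs]] : exists c : R, [/\ 0 < c, c <= 1, c `^ r <= e / 2 &
    0 < s -> c `^ s <= e / 2].
  have ps : \forall c \near 0^'+, 0 < s -> c `^ s <= e / 2.
    have [s1|s1] := ltP 0 s; last by apply: nearW.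
    by apply: filterS (powc _ s1) => c cs _.
  near ((0:R)^'+) => c; exists c; split; last by near: c.
  - by near: c; exact: nbhs_right_gt.
  - by near: c; apply: nbhs_right_le.
  - by near: c; exact: powc.
exists (fun x y => Num.max x c `^ r * Num.max y c `^ s).
  apply: continuous_quadratic_modulus => p; apply: cvgM.
    apply: (@continuous_comp _ _ _ fst (fun x : R => Num.max x c `^ r)).
      exact: cvg_fst.
    exact: continuous_powR_max.
  apply: (@continuous_comp _ _ _ snd (fun x : R => Num.max x c `^ s)).
    exact: cvg_snd.
  exact: continuous_powR_max.
move=> x y /andP[x0 x1] /andP[y0 y1].
have p1 (z p : R) : 0 <= p -> 0 <= z -> z <= 1 -> z `^ p <= 1.
  move=> p0 z0 z1; have : z `^ p <= 1 `^ p by rewrite ge0_ler_powR// nnegrE.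
  by rewrite powR1.
have dy : `|y `^ s - Num.max y c `^ s| <= e / 2.
  move: s0; rewrite le_eqVlt => /predU1P[<-|s0]; last exact: (dist _ _ _ s0 c0 (cs s0) y0).
  by rewrite !powRr0 subrr normr0 ltW.
have dx := dist r c x r0 c0 cr x0.
rewrite (_ : _ - _ = (x `^ r - Num.max x c `^ r) * y `^ s +
   Num.max x c `^ r * (y `^ s - Num.max y c `^ s)); last by ring.
apply: (le_trans (ler_normD _ _)); rewrite !normrM.
have m1 : `|y `^ s| <= 1 by rewrite ger0_norm ?powR_ge0// p1.
have m2 : `|Num.max x c `^ r| <= 1.
  rewrite ger0_norm ?powR_ge0// p1 ?(ltW r0)//.
    by rewrite le_max x0.
  by rewrite ge_max x1.
have h1 : `|x `^ r - Num.max x c `^ r| * `|y `^ s| <= e / 2.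
  by rewrite -[leRHS]mulr1 ler_pM.
have h2 : `|Num.max x c `^ r| * `|y `^ s - Num.max y c `^ s| <= e / 2.
  by rewrite -[leRHS]mul1r ler_pM.
by rewrite [leRHS]splitr lerD.
Unshelve. all: by end_near. Qed.

End power_modulus.

Section limit_transform_values.
Context {R : realType} d' (T' : measurableType d') (P' : probability T' R).
Variables (L : T' -> R) (alpha : R).
Hypothesis mL : measurable_fun setT L.
Hypothesis L0 : P' [set w | 0 < L w] = 1%E.
Hypothesis alpha0 : 0 < alpha.
Hypothesis alpha1 : alpha < 1.

(** The prescribed transform; [Num.max] replaces [L] by a nonnegative function
    without changing it almost everywhere. *)
Definition mixed_transform (r s : R) : R :=
  \int[P']_w expR (- (delta alpha r s * Num.max (L w) 0)).

Let mmax : measurable_fun setT (fun w => Num.max (L w) 0).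
Proof. by apply: measurable_maxr => //; exact: measurable_cst. Qed.

Let max0 w : 0 <= Num.max (L w) 0. Proof. by rewrite le_max lexx orbT. Qed.

Let bexp c : 0 <= c -> bounded_measurable (fun w => expR (- (c * Num.max (L w) 0))).
Proof. by move=> c0; exact: bmeas_exp_rate. Qed.

Lemma mixed_transformE r s : 0 < r -> 0 <= s ->
  ('E_P'[fun w => expR (- delta alpha r s * L w)] = (mixed_transform r s)%:E)%E.
Proof.
move=> r0 s0; have d0 := ltW (delta_gt0 alpha0 alpha1 r0 s0).
rewrite /mixed_transform -expectation_bmeas; last exact: bexp.
rewrite unlock; apply: ae_eq_integral => //.
- apply/measurable_EFinP; apply: measurableT_comp => //.
  by apply: measurable_funM => //; exact: measurable_cst.
- by apply/measurable_EFinP; case: (bexp d0).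
- apply: filterS (ae_gt0 mL L0) => w w0 _ /=.
  by rewrite max_l ?(ltW w0)// mulNr.
Qed.

Lemma cvg_mixed (c : nat -> R) (l : R) : (forall n, 0 <= c n) -> 0 <= l ->
  c n @[n --> \oo] --> l ->
  \int[P']_w expR (- (c n * Num.max (L w) 0)) @[n --> \oo] -->
  \int[P']_w expR (- (l * Num.max (L w) 0)).
Proof.
move=> c0 l0 cl; apply: (bounded_convergence (M := 1)).
- by move=> n; case: (bexp (c0 n)).
- by move=> n w; rewrite ger0_norm ?expR_ge0// expR_le1 oppr_le0 mulr_ge0.
- by case: (bexp l0).
- apply: aeW => w.
  apply: (@cvg_comp _ _ _ (fun n => - (c n * Num.max (L w) 0)) (@expR R)).
    by apply: cvgN; apply: cvgMr_tmp; exact: cl.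
  exact: continuous_expR.
Qed.

(** By homogeneity, [delta alpha (c^2) c] is [c^alpha delta alpha 1 1], which
    tends to [0] with [c]. *)
Lemma cvg_mixed_0 :
  mixed_transform (n.+1%:R^-1 ^+ 2) n.+1%:R^-1 @[n --> \oo] --> (1 : R).
Proof.
have d0 := ltW (delta_gt0 alpha0 alpha1 ltr01 ler01).
rewrite [X in _ --> X](_ : (1 : R) = \int[P']_w expR (- (0 * Num.max (L w) 0))); last first.
  by rewrite -[LHS](mean_cst P'); apply: eq_mean => w; rewrite mul0r oppr0 expR0.
have c0 n : 0 < (n.+1%:R^-1 : R) by rewrite invr_gt0.
rewrite (_ : (fun n => _) = fun n => \int[P']_w
    expR (- (n.+1%:R^-1 `^ alpha * delta alpha 1 1 * Num.max (L w) 0))); last first.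
  apply/funext => n; rewrite /mixed_transform.
  by have := delta_scale alpha0 alpha1 (c0 n) ltr01 ler01; rewrite !mulr1 => ->.
apply: cvg_mixed => //; first by move=> n; rewrite mulr_ge0// powR_ge0.
rewrite -[X in _ --> X](mul0r (delta alpha 1 1)); apply: cvgMr_tmp.
apply: ((cvg_at_rightP (fun a : R => a `^ alpha) 0 0).1 (powR_cvg0 alpha0)).
by split; [exact: c0 | exact: cvg_harmonic].
Qed.

(** The rate [delta alpha 1 n] tends to infinity and [L] is positive almost
    everywhere. *)
Lemma cvg_mixed_sy : mixed_transform 1 n.+1%:R @[n --> \oo] --> (0 : R).
Proof.
rewrite -[X in _ --> X](mean_cst P').
have d0 n : 0 <= delta alpha 1 n.+1%:R by apply/ltW/delta_gt0.
apply: (bounded_convergence (M := 1)).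
- by move=> n; case: (bexp (d0 n)).
- by move=> n w; rewrite ger0_norm ?expR_ge0// expR_le1 oppr_le0 mulr_ge0.
- exact: measurable_cst.
apply: filterS (ae_gt0 mL L0) => w w0.
rewrite max_l ?(ltW w0)//.
pose c := expR (- (1 + 1)) / 2 : R.
have c0 : 0 < c by rewrite divr_gt0// expR_gt0.
apply/cvgrPdist_le => e e0.
(* exp (- y) <= 1 / y, so it suffices that delta alpha 1 n.+1 exceeds 1 / (e L) *)
pose K := ((e * L w)^-1 / c) `^ alpha^-1.
have eL : 0 < e * L w by rewrite mulr_gt0.
near=> n; rewrite sub0r normrN ger0_norm ?expR_ge0//.
have Kn : K <= n.+1%:R.
  rewrite (@le_trans _ _ n%:R)//; last by rewrite ler_nat.
  by near: n; exact: nbhs_infty_ger.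
have Kd : (e * L w)^-1 <= delta alpha 1 n.+1%:R.
  apply: le_trans (delta_lower_large alpha0 alpha1 ltr01 _); last by rewrite ler1n.
  rewrite -/c [leRHS]mulrC -ler_pdivrMr//.
  have -> : (e * L w)^-1 / c = K `^ alpha.
    rewrite /K -powRrM mulVf ?gt_eqF// powRr1// divr_ge0 ?(ltW c0)// invr_ge0 ltW//.
  by rewrite ge0_ler_powR ?nnegrE ?powR_ge0 ?(ltW alpha0).
have y0 : 0 < delta alpha 1 n.+1%:R * L w.
  by rewrite mulr_gt0//; apply: delta_gt0.
rewrite expRN (@le_trans _ _ (delta alpha 1 n.+1%:R * L w)^-1)//.
  rewrite lef_pV2 ?posrE ?expR_gt0//.
  by apply: le_trans (expR_ge1Dx _); rewrite lerDr.
rewrite invf_ple ?posrE// -ler_pdivrMr// -invfM; exact: Kd.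
Unshelve. all: by end_near. Qed.

End limit_transform_values.

(** * Existence of the limit law *)

Section law_from_square.
Context {R : realType} dS (S : measurableType dS) (mu : probability S R)
  d' (T' : measurableType d') (P' : probability T' R).
Variables (L : T' -> R) (alpha : R) (Zx Zy : S -> R).
Hypothesis mL : measurable_fun setT L.
Hypothesis L0 : P' [set w | 0 < L w] = 1%E.
Hypothesis alpha0 : 0 < alpha.
Hypothesis alpha1 : alpha < 1.
Hypothesis sqZ : square_valued Zx Zy.
Hypothesis EZ : forall r s : R, 0 < r -> 0 <= s ->
  \int[mu]_x (Zx x `^ r * Zy x `^ s) = mixed_transform P' L alpha r s.

Let bZ r s : 0 < r -> 0 <= s ->
  bounded_measurable (fun x => Zx x `^ r * Zy x `^ s).
Proof.
move=> r0 s0; exact: (bmeas_quadratic_modulus sqZ (quadratic_modulus_powR r0 s0)).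
Qed.

Let powR01 (z p : R) : 0 <= p -> 0 <= z <= 1 -> 0 <= z `^ p <= 1.
Proof.
move=> p0 /andP[z0 z1]; rewrite powR_ge0/=.
have : z `^ p <= 1 `^ p by rewrite ge0_ler_powR// nnegrE.
by rewrite powR1.
Qed.

Let powR_le_pos (z p : R) : 0 < p -> 0 <= z <= 1 -> z `^ p <= ((0 < z)%R)%:R.
Proof.
move=> p0 z01; have /andP[_ h] := powR01 (ltW p0) z01.
case/andP: z01 => z0 _; move: z0 h; rewrite le_eqVlt => /predU1P[<-|-> //].
by rewrite powR0 ?gt_eqF// ltxx.
Qed.

(** The mean of [Zx^(c^2) Zy^c] is at most the probability that both
    coordinates are positive, and it tends to [1] as [c] decreases to [0]. *)
Lemma coordinates_pos : {ae mu, forall x, 0 < Zx x /\ 0 < Zy x}.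
Proof.
have [mZx mZy Zx01 Zy01] := sqZ.
have bp : bounded_measurable (fun x => ((0 < Zx x) && (0 < Zy x))%:R : R).
  by apply: bmeas_bool; apply: measurable_and;
    apply: measurable_fun_ltr => //; exact: measurable_cst.
have h1 : 1 <= \int[mu]_x ((0 < Zx x) && (0 < Zy x))%:R.
  apply: (ler_cvg_to (cvg_mixed_0 P' mL alpha0 alpha1) (cvg_cst _)).
  apply: nearW => n; have s0 : 0 < (n.+1%:R^-1 : R) by rewrite invr_gt0.
  have r0 : 0 < (n.+1%:R^-1 ^+ 2 : R) by rewrite exprn_gt0.
  have s0' := ltW s0; rewrite -EZ//; apply: le_mean => //; first exact: bZ.
  by move=> x; rewrite -mulnb natrM ler_pM ?powR_ge0//; exact: powR_le_pos.
have bc := bmeas_cst S (1 : R).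
have le0 x : 0 <= 1 - ((0 < Zx x) && (0 < Zy x))%:R :> R.
  by case: (_ && _); rewrite ?subrr ?subr0 ?ler01.
have E0 : \int[mu]_x (1 - ((0 < Zx x) && (0 < Zy x))%:R) = 0.
  apply/eqP; rewrite eq_le mean_ge0// andbT.
  by rewrite (meanB mu bc bp) mean_cst subr_le0.
apply: filterS (mean_eq0_ae (bmeasB bc bp) le0 E0) => x.
case: (0 < Zx x) => /=; last by rewrite subr0 => /eqP; rewrite oner_eq0.
by case: (0 < Zy x) => //=; rewrite subr0 => /eqP; rewrite oner_eq0.
Qed.

(** The pair [(- ln Zx, - ln Zy)] is well defined almost everywhere, as both
    coordinates are positive, and its transform at [(r, s)] is the mean of
    [Zx^r Zy^s]. *)
Lemma law_from_square : exists Q : probability (R * R)%type R,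
  has_limit_transform alpha P' L Q fst snd.
Proof.
have [mZx mZy Zx01 Zy01] := sqZ.
pose F (x : S) : R * R := (- ln (Zx x), - ln (Zy x)).
have mF : measurable_fun setT F.
  apply: measurable_fun_pair; apply: measurableT_comp => //.
    exact: (measurableT_comp (@measurable_ln R) mZx).
  exact: (measurableT_comp (@measurable_ln R) mZy).
pose mix := isMeasurableFun.Build _ _ _ _ F mF.
pose Fm : {mfun S >-> (R * R)%type} := HB.pack F mix.
exists (distribution mu Fm) => r s r0 s0.
have mexp : measurable_fun setT (fun p : R * R => expR (- r * p.1 - s * p.2)).
  apply: measurableT_comp => //; apply: measurable_funB.
    by apply: measurable_funM; [exact: measurable_cst | exact: measurable_fst].
  by apply: measurable_funM; [exact: measurable_cst | exact: measurable_snd].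
rewrite mixed_transformE// -EZ// -expectation_bmeas; last exact: bZ.
rewrite unlock ge0_integral_distribution//; last exact/measurable_EFinP.
apply: ae_eq_integral => //.
- apply/measurable_EFinP.
  exact: (measurableT_comp mexp mF).
- by apply/measurable_EFinP; case: (bZ r0 s0).
apply: filterS coordinates_pos => x [x0 y0] _ /=.
rewrite /powR !gt_eqF// -expRD; congr (expR _)%:E.
by ring.
Qed.

End law_from_square.

Section existence_of_limit_law.
Context {R : realType} d (T : measurableType d) (P : probability T R)
  d' (T' : measurableType d') (P' : probability T' R).
Variables (L : T' -> R) (alpha : R) (U_ V_ : nat -> T -> R).
Hypothesis mL : measurable_fun setT L.
Hypothesis L0 : P' [set w | 0 < L w] = 1%E.
Hypothesis alpha0 : 0 < alpha.
Hypothesis alpha1 : alpha < 1.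
Hypothesis mU : forall n, measurable_fun setT (U_ n).
Hypothesis mV : forall n, measurable_fun setT (V_ n).
Hypothesis U0 : forall n w, 0 <= U_ n w.
Hypothesis V0 : forall n w, 0 <= V_ n w.
Hypothesis UV : forall r s : R, 0 < r -> 0 <= s ->
  \int[P]_w expR (- (r * U_ n w + s * V_ n w)) @[n --> \oo] -->
  mixed_transform P' L alpha r s.

Lemma square_valued_exp d1 (S : measurableType d1) (U V : S -> R) :
  measurable_fun setT U -> measurable_fun setT V ->
  (forall w, 0 <= U w) -> (forall w, 0 <= V w) ->
  square_valued (fun w => expR (- U w)) (fun w => expR (- V w)).
Proof.
move=> mU' mV' U0' V0'; split.
- by apply: measurableT_comp => //; apply: measurableT_comp.
- by apply: measurableT_comp => //; apply: measurableT_comp.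
- by move=> w; rewrite expR_ge0 expR_le1 oppr_le0 U0'.
- by move=> w; rewrite expR_ge0 expR_le1 oppr_le0 V0'.
Qed.

(** Real powers have a quadratic modulus, so that the limiting pair in the
    square has the required mixed powers as means. *)
Lemma exists_limit_law : exists Q : probability (R * R)%type R,
  has_limit_transform alpha P' L Q fst snd.
Proof.
have sqn n := square_valued_exp (mU n) (mV n) (U0 n) (V0 n).
have [Zx [Zy [sqZ HZ]]] := cluster_pair P sqn.
apply: (law_from_square (mu := uniform_prob (@ltr01 R)) mL L0 alpha0 alpha1 sqZ).
move=> r s r0 s0; apply: (HZ (fun x y => x `^ r * y `^ s)).
  exact: quadratic_modulus_powR.
apply: (cvg_eq _ _ (UV r0 s0)) => // n; apply: eq_mean => w.
by rewrite -!expRM -expRD; congr expR; ring.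
Qed.

End existence_of_limit_law.

(** * Properties of the limit law *)

Section limit_law.
Context {R : realType} d (T : measurableType d) (Q : probability T R)
  d' (T' : measurableType d') (P' : probability T' R).
Variables (L : T' -> R) (alpha : R) (U V : T -> R).
Hypothesis mL : measurable_fun setT L.
Hypothesis L0 : P' [set w | 0 < L w] = 1%E.
Hypothesis alpha0 : 0 < alpha.
Hypothesis alpha1 : alpha < 1.
Hypothesis mU : measurable_fun setT U.
Hypothesis mV : measurable_fun setT V.
Hypothesis UV : has_limit_transform alpha P' L Q U V.

Let transformE r s : 0 < r -> 0 <= s ->
  (\int[Q]_w (expR (- r * U w - s * V w))%:E = (mixed_transform P' L alpha r s)%:E)%E.
Proof.
move=> r0 s0; have := UV r0 s0; rewrite [in LHS]unlock => ->.
exact: mixed_transformE.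
Qed.

Let mexp (r s : R) : measurable_fun setT (fun w => (expR (- r * U w - s * V w))%:E).
Proof.
apply/measurable_EFinP; apply: measurableT_comp => //; apply: measurable_funB.
  by apply: measurable_funM => //; exact: measurable_cst.
by apply: measurable_funM => //; exact: measurable_cst.
Qed.

Let mean_le_transform (f : T -> R) r s : bounded_measurable f ->
  0 < r -> 0 <= s -> (forall w, 0 <= f w) ->
  {ae Q, forall w, f w <= expR (- r * U w - s * V w)} ->
  \int[Q]_w f w <= mixed_transform P' L alpha r s.
Proof.
move=> bf r0 s0 f0 fle; rewrite -lee_fin -transformE// -expectation_bmeas//.
rewrite unlock; apply: ae_ge0_le_integral => //.
- by move=> w _; rewrite lee_fin f0.
- by apply/measurable_EFinP; case: bf.
- by apply: filterS fle => w h _; rewrite lee_fin.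
Qed.

Let transform_le1 r s : 0 < r -> 0 <= s -> mixed_transform P' L alpha r s <= 1.
Proof.
move=> r0 s0; have d0 := ltW (delta_gt0 alpha0 alpha1 r0 s0).
rewrite /mixed_transform; apply: mean_le1.
  apply: bmeas_exp_rate => //; first by apply: measurable_maxr => //; exact: measurable_cst.
  by move=> w; rewrite le_max lexx orbT.
by move=> w; rewrite expR_le1 oppr_le0 mulr_ge0// le_max lexx orbT.
Qed.

(** Where [U < 0] the function [exp (- r U)] exceeds [- r U], while its mean
    stays at most [1] for all [r]. *)
Lemma limit_U_ge0 : {ae Q, forall w, 0 <= U w}.
Proof.
pose f w := ramp 1 0 (- U w).
have f01 w : 0 <= f w <= 1 := ramp01 1 0 (- U w).
have f0 w : 0 <= f w by case/andP: (f01 w).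
have bf : bounded_measurable f.
  apply: (bmeas_continuous (@continuous_ramp R 1 0)); last exact: measurableT_comp.
  by exists 1 => x; case/andP: (ramp01 1 0 x) => ? ?; rewrite ger0_norm.
(* where U < 0, n.+1 * f <= - n.+1 * U <= exp (- n.+1 * U) *)
have nf n : n.+1%:R * \int[Q]_w f w <= 1.
  rewrite -meanZ//; apply: le_trans (transform_le1 (ltr0Sn R n) (lexx 0)).
  apply: mean_le_transform => //.
  - by apply: bmeasM => //; exact: bmeas_cst.
  - by move=> w; rewrite mulr_ge0.
  - apply: aeW => w; rewrite mul0r subr0.
    have [U0|U0] := leP 0 (U w).
      have -> : f w = 0 by rewrite /f ramp_le0 ?oppr_le0.
      by rewrite mulr0 expR_ge0.
    apply: (@le_trans _ _ (n.+1%:R * - U w)).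
      rewrite ler_wpM2l// /f /ramp mul1r subr0 ge_min.
      by rewrite max_l ?lexx// oppr_ge0 ltW.
    apply: le_trans (expR_ge1Dx _).
    by rewrite mulrN mulNr lerDr.
have E0 : \int[Q]_w f w = 0.
  apply/eqP; rewrite eq_le mean_ge0// andbT leNgt; apply/negP => Ef.
  have [n _ Hn] := @nbhs_infty_gtr R (\int[Q]_w f w)^-1.
  have := nf n; rewrite leNgt => /negP; apply.
  rewrite -ltr_pdivrMr// div1r (lt_trans (Hn n (leqnn n)))// ltr_nat//.
apply: filterS (mean_eq0_ae bf f0 E0) => w.
rewrite /f /ramp mul1r subr0; case: (leP 0 (U w)) => // U0.
rewrite max_l ?oppr_ge0 ?ltW//; case: (leP (- U w) 1) => _ /eqP.
  by rewrite oppr_eq0 lt_eqF.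
by rewrite oner_eq0.
Qed.

Let X w := expR (- Num.max (U w) 0).
Let Y w := expR (- Num.max (V w) 0).

(** Where [V <= 0] the function [exp (- U - s V)] does not decrease with [s],
    while [cvg_mixed_sy] says that its mean tends to [0]. *)
Lemma limit_V_gt0 : {ae Q, forall w, 0 < V w}.
Proof.
have max0 w : 0 <= Num.max (U w) 0 by rewrite le_max lexx orbT.
have mU' : measurable_fun setT (fun w => Num.max (U w) 0).
  by apply: measurable_maxr => //; exact: measurable_cst.
have bX : bounded_measurable X.
  by case: (square_valued_exp mU' mU' max0 max0) => *; exact: bmeas_le01.
have bI : bounded_measurable (fun w => ((V w <= 0)%R)%:R : R).
  by apply: bmeas_bool; apply: measurable_fun_ler => //; exact: measurable_cst.
(* on V <= 0, X = exp (- U) is at most exp (- U - n.+1 * V) *)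
pose f w := X w * ((V w <= 0)%R)%:R.
have bf : bounded_measurable f by exact: bmeasM.
have f0 w : 0 <= f w by rewrite mulr_ge0 ?expR_ge0.
have fn n : \int[Q]_w f w <= mixed_transform P' L alpha 1 n.+1%:R.
  apply: mean_le_transform => //.
  apply: filterS limit_U_ge0 => w U0; rewrite /f /X max_l//.
  have [V0|V0] := leP (V w) 0; last by rewrite mulr0 expR_ge0.
  rewrite mulr1 ler_expR mulN1r lerDl oppr_ge0 mulr_ge0_le0//.
have E0 : \int[Q]_w f w = 0.
  apply/eqP; rewrite eq_le mean_ge0// andbT.
  apply: (ler_cvg_to (cvg_cst _) (cvg_mixed_sy mL L0 alpha0 alpha1)).
  exact: nearW.
apply: filterS (mean_eq0_ae bf f0 E0) => w /eqP.
rewrite /f mulf_eq0 gt_eqF ?expR_gt0//=.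
by case: (leP (V w) 0) => //; rewrite oner_eq0.
Qed.

Lemma limit_square_valued : square_valued X Y.
Proof.
by apply: square_valued_exp => [||w|w]; rewrite ?le_max ?lexx ?orbT//;
  apply: measurable_maxr => //; exact: measurable_cst.
Qed.

Lemma limit_moments (a b : nat) :
  \int[Q]_w (X w ^+ a.+1 * Y w ^+ b) = mixed_transform P' L alpha a.+1%:R b%:R.
Proof.
have sq := limit_square_valued.
have bm : bounded_measurable (fun w => X w ^+ a.+1 * Y w ^+ b).
  apply: bmeasM; apply: bmeasX; first exact: (bmeas_squareX sq).
  exact: (bmeas_squareY sq).
apply: EFin_inj; rewrite -transformE// -expectation_bmeas// unlock.
apply: ae_eq_integral => //.
- by apply/measurable_EFinP; case: bm.
apply: filterS2 limit_U_ge0 limit_V_gt0 => w U0 V0 _ /=.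
rewrite /X /Y !max_l ?(ltW V0)// -!expRM_natl -expRD; congr (expR _)%:E.
by ring.
Qed.

End limit_law.

(** * Convergence of means inside the square *)

Section interior_convergence.
Context {R : realType} d (T : measurableType d) (P : probability T R)
  d' (T' : measurableType d') (P' : probability T' R).
Variables (X_ Y_ : nat -> T -> R) (X Y : T' -> R).
Hypothesis XY_ : forall n, square_valued (X_ n) (Y_ n).
Hypothesis XY : square_valued X Y.
Hypothesis moments : forall a b : nat,
  \int[P]_w (X_ n w ^+ a.+1 * Y_ n w ^+ b) @[n --> \oo] -->
  \int[P']_w (X w ^+ a.+1 * Y w ^+ b).
Hypothesis interior : {ae P', forall w, [/\ 0 < X w, 0 < Y w & Y w < 1]}.

Let cut (e z : R) := ramp e^-1 e z.

Let cut0 e z : 0 < e -> z <= e -> cut e z = 0.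
Proof. by move=> e0 ze; apply: ramp_le0; rewrite // invr_ge0 ltW. Qed.

Let cut1 e z : 0 < e -> 2 * e <= z -> cut e z = 1.
Proof.
by move=> e0 ze; apply: ramp_ge1; rewrite ler_pdivlMl// mulr1; lra.
Qed.

Let window (e x y : R) := cut e x * (cut e y * cut e (1 - y)).

Let window01 e x y : 0 <= window e x y <= 1.
Proof.
have /andP[? ?] := ramp01 e^-1 e x; have /andP[? ?] := ramp01 e^-1 e y.
have /andP[? ?] := ramp01 e^-1 e (1 - y).
by rewrite /window !mulr_ge0//= mulr_ile1 ?mulr_ge0// mulr_ile1.
Qed.

Let trunc (e x : R) := Num.max x e.
Let clamp (e y : R) := Num.min (Num.max y e) (1 - e).

Let continuous_window_over e : 0 < e ->
  continuous (fun p : R * R => (trunc e p.1)^-1 * window e p.1 p.2).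
Proof.
move=> e0 p; have c1 : {for p, continuous (fun p : R * R => p.1)} by exact: cvg_fst.
have c2 : {for p, continuous (fun p : R * R => p.2)} by exact: cvg_snd.
have m0 : trunc e p.1 != 0 by rewrite gt_eqF// lt_max e0 orbT.
apply: cvgM.
  apply: cvgV => //.
  by apply: (@continuous_max _ _ fst (fun=> e)) => //; exact: cvg_cst.
apply: cvgM; first by apply: (continuous_comp c1); exact: continuous_ramp.
apply: cvgM; first by apply: (continuous_comp c2); exact: continuous_ramp.
apply: (@continuous_comp _ _ _ (fun p : R * R => 1 - p.2) (cut e)); last exact: continuous_ramp.
by apply: (@cvgB _ R^o) => //; exact: cvg_cst.
Qed.

(** A continuous window, equal to [1] well inside the square and to [0] near
    the sides [x = 0], [y = 0] and [y = 1], truncates [h] to a continuous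
    function to which [cvg_weighted_mean] applies after division by [x]. The
    mean of the window controls the error for the limit and, by convergence of
    that mean, for the sequence too. *)
Lemma cvg_mean_interior (h : R -> R -> R) (M : R) :
  (forall n, bounded_measurable (fun w => h (X_ n w) (Y_ n w))) ->
  bounded_measurable (fun w => h (X w) (Y w)) ->
  (forall x y, `|h x y| <= M) ->
  (forall e : R, 0 < e -> e < 2^-1 -> continuous (fun p : R * R =>
     h (Num.max p.1 e) (Num.min (Num.max p.2 e) (1 - e)))) ->
  \int[P]_w h (X_ n w) (Y_ n w) @[n --> \oo] --> \int[P']_w h (X w) (Y w).
Proof.
move=> bh_ bh hM ch.
have M0 : 0 <= M by apply: le_trans (hM 0 0).
(* the window vanishes where trunc e x differs from x *)
have inv0 e : 0 < e -> forall x y,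
    x * ((trunc e x)^-1 * window e x y) = window e x y.
  move=> e0 x y; have [xe|xe] := leP x e; first by rewrite /window cut0// mul0r !mulr0.
  by rewrite /trunc max_l ?(ltW xe)// mulVKf// gt_eqF// (lt_trans e0).
have hE e : 0 < e -> forall x y, x * (h (trunc e x) (clamp e y) *
    ((trunc e x)^-1 * window e x y)) = h x y * window e x y.
  move=> e0 x y; rewrite mulrCA inv0//.
  have [xe|xe] := leP x e; first by rewrite /window cut0// mul0r !mulr0.
  have [ye|ye] := leP y e; first by rewrite /window (cut0 e0 ye) mul0r !mulr0.
  have [ye1|ye1] := leP (1 - y) e.
    by rewrite /window (cut0 e0 ye1) !mulr0.
  by rewrite /trunc /clamp !max_l ?ltW// min_l//; lra.
have qw e : 0 < e ->
    quadratic_modulus (fun x y => (trunc e x)^-1 * window e x y).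
  by move=> e0; apply: continuous_quadratic_modulus; exact: continuous_window_over.
have qh e : 0 < e -> e < 2^-1 -> quadratic_modulus (fun x y =>
    h (trunc e x) (clamp e y) * ((trunc e x)^-1 * window e x y)).
  move=> e0 e1; apply: continuous_quadratic_modulus => p.
  by apply: cvgM; [exact: ch | exact: continuous_window_over].
have bw e d1 (S : measurableType d1) (f g : S -> R) : 0 < e -> square_valued f g ->
    bounded_measurable (fun w => window e (f w) (g w)).
  move=> e0 fg; have := bmeasM (bmeas_squareX fg) (bmeas_quadratic_modulus fg (qw _ e0)).
  by congr bounded_measurable; apply/funext => w; exact: inv0.
have cw e : 0 < e -> \int[P]_w window e (X_ n w) (Y_ n w) @[n --> \oo] -->
    \int[P']_w window e (X w) (Y w).
  move=> e0; apply: (cvg_eq _ _ (cvg_weighted_mean XY_ XY moments (qw _ e0))) => [n|];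
    by apply: eq_mean => w; exact: inv0.
have chw e : 0 < e -> e < 2^-1 ->
    \int[P]_w (h (X_ n w) (Y_ n w) * window e (X_ n w) (Y_ n w)) @[n --> \oo] -->
    \int[P']_w (h (X w) (Y w) * window e (X w) (Y w)).
  move=> e0 e1; apply: (cvg_eq _ _ (cvg_weighted_mean XY_ XY moments (qh _ e0 e1))) => [n|];
    by apply: eq_mean => w; exact: hE.
have close e d1 (S : measurableType d1) (Q : probability S R) (f g : S -> R) :
    0 < e -> square_valued f g -> bounded_measurable (fun w => h (f w) (g w)) ->
    `|\int[Q]_w h (f w) (g w) - \int[Q]_w (h (f w) (g w) * window e (f w) (g w))| <=
    M * (1 - \int[Q]_w window e (f w) (g w)).
  move=> e0 fg bfg; have bwe := bw e _ _ _ _ e0 fg; have b1 := bmeas_cst S (1 : R).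
  rewrite -[X in M * (X - _)](mean_cst Q) -(meanB Q b1 bwe) -meanZ; last exact: bmeasB.
  apply: dist_mean => //.
  - exact: bmeasM.
  - by apply: bmeasM; [exact: bmeas_cst | exact: bmeasB].
  move=> w; rewrite -[X in X - _]mulr1 -mulrBr normrM.
  have /andP[h0 h1] := window01 e (f w) (g w).
  by rewrite ler_pM// ger0_norm// subr_ge0.
have full : \int[P']_w window k.+3%:R^-1 (X w) (Y w) @[k --> \oo] --> (1 : R).
  rewrite -[X in _ --> X](mean_cst P').
  apply: (bounded_convergence (M := 1)).
  - by move=> k; case: (bw k.+3%:R^-1 _ _ _ _ _ XY).
  - by move=> k w; have /andP[h0 h1] := window01 k.+3%:R^-1 (X w) (Y w); rewrite ger0_norm.
  - exact: measurable_cst.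
  have c3 : k.+3%:R^-1 @[k --> \oo] --> (0 : R).
    have := @cvg_harmonic R; rewrite -(cvg_shiftn 2).
    by rewrite (_ : (fun n => _) = fun k => k.+3%:R^-1)//; apply/funext => k; rewrite /harmonic addn2.
  apply: filterS interior => w [x0 y0 y1].
  have small (z : R) : 0 < z -> \forall k \near \oo, 2 * k.+3%:R^-1 <= z.
    move=> z0; have z2 : 0 < z / 2 by rewrite divr_gt0.
    by near=> k; rewrite -ler_pdivlMl// mulrC; apply: ltW; near: k; exact: (cvgr_lt _ c3).
  apply: cvg_near_cst; near=> k.
  have k0 : 0 < k.+3%:R^-1 :> R by rewrite invr_gt0.
  rewrite /window !cut1 ?mulr1//; near: k; apply: small => //.
  by rewrite subr_gt0.
apply: cvg_up_to => e e0.
have eM : 0 < e / (M + 1) by rewrite divr_gt0// ltr_wpDl.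
have [k Hk] : exists k : nat, 1 - e / (M + 1) < \int[P']_w window k.+3%:R^-1 (X w) (Y w).
  have [k _ Hk] := cvgr_gt _ full (1 - e / (M + 1)) (ltac:(by rewrite gtrBl)).
  by exists k; apply: Hk => /=.
set c : R := k.+3%:R^-1 in Hk.
have c0 : 0 < c by rewrite invr_gt0.
(* the index is shifted by 3 for this strict inequality *)
have c1 : c < 2^-1 by rewrite ltf_pV2 ?posrE// ltr_nat.
have fin z : 1 - e / (M + 1) < z -> M * (1 - z) <= e.
  move=> hz; have : 1 - z <= e / (M + 1) by lra.
  move=> /(ler_wpM2l M0) /le_trans; apply.
  rewrite mulrCA -[leRHS]mulr1 ler_wpM2l ?(ltW e0)// ler_pdivrMr; last by rewrite ltr_wpDl.
  by rewrite mul1r lerDl.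
exists (fun n => \int[P]_w (h (X_ n w) (Y_ n w) * window c (X_ n w) (Y_ n w))).
exists (\int[P']_w (h (X w) (Y w) * window c (X w) (Y w))); split.
- exact: chw.
- near=> n; apply: le_trans (close c _ _ P _ _ c0 (XY_ n) (bh_ n)) _; apply: fin.
  by near: n; exact: (cvgr_gt _ (cw _ c0)).
- by apply: le_trans (close c _ _ P' _ _ c0 XY bh) _; exact: fin.
Unshelve. all: by end_near. Qed.

End interior_convergence.

(** * Uniqueness of the limit law *)

Section measures_on_the_plane.
Context {R : realType}.

Lemma measurable_quadrant (a b : R) :
  measurable [set p : R * R | p.1 < a /\ p.2 < b].
Proof.
rewrite (_ : [set p | _] = `]-oo, a[%classic `*` `]-oo, b[%classic).
  by apply: measurableX; exact: measurable_itv.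
by apply/seteqP; split => p /=; rewrite !in_itv.
Qed.

Let quadrant (a b : R) : set (R * R) := [set p | p.1 < a /\ p.2 < b].
Let quadrants : set (set (R * R)) := [set A | exists a b, A = quadrant a b].

Let quadrant_nat : \bigcup_(n : nat) quadrant n%:R n%:R = setT.
Proof.
apply/seteqP; split => // -[x y] _.
have [n _ Hn] := @nbhs_infty_gtr R (Num.max x y).
by exists n => //; split => /=; apply: le_lt_trans (Hn n (leqnn n));
  rewrite le_max lexx ?orbT.
Qed.

Let measurable_quadrants : @measurable _ (R * R)%type = <<s quadrants >>.
Proof.
apply/seteqP; split; last first.
  apply: smallest_sub; first exact: sigma_algebra_measurable.
  move=> _ [a [b ->]].
  exact: measurable_quadrant.
have gen A : quadrants A -> <<s quadrants >> A by exact: sub_sigma_algebra.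
have half1 : measurable_fun (setT : set (g_sigma_algebraType quadrants)) (fst : R * R -> R).
  apply: (measurability _ (RGenInftyO.measurableE R)) => _ [_ [a ->] <-].
  rewrite setTI (_ : _ @^-1` _ = \bigcup_(n : nat) quadrant a n%:R).
    by apply: bigcupT_measurable => n; apply: gen; exists a, n%:R.
  apply/seteqP; split => [[x y]|[x y] [n _ [/= xa _]]] /=; rewrite in_itv//= => xa.
  by have [n _ /(_ n (leqnn n)) Hn] := @nbhs_infty_gtr R y; exists n.
have half2 : measurable_fun (setT : set (g_sigma_algebraType quadrants)) (snd : R * R -> R).
  apply: (measurability _ (RGenInftyO.measurableE R)) => _ [_ [a ->] <-].
  rewrite setTI (_ : _ @^-1` _ = \bigcup_(n : nat) quadrant n%:R a).
    by apply: bigcupT_measurable => n; apply: gen; exists n%:R, a.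
  apply/seteqP; split => [[x y]|[x y] [n _ [/= _ ya]]] /=; rewrite in_itv//= => ya.
  by have [n _ /(_ n (leqnn n)) Hn] := @nbhs_infty_gtr R x; exists n.
rewrite measurable_prod_measurableType; apply: smallest_sub.
  exact: smallest_sigma_algebra.
move=> _ [A mA [B mB] <-].
have := measurableI _ _ (half1 measurableT A mA) (half2 measurableT B mB).
by rewrite !setTI => h; rewrite (_ : A `*` B = fst @^-1` A `&` snd @^-1` B).
Qed.

(** Quadrants are stable under intersection and generate the Borel sets of the
    plane. *)
Lemma quadrants_determine_law (Q1 Q2 : probability (R * R)%type R) :
  (forall a b, Q1 [set p | p.1 < a /\ p.2 < b] = Q2 [set p | p.1 < a /\ p.2 < b]) ->
  forall A, measurable A -> Q1 A = Q2 A.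
Proof.
move=> H A mA.
apply: (@measure_unique _ _ _ quadrants (fun n => quadrant n%:R n%:R)) => //.
- move=> _ _ [a [b ->]] [a' [b' ->]]; exists (Num.min a a'), (Num.min b b').
  apply/seteqP; split => p /=; rewrite /quadrant /= !lt_min.
    by move=> [[-> ->] [-> ->]].
  by move=> [/andP[-> ->] /andP[-> ->]].
- by move=> n; exists n%:R, n%:R.
- by move=> _ [a [b ->]]; exact: H.
- move=> k; rewrite (le_lt_trans (probability_le1 _ _)) ?ltry//.
  exact: measurable_quadrant.
Qed.

End measures_on_the_plane.

Section uniqueness.
Context {R : realType} d' (T' : measurableType d') (P' : probability T' R).
Variables (L : T' -> R) (alpha : R).
Hypothesis mL : measurable_fun setT L.
Hypothesis L0 : P' [set w | 0 < L w] = 1%E.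
Hypothesis alpha0 : 0 < alpha.
Hypothesis alpha1 : alpha < 1.

Let X (p : R * R) := expR (- Num.max p.1 0).
Let Y (p : R * R) := expR (- Num.max p.2 0).

Let cvg_ramp (z c : R) : ramp n%:R c z @[n --> \oo] --> (((c < z)%R)%:R : R).
Proof.
apply: cvg_near_cst; have [zc|cz] := leP z c.
  by apply: nearW => n; exact: ramp_le0.
near=> n; apply: ramp_ge1; rewrite -ler_pdivrMr ?subr_gt0// div1r ltW//.
by near: n; exact: nbhs_infty_gtr.
Unshelve. all: by end_near. Qed.

Let continuous_ramps (n : nat) (a b : R) (k l : R -> R) :
  continuous k -> continuous l ->
  continuous (fun p : R * R => ramp n%:R a (k p.1) * ramp n%:R b (l p.2)).
Proof.
move=> ck cl p; apply: cvgM.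
  apply: (@continuous_comp _ _ _ (fun p : R * R => k p.1) (ramp n%:R a)).
    by apply: (@continuous_comp _ _ _ (fst : R * R -> R) k); [exact: cvg_fst | exact: ck].
  exact: continuous_ramp.
apply: (@continuous_comp _ _ _ (fun p : R * R => l p.2) (ramp n%:R b)).
  by apply: (@continuous_comp _ _ _ (snd : R * R -> R) l); [exact: cvg_snd | exact: cl].
exact: continuous_ramp.
Qed.

Let dist_ramps (n : nat) (a b x y : R) : `|ramp n%:R a x * ramp n%:R b y| <= 1.
Proof.
rewrite normrM -[leRHS]mulr1.
have /andP[? ?] := ramp01 n%:R a x; have /andP[? ?] := ramp01 n%:R b y.
by rewrite ler_pM// ger0_norm.
Qed.

Section one_law.
Variable Q : probability (R * R)%type R.
Hypothesis QL : has_limit_transform alpha P' L Q fst snd.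

Let mU : measurable_fun setT (fst : R * R -> R). Proof. exact: measurable_fst. Qed.
Let mV : measurable_fun setT (snd : R * R -> R). Proof. exact: measurable_snd. Qed.

Let sq : square_valued X Y.
Proof. exact: (limit_square_valued mU mV). Qed.

Lemma law_interior : {ae Q, forall p, [/\ 0 < X p, 0 < Y p & Y p < 1]}.
Proof.
apply: filterS (limit_V_gt0 mL L0 alpha0 alpha1 mU mV QL) => p p0.
by rewrite !expR_gt0 expR_lt1 oppr_lt0 lt_max p0.
Qed.

Lemma law_quadrant0 a b : a <= 0 \/ b <= 0 ->
  Q [set p | p.1 < a /\ p.2 < b] = 0%E.
Proof.
move=> ab.
have [A [mA QA sA]] := filterI (limit_U_ge0 mL L0 alpha0 alpha1 mU mV QL)
  (limit_V_gt0 mL L0 alpha0 alpha1 mU mV QL).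
apply/eqP; rewrite eq_le measure_ge0 andbT -QA le_measure// ?inE//.
  exact: measurable_quadrant.
move=> p /= [pa pb]; apply: sA => /= -[p1 p2].
case: ab => h; [have := lt_le_trans pa h | have := lt_le_trans pb h].
  by rewrite ltNge p1.
by rewrite ltNge ltW.
Qed.

Let hn (a b : R) (n : nat) (x y : R) :=
  ramp n%:R (expR (- a)) x * ramp n%:R (expR (- b)) y.

Lemma bmeas_law_ramp a b n : bounded_measurable (fun p => hn a b n (X p) (Y p)).
Proof.
apply: (bmeas_quadratic_modulus sq); apply: continuous_quadratic_modulus.
by apply: (@continuous_ramps n _ _ id id) => x; exact: cvg_id.
Qed.

(** Ramps of slope [n] increase to the indicator of an open quadrant; for
    positive [a] and [b] the quadrant is a condition on [exp (- max U 0)] and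
    [exp (- max V 0)]. *)
Lemma cvg_law_quadrant a b : 0 < a -> 0 < b ->
  \int[Q]_p hn a b n (X p) (Y p) @[n --> \oo] -->
  fine (Q [set p | p.1 < a /\ p.2 < b]).
Proof.
move=> a0 b0; have mA := measurable_quadrant a b.
rewrite -mean_indic//; apply: (bounded_convergence (M := 1)).
- by move=> n; case: (bmeas_law_ramp a b n).
- by move=> n p; exact: dist_ramps.
- exact: measurable_indic.
apply: aeW => p; rewrite (_ : \1__ p = ((expR (- a) < X p)%R)%:R * ((expR (- b) < Y p)%R)%:R).
  by apply: cvgM; exact: cvg_ramp.
rewrite indicE /X /Y !ltr_expR !ltrN2 !gt_max a0 b0 !andbT -natrM mulnb.
by congr (_%:R); congr nat_of_bool; apply/idP/andP; rewrite inE.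
Qed.

End one_law.

(** [cvg_mean_interior] between constant sequences: the two laws give the same
    mean to every product of ramps, hence the same mass to every quadrant.
    Quadrants with a nonpositive corner are null for both. *)
Lemma limit_law_unique (Q1 Q2 : probability (R * R)%type R) :
  has_limit_transform alpha P' L Q1 fst snd ->
  has_limit_transform alpha P' L Q2 fst snd ->
  forall A, measurable A -> Q1 A = Q2 A.
Proof.
move=> H1 H2; apply: quadrants_determine_law => a b.
have [a0|a0] := leP a 0; first by rewrite !law_quadrant0//; left.
have [b0|b0] := leP b 0; first by rewrite !law_quadrant0//; right.
have mU : measurable_fun setT (fst : R * R -> R) by exact: measurable_fst.
have mV : measurable_fun setT (snd : R * R -> R) by exact: measurable_snd.
have sq : square_valued X Y by exact: (limit_square_valued mU mV).
have mom i j : \int[Q1]_w (X w ^+ i.+1 * Y w ^+ j) @[_ --> \oo] -->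
    \int[Q2]_w (X w ^+ i.+1 * Y w ^+ j).
  rewrite (limit_moments mL L0 alpha0 alpha1 mU mV H1).
  rewrite (limit_moments mL L0 alpha0 alpha1 mU mV H2); exact: cvg_cst.
pose h n x y := ramp n%:R (expR (- a)) x * ramp n%:R (expR (- b)) y.
have E n : \int[Q1]_p h n (X p) (Y p) = \int[Q2]_p h n (X p) (Y p).
  have c := cvg_mean_interior (h := h n) (M := 1) (fun=> sq) sq mom (law_interior H2)
    (fun=> bmeas_law_ramp a b n) (bmeas_law_ramp a b n).
  apply: (cvg_unique _ (cvg_cst _) (c _ _)); first exact: Rhausdorff.
    by move=> x y; exact: dist_ramps.
  move=> e _ _; apply: (@continuous_ramps n _ _ (fun x => Num.max x e)
     (fun x => Num.min (Num.max x e) (1 - e))) => x.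
    by apply: (@continuous_max _ _ id (fun=> e)); [exact: cvg_id | exact: cvg_cst].
  apply: (@continuous_min _ _ (fun x => Num.max x e) (fun=> 1 - e)); last exact: cvg_cst.
  by apply: (@continuous_max _ _ id (fun=> e)); [exact: cvg_id | exact: cvg_cst].
have c1 := cvg_law_quadrant (Q := Q1) a0 b0; have c2 := cvg_law_quadrant (Q := Q2) a0 b0.
set A := [set p | _] in c1 c2 *.
have Ef : fine (Q1 A) = fine (Q2 A).
  rewrite (funext E) in c1.
  exact: (cvg_unique (@Rhausdorff R) c1 c2).
have mA : measurable A by exact: measurable_quadrant.
have fin (Q : probability (R * R)%type R) : (fine (Q A))%:E = Q A.
  by rewrite fineK// fin_num_measure.
by rewrite -fin -[RHS]fin Ef.
Qed.

End uniqueness.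

(** * Convergence of the ratio *)

Section measurable_inverse.
Context {R : realType}.

(** The functions [x / (x^2 + 1/(n+1))] are continuous and tend to the inverse
    everywhere, including at [0], whose inverse is [0]. *)
Lemma measurable_invr : measurable_fun setT (@GRing.inv R).
Proof.
have d0 (n : nat) (x : R) : 0 < x ^+ 2 + n.+1%:R^-1 by rewrite ltr_wpDl ?sqr_ge0 ?invr_gt0.
apply: (@measurable_fun_cvg _ _ _ _ (fun n (x : R) => x / (x ^+ 2 + n.+1%:R^-1))).
  move=> n; apply: continuous_measurable_fun => x.
  apply: cvgM; first exact: cvg_id.
  apply: cvgV; first by rewrite gt_eqF.
  by apply: (@cvgD _ R^o); [exact: exprn_continuous | exact: cvg_cst].
move=> x _; have [->|x0] := eqVneq x 0.
  rewrite invr0 (_ : (fun n => _) = fun=> 0); first exact: cvg_cst.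
  by apply/funext => n; rewrite mul0r.
have -> : x^-1 = x / (x ^+ 2 + 0) by rewrite addr0; field.
apply: cvgM; first exact: cvg_cst.
apply: cvgV; first by rewrite addr0 expf_neq0.
by apply: cvgD; [exact: cvg_cst | exact: cvg_harmonic].
Qed.

Lemma measurable_sqrt_ratio d (T : measurableType d) (u v : T -> R) :
  measurable_fun setT u -> measurable_fun setT v ->
  measurable_fun setT (fun w => Num.sqrt (u w) / v w).
Proof.
move=> mu mv; apply: measurable_funM.
  exact: (measurableT_comp (continuous_measurable_fun (@sqrt_continuous R)) mu).
exact: (measurableT_comp measurable_invr mv).
Qed.

End measurable_inverse.

Section ratio_convergence.
Context {R : realType} d (T : measurableType d) (P : probability T R)
  d' (T' : measurableType d') (P' : probability T' R)
  d'' (T'' : measurableType d'') (P'' : probability T'' R).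
Variables (L : T' -> R) (alpha : R) (U_ V_ : nat -> T -> R) (U V : T'' -> R).
Hypothesis mL : measurable_fun setT L.
Hypothesis L0 : P' [set w | 0 < L w] = 1%E.
Hypothesis alpha0 : 0 < alpha.
Hypothesis alpha1 : alpha < 1.
Hypothesis mU_ : forall n, measurable_fun setT (U_ n).
Hypothesis mV_ : forall n, measurable_fun setT (V_ n).
Hypothesis U_0 : forall n w, 0 <= U_ n w.
Hypothesis V_0 : forall n w, 0 <= V_ n w.
Hypothesis UV_ : forall r s : R, 0 < r -> 0 <= s ->
  \int[P]_w expR (- (r * U_ n w + s * V_ n w)) @[n --> \oo] -->
  mixed_transform P' L alpha r s.
Hypothesis mU : measurable_fun setT U.
Hypothesis mV : measurable_fun setT V.
Hypothesis UV : has_limit_transform alpha P' L P'' U V.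

(** With [x = exp (- u)] and [y = exp (- v)] this is [sqrt u / v], away from
    the singularities at [y = 0] and [y = 1]. *)
Lemma continuous_log_ratio (e : R) : 0 < e -> e < 2^-1 ->
  continuous (fun p : R * R => Num.sqrt (- ln (Num.max p.1 e)) /
     (- ln (Num.min (Num.max p.2 e) (1 - e)))).
Proof.
move=> e0 e1 p.
have m0 : 0 < Num.max p.1 e by rewrite lt_max e0 orbT.
have e2 : e < 1 - e by lra.
have c0 : 0 < Num.min (Num.max p.2 e) (1 - e).
  by rewrite lt_min lt_max e0 orbT (lt_trans e0).
have c1 : Num.min (Num.max p.2 e) (1 - e) < 1.
  by rewrite gt_min; apply/orP; right; lra.
have cmax (q : R * R -> R) : {for p, continuous q} ->
    {for p, continuous (fun p => Num.max (q p) e)}.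
  by move=> cq; apply: (@continuous_max _ _ q (fun=> e)) => //; exact: cvg_cst.
apply: cvgM.
  apply: (@continuous_comp _ _ _ (fun p : R * R => - ln (Num.max p.1 e)) (@Num.sqrt R)).
    apply: (@cvgN _ R^o).
    apply: (@continuous_comp _ _ _ (fun p : R * R => Num.max p.1 e) (@ln R)).
      by apply: cmax; exact: cvg_fst.
    exact: continuous_ln.
  exact: sqrt_continuous.
apply: cvgV; first by rewrite oppr_eq0 lt_eqF// ln_lt0// c0.
apply: (@cvgN _ R^o).
apply: (@continuous_comp _ _ _ (fun p : R * R => Num.min (Num.max p.2 e) (1 - e)) (@ln R)).
  apply: (@continuous_min _ _ (fun p : R * R => Num.max p.2 e) (fun=> 1 - e)).
    by apply: cmax; exact: cvg_snd.
  exact: cvg_cst.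
exact: continuous_ln.
Qed.

Lemma cvg_mean_ratio (f : R -> R) : continuous f ->
  (exists M : R, forall x, `|f x| <= M) ->
  \int[P]_w f (Num.sqrt (U_ n w) / V_ n w) @[n --> \oo] -->
  \int[P'']_w f (Num.sqrt (U w) / V w).
Proof.
move=> cf bf; have [M fM] := bf.
have sq_ n := square_valued_exp (mU_ n) (mV_ n) (U_0 n) (V_0 n).
have sq := limit_square_valued mU mV.
have mom a b : \int[P]_w (expR (- U_ n w) ^+ a.+1 * expR (- V_ n w) ^+ b) @[n --> \oo] -->
    \int[P'']_w (expR (- Num.max (U w) 0) ^+ a.+1 * expR (- Num.max (V w) 0) ^+ b).
  rewrite (limit_moments mL L0 alpha0 alpha1 mU mV UV).
  apply: (cvg_eq _ _ (UV_ (ltr0Sn R a) (ler0n R b))) => // n; apply: eq_mean => w.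
  by rewrite -!expRM_natl -expRD; congr expR; ring.
have V0 := limit_V_gt0 mL L0 alpha0 alpha1 mU mV UV.
have U0 := limit_U_ge0 mL L0 alpha0 alpha1 mU mV UV.
have interior : {ae P'', forall w, [/\ 0 < expR (- Num.max (U w) 0),
    0 < expR (- Num.max (V w) 0) & expR (- Num.max (V w) 0) < 1]}.
  by apply: filterS V0 => w w0; rewrite !expR_gt0 expR_lt1 oppr_lt0 lt_max w0.
(* h is continuous only inside the square *)
pose h x y : R := f (Num.sqrt (- ln x) / - ln y).
have hE u v : h (expR (- u)) (expR (- v)) = f (Num.sqrt u / v).
  by rewrite /h !expRK !opprK.
have bh d1 (S : measurableType d1) (u v : S -> R) : measurable_fun setT u ->
    measurable_fun setT v -> bounded_measurable (fun w => h (expR (- u w)) (expR (- v w))).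
  move=> mu mv.
  have := bmeas_continuous cf bf (measurable_sqrt_ratio mu mv); congr bounded_measurable.
  by apply/funext => w; rewrite hE.
have mmax (g : T'' -> R) : measurable_fun setT g -> measurable_fun setT (fun w => Num.max (g w) 0).
  by move=> mg; apply: measurable_maxr => //; exact: measurable_cst.
have := cvg_mean_interior (h := h) (M := M) sq_ sq mom interior
  (fun n => bh _ _ _ _ (mU_ n) (mV_ n)) (bh _ _ _ _ (mmax _ mU) (mmax _ mV)).
have -> : \int[P'']_w h (expR (- Num.max (U w) 0)) (expR (- Num.max (V w) 0)) =
    \int[P'']_w f (Num.sqrt (U w) / V w).
  apply: ae_eq_mean.
  - by case: (bh _ _ _ _ (mmax _ mU) (mmax _ mV)).
  - by case: (bmeas_continuous cf bf (measurable_sqrt_ratio mU mV)).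
  by apply: filterS2 U0 V0 => w u0 v0; rewrite hE !max_l// ltW.
rewrite (_ : (fun n => _) = fun n => \int[P]_w f (Num.sqrt (U_ n w) / V_ n w)); last first.
  by apply/funext => n; apply: eq_mean => w; exact: hE.
apply=> [x y|e e0 e1]; first exact: fM.
move=> p; apply: (@continuous_comp _ _ _ (fun p : R * R => Num.sqrt (- ln (Num.max p.1 e)) /
     (- ln (Num.min (Num.max p.2 e) (1 - e)))) f).
  exact: continuous_log_ratio.
exact: cf.
Qed.

End ratio_convergence.

(** * The sample coefficient of variation *)

Section sample_ratio.
Context {R : realType}.

(** Expansion of the sample variance as the mean of the squares minus the
    square of the mean. *)
Lemma sample_CoVar_sqr (n : nat) (x : nat -> R) : (0 < n)%N ->
  0 < \sum_(i < n) x i ->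
  (sample_CoVar n x / Num.sqrt n%:R) ^+ 2 =
  (\sum_(i < n) x i ^+ 2) / (\sum_(i < n) x i) ^+ 2 - n%:R^-1.
Proof.
move=> n0 S0; have nR : (n%:R : R) != 0 by rewrite pnatr_eq0 -lt0n.
rewrite /sample_CoVar /sample_sd !exprMn !exprVn.
have var0 : 0 <= n%:R^-1 * \sum_(i < n) (x i - sample_mean n x) ^+ 2.
  by rewrite mulr_ge0 ?invr_ge0//; apply: sumr_ge0 => i _; exact: sqr_ge0.
rewrite sqr_sqrtr// sqr_sqrtr//.
have -> : \sum_(i < n) (x i - sample_mean n x) ^+ 2 =
    \sum_(i < n) x i ^+ 2 - (\sum_(i < n) x i) ^+ 2 / n%:R.
  rewrite (eq_bigr (fun i : 'I_n => x i ^+ 2 - 2 * sample_mean n x * x i + sample_mean n x ^+ 2)).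
    rewrite big_split/= sumrB sumr_const card_ord -mulr_sumr /sample_mean.
    by rewrite -mulr_natl; field.
  by move=> i _; ring.
rewrite /sample_mean; field.
by rewrite nR gt_eqF.
Qed.

Lemma sum_sqr_le (n : nat) (x : nat -> R) : (forall i, 0 <= x i) ->
  \sum_(i < n) x i ^+ 2 <= (\sum_(i < n) x i) ^+ 2.
Proof.
move=> x0; rewrite [leRHS]expr2 mulr_suml; apply: ler_sum => i _.
rewrite expr2 ler_wpM2l// (bigD1 i)//= lerDl.
by apply: sumr_ge0 => j _.
Qed.

(** As [0 <= c <= q], the square of [c - q] is at most [q^2 - c^2 = 1 / n]. The
    empty sample obeys the same bounds with the convention that the inverse of
    [0] is [0]. *)
Lemma sample_ratio_close (n : nat) (x : nat -> R) (a : R) : 0 < a ->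
  (forall i, 0 < x i) ->
  let q := Num.sqrt (\sum_(i < n) (x i / a) ^+ 2) / \sum_(i < n) (x i / a) ^+ 1 in
  let c := sample_CoVar n x / Num.sqrt n%:R in
  [/\ 0 <= q <= 1, 0 <= c <= 1 & (c - q) ^+ 2 <= n%:R^-1].
Proof.
move=> a0 x0 /=.
have S1E : \sum_(i < n) (x i / a) ^+ 1 = (\sum_(i < n) x i) / a.
  by rewrite mulr_suml; apply: eq_bigr => i _; rewrite expr1.
have S2E : \sum_(i < n) (x i / a) ^+ 2 = (\sum_(i < n) x i ^+ 2) / a ^+ 2.
  by rewrite mulr_suml; apply: eq_bigr => i _; rewrite exprMn exprVn.
have S20 : 0 <= \sum_(i < n) (x i / a) ^+ 2 by apply: sumr_ge0 => i _; exact: sqr_ge0.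
have S10 : 0 <= \sum_(i < n) (x i / a) ^+ 1.
  by apply: sumr_ge0 => i _; rewrite exprn_ge0// divr_ge0// ltW.
set q := _ / _; set c := _ / _.
have q0 : 0 <= q by rewrite /q divr_ge0// sqrtr_ge0.
have c0 : 0 <= c.
  rewrite /c /sample_CoVar !divr_ge0// ?sqrtr_ge0// /sample_mean mulr_ge0 ?invr_ge0//.
  by apply: sumr_ge0 => i _; exact: ltW.
have [n0|n0] := posnP n.
  have -> : q = 0 by rewrite /q n0 !big_ord0 invr0 mulr0.
  have -> : c = 0 by rewrite /c n0 mulr0n sqrtr0 invr0 mulr0.
  by rewrite subrr expr0n lexx ler01 invr_ge0 ler0n.
have S0 : 0 < \sum_(i < n) x i.
  case: n n0 {S1E S2E S20 S10 q c q0 c0} => // n _.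
  rewrite big_ord_recl ltr_pwDl//; apply: sumr_ge0 => i _; exact: ltW.
have qE : q ^+ 2 = (\sum_(i < n) x i ^+ 2) / (\sum_(i < n) x i) ^+ 2.
  rewrite /q exprMn exprVn sqr_sqrtr// S1E S2E; move: (\sum_(i < n) x i ^+ 2) => s2.
  by move: S0; move: (\sum_(i < n) x i) => s1 S0; field; rewrite !gt_eqF.
have cE : c ^+ 2 = q ^+ 2 - n%:R^-1 by rewrite qE -sample_CoVar_sqr.
have q1 : q <= 1.
  rewrite -(ler_pXn2r (n := 2))// ?nnegrE// expr1n qE ler_pdivrMr ?exprn_gt0// mul1r.
  by apply: sum_sqr_le => i; exact: ltW.
have cq : c <= q.
  by rewrite -(ler_pXn2r (n := 2))// ?nnegrE// cE gerBl invr_ge0.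
rewrite q0 q1 c0 (le_trans cq q1); split => //.
have -> : n%:R^-1 = q ^+ 2 - c ^+ 2 by rewrite cE; ring.
have -> : q ^+ 2 - c ^+ 2 = (c - q) ^+ 2 + 2 * c * (q - c) by ring.
by rewrite lerDl mulr_ge0// ?subr_ge0// mulr_ge0.
Qed.

End sample_ratio.

Section mean_inverse_count.
Context {R : realType} d (T : measurableType d) (P : probability T R)
  d' (T' : measurableType d') (P' : probability T' R).
Variables (N_ : nat -> T -> nat) (t : nat -> R) (L : T' -> R).
Hypothesis mN : forall n, measurable_fun setT (N_ n).
Hypothesis t0 : forall n, 0 < t n.
Hypothesis ty : t n @[n --> \oo] --> +oo.
Hypothesis mL : measurable_fun setT L.
Hypothesis L0 : P' [set w | 0 < L w] = 1%E.
Hypothesis NL : forall f : R -> R, continuous f ->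
  (exists M : R, forall x, `|f x| <= M) ->
  \int[P]_w f ((N_ n w)%:R / t n) @[n --> \oo] --> \int[P']_w f (L w).

Lemma bmeas_inv_count n : bounded_measurable (fun w => (N_ n w)%:R^-1 : R).
Proof.
apply: bmeas_le01.
  apply: (measurable_nat_index (F := fun k _ => k%:R^-1) (mN n)) => k.
  exact: measurable_cst.
move=> w; rewrite invr_ge0 ler0n/=; case: (N_ n w) => [|k]; first by rewrite invr0.
by rewrite invf_le1// ler1n.
Qed.

(** For every [k], the inverse of a positive [N] is at most [k / t + exp (1 - k
    N / t)], according to whether [k N] exceeds [t] or not. The mean of the
    exponential tends to its mean at [L], which is small for large [k] because
    [L] is positive. *)
Lemma cvg_mean_inv_count : \int[P]_w (N_ n w)%:R^-1 @[n --> \oo] --> (0 : R).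
Proof.
have mmax : measurable_fun setT (fun w => Num.max (L w) 0).
  by apply: measurable_maxr => //; exact: measurable_cst.
have max0 w : 0 <= Num.max (L w) 0 by rewrite le_max lexx orbT.
have tail : \int[P']_w expR (- (k.+1%:R * Num.max (L w) 0)) @[k --> \oo] --> (0 : R).
  rewrite -[X in _ --> X](mean_cst P').
  apply: (bounded_convergence (M := 1)).
  - by move=> k; case: (bmeas_exp_rate (ler0n R k.+1) mmax max0).
  - by move=> k w; rewrite ger0_norm ?expR_ge0// expR_le1 oppr_le0 mulr_ge0.
  - exact: measurable_cst.
  apply: filterS (ae_gt0 mL L0) => w w0.
  apply: (@cvg_comp _ _ _ (fun k : nat => k.+1%:R * Num.max (L w) 0)
    (fun x => expR (- x)) _ (pinfty_nbhs R)); last exact: cvgr_expR.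
  rewrite max_l ?(ltW w0)//; apply/cvgryPge => M; near=> k.
  rewrite -ler_pdivrMr// (@le_trans _ _ k%:R) ?ler_nat//; near: k.
  exact: nbhs_infty_ger.
apply/cvgrPdist_le => e e0.
have e2 : 0 < e / 2 by rewrite divr_gt0.
have E0 := expR_gt0 (1 : R).
have [k _ /(_ k (leqnn k)) Hk] := cvgr_lt _ tail (e / 2 / expR 1) (ltac:(by rewrite divr_gt0)).
have S0 n w : 0 <= (N_ n w)%:R / t n by rewrite divr_ge0// ltW.
have mS n : measurable_fun setT (fun w => (N_ n w)%:R / t n).
  apply: (measurable_nat_index (F := fun k _ => k%:R / t n) (mN n)) => j.
  exact: measurable_cst.
have kk : (fun=> k.+1%:R : R) @ \oo --> (k.+1%:R : R) by exact: cvg_cst.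
have cexp := cvg_mean_exp_rate mS S0 NL (ltr0Sn R k) kk.
near=> n.
have tn : k.+1%:R / t n <= e / 2.
  rewrite ler_pdivrMr// mulrC -ler_pdivrMr//; apply: ltW; near: n.
  by move/cvgryPgt : ty; apply.
have expn : \int[P]_w expR (- (k.+1%:R * ((N_ n w)%:R / t n))) < e / 2 / expR 1.
  by near: n; exact: (cvgr_lt _ cexp).
have bexp : bounded_measurable (fun w => expR (- (k.+1%:R * ((N_ n w)%:R / t n)))).
  exact: bmeas_exp_rate.
rewrite sub0r normrN ger0_norm; last by apply: mean_ge0 => w; rewrite invr_ge0.
apply: (@le_trans _ _ (k.+1%:R / t n +
    expR 1 * \int[P]_w expR (- (k.+1%:R * ((N_ n w)%:R / t n))))); last first.
  have -> : e = e / 2 + expR 1 * (e / 2 / expR 1) by field; rewrite gt_eqF.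
  by rewrite lerD// ler_wpM2l// ltW.
rewrite -meanZ// -[X in X + _](mean_cst P) -meanD//; last 2 first.
- exact: bmeas_cst.
- by apply: bmeasM => //; exact: bmeas_cst.
apply: le_mean.
- exact: bmeas_inv_count.
- apply: bmeasD; first exact: bmeas_cst.
  by apply: bmeasM => //; exact: bmeas_cst.
move=> w; rewrite -expRD.
have tp := t0 n; have k0 := ltr0Sn R k.
have [N0|N0] := posnP (N_ n w).
  by rewrite N0 invr0 addr_ge0 ?expR_ge0// divr_ge0// ltW.
have NR : 0 < ((N_ n w)%:R : R) by rewrite ltr0n.
have [h|h] := leP (k.+1%:R * ((N_ n w)%:R / t n)) 1.
  apply: (@le_trans _ _ 1).
    by rewrite invf_le1// ler1n.
  rewrite -[leLHS]add0r lerD ?divr_ge0 ?(ltW k0) ?(ltW tp)//.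
  by apply: le_trans (expR_ge1Dx _); lra.
rewrite -[leLHS]addr0 lerD ?expR_ge0//.
rewrite ler_pdivlMr// ler_pdivrMl//.
by rewrite mulrA ltr_pdivlMr// mul1r mulrC in h; exact: ltW.
Unshelve. all: by end_near. Qed.

End mean_inverse_count.

Section coefficient_of_variation.
Context {R : realType} d (T : measurableType d) (P : probability T R).
Variables (X : {RV P >-> R}) (Xs : nat -> {RV P >-> R}) (alpha : R).
Context d' (T' : measurableType d') (P' : probability T' R)
  d'' (T'' : measurableType d'') (P'' : probability T'' R).
Variables (N_ : nat -> T -> nat) (t : nat -> R) (L : T' -> R) (U V : T'' -> R).
Hypothesis alpha0 : 0 < alpha.
Hypothesis alpha1 : alpha < 1.
Hypothesis pX : pareto_type X alpha.
Hypothesis mN : forall n, measurable_fun setT (N_ n).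
Hypothesis t0 : forall n, 0 < t n.
Hypothesis ty : t n @[n --> \oo] --> +oo.
Hypothesis mL : measurable_fun setT L.
Hypothesis L0 : P' [set w | 0 < L w] = 1%E.
Hypothesis indep : forall m n (B : nat -> set R), (forall i, measurable (B i)) ->
  \int[P]_w ((N_ m w == n)%:R * \prod_(i < n) \1_(B i) (Xs i w)) =
  \int[P]_w (N_ m w == n)%:R * \prod_(i < n) \int[P]_w \1_(B i) (X w).
Hypothesis NL : forall f : R -> R, continuous f ->
  (exists M : R, forall x, `|f x| <= M) ->
  \int[P]_w f ((N_ n w)%:R / t n) @[n --> \oo] --> \int[P']_w f (L w).
Hypothesis Xpos : {ae P, forall w, forall i, 0 < Xs i w}.

Let mXs i : measurable_fun setT (Xs i). Proof. exact: measurable_funP. Qed.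

Lemma measurable_scaled_sum p a n : measurable_fun setT (scaled_sum Xs p a (N_ n)).
Proof.
apply: (measurable_nat_index
  (F := fun k w => \sum_(i < k) scaled_pos (Xs i) a w ^+ p) (mN n)) => k.
apply: measurable_sum => i; apply: measurable_funX.
exact: measurable_scaled_pos.
Qed.

Lemma scaled_sum_ge0 p a N w : 0 < a -> 0 <= scaled_sum Xs p a N w.
Proof.
by move=> a0; apply: sumr_ge0 => i _; rewrite exprn_ge0// scaled_pos_ge0.
Qed.

Definition scaled_CoVar (N : T -> nat) (w : T) : R :=
  sample_CoVar (N w) (fun i => Xs i w) / Num.sqrt (N w)%:R.

Lemma measurable_scaled_CoVar n : measurable_fun setT (scaled_CoVar (N_ n)).
Proof.
apply: (measurable_nat_index (F := fun k w =>
  sample_CoVar k (fun i => Xs i w) / Num.sqrt k%:R) (mN n)) => k.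
have mc (c : R) : measurable_fun setT (fun _ : T => c) by exact: measurable_cst.
apply: measurable_funM => //.
have mmean : measurable_fun setT (fun w => sample_mean k (fun i => Xs i w)).
  by apply: measurable_funM => //; apply: measurable_sum => i; exact: mXs.
apply: measurable_funM; last exact: (measurableT_comp measurable_invr mmean).
apply: (measurableT_comp (continuous_measurable_fun (@sqrt_continuous R))).
apply: measurable_funM => //; apply: measurable_sum => i.
by apply: measurable_funX; apply: measurable_funB => //; exact: mXs.
Qed.

Lemma exists_limit_law_of_process : exists Q : probability (R * R)%type R,
  has_limit_transform alpha P' L Q fst snd.
Proof.
have [a [a0 UV_]] := cvg_process_transform alpha0 alpha1 pX mN t0 ty indep NL.
apply: (exists_limit_law (P := P) (U_ := fun n => scaled_sum Xs 2 (a n) (N_ n))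
  (V_ := fun n => scaled_sum Xs 1 (a n) (N_ n)) mL L0 alpha0 alpha1).
- by move=> n; exact: measurable_scaled_sum.
- by move=> n; exact: measurable_scaled_sum.
- by move=> n w; exact: scaled_sum_ge0.
- by move=> n w; exact: scaled_sum_ge0.
- exact: UV_.
Qed.

Hypothesis mU : measurable_fun setT U.
Hypothesis mV : measurable_fun setT V.
Hypothesis UV : has_limit_transform alpha P' L P'' U V.

(** A bounded continuous [f] is uniformly continuous on the unit interval,
    where both ratios lie, with a modulus linear in the squared distance; the
    mean of the squared distance is at most that of [1 / N]. *)
Lemma cvg_mean_scaled_CoVar (f : R -> R) : continuous f ->
  (exists M : R, forall x, `|f x| <= M) ->
  \int[P]_w f (scaled_CoVar (N_ n) w) @[n --> \oo] -->
  \int[P'']_w f (Num.sqrt (U w) / V w).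
Proof.
move=> cf bf.
have [a [a0 UV_]] := cvg_process_transform alpha0 alpha1 pX mN t0 ty indep NL.
pose q n w := Num.sqrt (scaled_sum Xs 2 (a n) (N_ n) w) / scaled_sum Xs 1 (a n) (N_ n) w.
have cq : \int[P]_w f (q n w) @[n --> \oo] --> \int[P'']_w f (Num.sqrt (U w) / V w).
  apply: (cvg_mean_ratio (U_ := fun n => scaled_sum Xs 2 (a n) (N_ n))
    (V_ := fun n => scaled_sum Xs 1 (a n) (N_ n)) mL L0 alpha0 alpha1) => //.
  - by move=> n; exact: measurable_scaled_sum.
  - by move=> n; exact: measurable_scaled_sum.
  - by move=> n w; exact: scaled_sum_ge0.
  - by move=> n w; exact: scaled_sum_ge0.
have mq n : measurable_fun setT (q n).
  by apply: measurable_sqrt_ratio; exact: measurable_scaled_sum.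
have close n : {ae P, forall w, [/\ 0 <= q n w <= 1, 0 <= scaled_CoVar (N_ n) w <= 1 &
    (scaled_CoVar (N_ n) w - q n w) ^+ 2 <= (N_ n w)%:R^-1]}.
  apply: filterS Xpos => w w0; have := sample_ratio_close (N_ n w) (a0 n) w0.
  have E p : scaled_sum Xs p (a n) (N_ n) w = \sum_(i < N_ n w) (Xs i w / a n) ^+ p.
    by apply: eq_bigr => i _; rewrite /scaled_pos max_l// ltW.
  by rewrite /q !E.
have qf : quadratic_modulus (fun x _ : R => f x).
  apply: continuous_quadratic_modulus => p.
  by apply: (@continuous_comp _ _ _ (fst : R * R -> R) f); [exact: cvg_fst | exact: cf].
apply: cvg_up_to => e e0; exists (fun n => \int[P]_w f (q n w)).
exists (\int[P'']_w f (Num.sqrt (U w) / V w)); split => //; last by rewrite subrr normr0 ltW.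
have e2 : 0 < e / 2 by rewrite divr_gt0.
have [C C0 fC] := qf _ e2.
have cN := cvg_mean_inv_count mN t0 ty mL L0 NL.
have C1 : 0 < C + 1 by rewrite ltr_wpDl.
near=> n.
have Nn : \int[P]_w (N_ n w)%:R^-1 < e / 2 / (C + 1).
  by near: n; apply: (cvgr_lt _ cN); rewrite divr_gt0.
have bT := bmeas_continuous cf bf (measurable_scaled_CoVar n).
have bq := bmeas_continuous cf bf (mq n).
have bN := bmeas_inv_count (R := R) mN n.
have bCN : bounded_measurable (fun w => C * (N_ n w)%:R^-1).
  by apply: bmeasM => //; exact: bmeas_cst.
rewrite -meanB//; apply: le_trans (le_norm_mean P (bmeasB bT bq)) _.
apply: (@le_trans _ _ (\int[P]_w (e / 2 + C * (N_ n w)%:R^-1))).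
  apply: ae_le_mean; first exact/bmeas_norm/bmeasB.
    by apply: bmeasD => //; exact: bmeas_cst.
  apply: filterS (close n) => w [q01 c01 cqw].
  have z01 : 0 <= (0 : R) <= 1 by rewrite lexx ler01.
  apply: le_trans (fC _ 0 _ 0 c01 z01 q01 z01) _.
  by rewrite lerD2l ler_wpM2l// subrr expr0n addr0.
rewrite meanD//; last exact: bmeas_cst.
rewrite mean_cst meanZ// [leRHS](_ : e = e / 2 + e / 2); last by field.
rewrite lerD2l (@le_trans _ _ ((C + 1) * (e / 2 / (C + 1))))//.
  rewrite ler_pM ?lerDl ?ler01 ?(ltW Nn)//.
  by apply: mean_ge0 => w; rewrite invr_ge0.
by rewrite mulrC divfK// gt_eqF.
Unshelve. all: by end_near. Qed.

End coefficient_of_variation.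

(** * Conclusion *)

Section independent_counts.
Context {R : realType} d (T : measurableType d) (P : probability T R).
Variables (X : {RV P >-> R}) (Xs : nat -> {RV P >-> R}) (N : R -> {RV P >-> nat}).
Hypothesis iid : iid_copies X Xs.
Hypothesis indep : independent_of_sequence N Xs.

Let mX : measurable_fun setT X. Proof. exact: measurable_funP. Qed.
Let mXs i : measurable_fun setT (Xs i). Proof. exact: measurable_funP. Qed.
Let mN t : measurable_fun setT (N t). Proof. exact: measurable_funP. Qed.

Let sample_event n (B : nat -> set R) : set T := \bigcap_(i < n) (Xs i @^-1` B i).

Let measurable_preim (Z : {RV P >-> R}) B : measurable B -> measurable (Z @^-1` B).
Proof.
by move=> mB; rewrite -[X in measurable X]setTI; apply: (measurable_funP Z).
Qed.

Let prob_sample_event n (B : nat -> set R) : (forall i, measurable (B i)) ->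
  P (sample_event n B) = (\prod_(i < n) \int[P]_w \1_(B i) (X w))%:E.
Proof.
move=> mB; have := iid.1 [fset i in iota 0 n]%fset B mB.
have -> : \bigcap_(i in [set` [fset i in iota 0 n]%fset]) Xs i @^-1` B i = sample_event n B.
  by congr bigcap; apply/seteqP; split => i /=; rewrite !inE/= mem_iota.
move=> ->; rewrite -prodEFin (perm_big (iota 0 n)); last first.
  apply: uniq_perm; [exact: fset_uniq | exact: iota_uniq|].
  by move=> i; rewrite !inE.
rewrite (_ : iota 0 n = index_iota 0 n) ?big_mkord; last by rewrite /index_iota subn0.
apply: eq_bigr => i _.
have -> : P (Xs i @^-1` B i) = P (X @^-1` B i) := iid.2 i (B i) (mB i).
have mXB := measurable_preim X (mB i).
rewrite -[LHS]fineK ?fin_num_measure// -mean_indic//.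
Qed.

(** The event [N t = n] and the events on the sample belong to the two
    sigma-algebras that are independent, and the sample is i.i.d. *)
Lemma independent_count_sample t n (B : nat -> set R) : 0 <= t ->
  (forall i, measurable (B i)) ->
  \int[P]_w ((N t w == n)%:R * \prod_(i < n) \1_(B i) (Xs i w)) =
  \int[P]_w (N t w == n)%:R * \prod_(i < n) \int[P]_w \1_(B i) (X w).
Proof.
move=> t0 mB; pose A : set T := N t @^-1` [set n].
have mA : measurable A.
  by rewrite -[X in measurable X]setTI; apply: mN.
have mE : measurable (sample_event n B).
  by apply: bigcap_measurableType => i _; exact: measurable_preim.
have AE w : (N t w == n)%:R = \1_A w :> R.
  rewrite indicE; congr (nat_of_bool _)%:R.
  by apply/eqP/idP => [h|]; rewrite inE.
have BE w : \prod_(i < n) \1_(B i) (Xs i w) = \1_(sample_event n B) w :> R.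
  rewrite indicE; have [/set_mem wE|wE] := boolP (w \in sample_event n B).
    by apply: big1 => i _; rewrite indicE mem_set//; exact: (wE _ (ltn_ord i)).
  have [i iB] : exists i : 'I_n, ~ B i (Xs i w).
    apply: contrapT => h; move/negP : wE; apply; rewrite inE => i /= ilt.
    by apply: contrapT => iB; apply: h; exists (Ordinal ilt).
  by rewrite (bigD1 i)//= indicE memNset// mul0r.
have -> : \int[P]_w ((N t w == n)%:R * \prod_(i < n) \1_(B i) (Xs i w)) =
    \int[P]_w \1_(A `&` sample_event n B) w.
  by apply: eq_mean => w; rewrite AE BE indicI.
have -> : \int[P]_w (N t w == n)%:R = \int[P]_w \1_A w :> R by exact: eq_mean.
rewrite !mean_indic//; last exact: measurableI.
have -> : P (A `&` sample_event n B) = (P A * P (sample_event n B))%E.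
  apply: indep.
    by apply: sub_sigma_algebra; exists t => //; exists [set n] => //; rewrite setTI.
  pose G := \bigcup_(i in setT) preimage_set_system setT (Xs i : T -> R) measurable.
  apply: (@bigcap_measurableType _ (g_sigma_algebraType G)) => i _.
  by apply: sub_sigma_algebra; exists i => //; exists (B i) => //; rewrite setTI.
by rewrite prob_sample_event// fineM// fin_num_measure.
Qed.

End independent_counts.

Section conclusion.
Context {R : realType} d (T : measurableType d) (P : probability T R)
  (X : {RV P >-> R}) (Xs : nat -> {RV P >-> R}) (N : R -> {RV P >-> nat})
  d' (T' : measurableType d') (P' : probability T' R)
  (Lambda : {RV P' >-> R}) (alpha : R).
Hypothesis X0 : P [set w | 0 < X w] = 1%E.
Hypothesis iid : iid_copies X Xs.
Hypothesis indep : independent_of_sequence N Xs.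
Hypothesis alpha0 : 0 < alpha.
Hypothesis alpha1 : alpha < 1.
Hypothesis pX : pareto_type X alpha.
Hypothesis NL : averages_in_time N Lambda.

Let mL : measurable_fun setT Lambda. Proof. exact: measurable_funP. Qed.

Lemma sample_positive : {ae P, forall w, forall i, 0 < Xs i w}.
Proof.
apply/ae_foralln => i; apply: ae_gt0; first exact: measurable_funP.
have posE (Z : {RV P >-> R}) : [set w | 0 < Z w] = Z @^-1` `]0, +oo[%classic.
  by apply/seteqP; split => w /=; rewrite in_itv/= andbT.
have -> : P [set w | 0 < Xs i w] = P [set w | 0 < X w].
  by rewrite !posE; exact: (iid.2 i _ (measurable_itv _)).
exact: X0.
Qed.

Lemma cvg_averages (t : nat -> R) (f : R -> R) : t n @[n --> \oo] --> +oo ->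
  continuous f -> (exists M : R, forall x, `|f x| <= M) ->
  \int[P]_w f ((N (t n) w)%:R / t n) @[n --> \oo] --> \int[P']_w f (Lambda w).
Proof.
move=> ty cf bf; have := NL.2 f cf bf.
have bL := bmeas_continuous cf bf mL.
move=> /cvge_pinftyP /(_ t ty).
rewrite (_ : f \o Lambda = fun w => f (Lambda w))// expectation_bmeas// => /fine_cvg.
rewrite (_ : fine \o _ = fun n => \int[P]_w f ((N (t n) w)%:R / t n))//.
apply/funext => n /=; rewrite expectation_bmeas//.
apply: (bmeas_continuous cf bf); apply: (measurable_nat_index (F := fun k _ => k%:R / t n)).
  exact: (measurable_funP (N (t n))).
by move=> k; exact: measurable_cst.
Qed.

(** The times [n + 1] produce a sequence of pairs whose transforms converge to
    the prescribed one. *)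
Lemma exists_joint_limit_law : exists Q : probability (R * R)%type R,
  has_limit_transform alpha P' Lambda Q fst snd.
Proof.
have t0 n : 0 < (n.+1%:R : R) by rewrite ltr0n.
have ty : (n.+1%:R : R) @[n --> \oo] --> +oo.
  apply/cvgryPge => M; near=> n; rewrite (@le_trans _ _ n%:R) ?ler_nat//.
  by near: n; exact: nbhs_infty_ger.
apply: (exists_limit_law_of_process (N_ := fun n => N n.+1%:R : T -> nat)
  alpha0 alpha1 pX (fun n => measurable_funP (N n.+1%:R)) t0 ty mL NL.1).
- by move=> m n B mB; exact: (independent_count_sample iid indep).
- by move=> f cf bf; exact: cvg_averages.
Unshelve. all: by end_near. Qed.

(** Convergence at infinity is tested along sequences of times, which are
    replaced by their maximum with [1] to make them positive. *)
Lemma cvg_sample_CoVar d'' (T'' : measurableType d'') (P'' : probability T'' R)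
    (U V : {RV P'' >-> R}) :
  has_limit_transform alpha P' Lambda P'' U V ->
  cvg_in_distribution P
    (fun t w => sample_CoVar (N t w) (fun i => Xs i w) / Num.sqrt (N t w)%:R)
    P'' (fun w => Num.sqrt (U w) / V w).
Proof.
move=> UV f cf bf; apply/cvge_pinftyP => u uy.
pose t n := Num.max (u n) 1.
have t0 n : 0 < t n by rewrite lt_max ltr01 orbT.
have ty : t n @[n --> \oo] --> +oo.
  apply/cvgryPge => M; near=> n; rewrite le_max; apply/orP; left.
  by near: n; move/cvgryPge : uy; apply.
have mN n : measurable_fun setT (N (t n)) by exact: measurable_funP.
have c := cvg_mean_scaled_CoVar (N_ := fun n => N (t n) : T -> nat)
  alpha0 alpha1 pX mN t0 ty mL NL.1 _ _ sample_positive (measurable_funP U)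
  (measurable_funP V) UV cf bf.
have mUV : measurable_fun setT (fun w => Num.sqrt (U w) / V w).
  by apply: measurable_sqrt_ratio; exact: measurable_funP.
rewrite (_ : f \o _ = fun w => f (Num.sqrt (U w) / V w))// expectation_bmeas; last exact: (bmeas_continuous cf bf).
have tE n : ('E_P[f \o scaled_CoVar Xs (N (t n))] =
    (\int[P]_w f (scaled_CoVar Xs (N (t n)) w))%:E)%E.
  apply: expectation_bmeas; apply: (bmeas_continuous cf bf).
  exact: (measurable_scaled_CoVar Xs (N_ := fun n => N (t n) : T -> nat) mN n).
have cE : ((\int[P]_w f (scaled_CoVar Xs (N (t n)) w))%:E @[n --> \oo] -->
    (\int[P'']_w f (Num.sqrt (U w) / V w))%:E)%E.
  apply: cvg_EFin; first exact: nearW.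
  apply: c; last by move=> g cg bg; exact: cvg_averages.
  by move=> m n B mB; apply: (independent_count_sample iid indep) => //; exact: ltW.
apply: cvg_trans cE; apply: near_eq_cvg; near=> n; rewrite -tE.
suff -> : t n = u n by [].
by rewrite /t max_l//; near: n; move/cvgryPge : uy; apply.
Unshelve. all: by end_near. Qed.

End conclusion.

Theorem mainTheorem7 (R : realType)
    (d : measure_display) (T : measurableType d) (P : probability T R)
    (X : {RV P >-> R}) (Xs : nat -> {RV P >-> R}) (N : R -> {RV P >-> nat})
    (d' : measure_display) (T' : measurableType d') (P' : probability T' R)
    (Lambda : {RV P' >-> R}) (alpha : R) :
  P [set w | 0 < X w] = 1%E ->
  iid_copies X Xs ->
  counting_process N ->
  independent_of_sequence N Xs ->
  0 < alpha -> alpha < 1 ->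
  pareto_type X alpha ->
  averages_in_time N Lambda ->
  [/\ exists Q : probability (R * R)%type R,
        has_limit_transform alpha P' Lambda Q fst snd,
      forall Q1 Q2 : probability (R * R)%type R,
        has_limit_transform alpha P' Lambda Q1 fst snd ->
        has_limit_transform alpha P' Lambda Q2 fst snd ->
        forall A, measurable A -> Q1 A = Q2 A
    & forall (d'' : measure_display) (T'' : measurableType d'')
             (P'' : probability T'' R) (U V : {RV P'' >-> R}),
        has_limit_transform alpha P' Lambda P'' U V ->
        cvg_in_distribution
          P (fun t w => sample_CoVar (N t w) (fun i => Xs i w)
                        / Num.sqrt (N t w)%:R)
          P'' (fun w => Num.sqrt (U w) / V w)].
Proof.
move=> X0 iid _ indep alpha0 alpha1 pX NL; split.
- exact: (exists_joint_limit_law iid indep alpha0 alpha1 pX NL).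
- move=> Q1 Q2; apply: (limit_law_unique _ NL.1 alpha0 alpha1).
  exact: (measurable_funP Lambda).
- move=> d'' T'' P'' U V UV.
  exact: (cvg_sample_CoVar X0 iid indep alpha0 alpha1 pX NL UV).
Qed.
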